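(* Let $n\ge3$ and $1<p<\infty$. Suppose $(1+|x|^2)^{\tau/2}q\in L_r(\mathbb{R}^n)$, where $\tau r>n$, and $n<r<\infty$ if $1<p\le n$, $p\le r<\infty$ if $p>n$. Let $H$ be the Schrödinger operator in $L_p(\mathbb{R}^n)$ associated with $-\Delta+q$. Then every eigenvalue $\lambda$ of $H$ with $\operatorname{Re}\lambda<0$ satisfies $$|\operatorname{Re}\lambda|^{r-n}\le C_1(n,r)\int_{\mathbb{R}^n}\bigl|(1+|x|^2)^{\tau/2}q(x)\bigr|^r\,dx,$$ where $$C_1(n,r)=\pi^{n/2}\,C(n,r)\,\frac{\Gamma\!\left(\frac{\tau r-n}{2}\right)}{\Gamma\!\left(\frac{\tau r}{2}\right)},\qquad C(n,r)=(4\pi)^{-n}(1-2r^{-1})^{n(r-2)/2}\,\Gamma(1-nr^{-1})^r.$$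
   Context: $\Gamma$ is the gamma function. For $1<p<\infty$, $p'$ is defined by $1/p+1/p'=1$. The complex-valued measurable potential $q$ is factorized as $q=ab$ with $a(x)=(1+|x|^2)^{-\tau/2}$, $b(x)=(1+|x|^2)^{\tau/2}q(x)$. $H_0$ is the operator $-\Delta$ in $L_p(\mathbb{R}^n)$ with domain the Sobolev space $W_p^2(\mathbb{R}^n)$, and $A,B$ are the operators of multiplication by $a,b$ in $L_p(\mathbb{R}^n)$ with maximal domains. For $u\in L_{p,\mathrm{loc}}(\mathbb{R}^n)$ put $M_{\nu,p}(u)=\sup_{x}\int_{|x-y|<1}|u(y)|^p|x-y|^{\nu-n}\,dy$. Standing assumptions: $M_{\nu,p'}(a)<\infty$ for some $0<\nu<p'$; $M_{\mu,p}(b)<\infty$ for some $0<\mu<p$; and $\int_{|x-y|<1}|q(y)|\,dy\to0$ as $|x|\to\infty$. Under these assumptions, for $z\in\mathbb{C}\setminus[0,\infty)$ the operator $B(H_0-z)^{-1}A$ is densely defined and has a unique bounded extension $Q(z)$ to $L_p(\mathbb{R}^n)$, which is compact, and $H_0+AB$ admits a closed extension $H$ with $\sigma_{ess}(H)=\sigma_{ess}(H_0)=[0,\infty)$ such that $\lambda\in\mathbb{C}\setminus[0,\infty)$ is an eigenvalue of $H$ if and only if $-1$ is an eigenvalue of $Q(\lambda)$. This $H$ is the Schrödinger operator associated with $-\Delta+q$. *)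

(* Defs.v *)
From HB Require Import structures.
From mathcomp Require Import all_boot all_order all_algebra.
From mathcomp Require Import complex.
From mathcomp Require Import all_classical all_reals all_analysis.
Set Implicit Arguments.
Unset Strict Implicit.
Unset Printing Implicit Defensive.
Import Order.TTheory GRing.Theory Num.Theory.
Import numFieldNormedType.Exports.
Import Normc.
Local Open Scope classical_set_scope.
Local Open Scope ring_scope.
Local Open Scope complex_scope.

(* The product sigma-algebra on R^n, i.e. the Borel one. A Lebesgue measurable
   function is a.e. equal to a Borel one, so working with Borel functions up to
   a.e. equality loses nothing. *)
Section measurable_rV.
Context {d} {T : sigmaRingType d} (n : nat).

Let coord (i : 'I_n) (x : 'rV[T]_n) : T := x ord0 i.

Let rV_set0 : g_sigma_preimage coord set0.
Proof. exact: sigma_algebra0. Qed.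

Let rV_setC A : g_sigma_preimage coord A -> g_sigma_preimage coord (~` A).
Proof. exact: sigma_algebraC. Qed.

Let rV_bigcup (F : (set 'rV[T]_n)^nat) :
  (forall i, g_sigma_preimage coord (F i)) ->
  g_sigma_preimage coord (\bigcup_i (F i)).
Proof. exact: sigma_algebra_bigcup. Qed.

HB.instance Definition _ := @isMeasurable.Build (measure_tuple_display d)
  'rV[T]_n (g_sigma_preimage coord) rV_set0 rV_setC rV_bigcup.
End measurable_rV.

Lemma measurable_coord_rV d (T : sigmaRingType d) n (i : 'I_n) :
  measurable_fun [set: 'rV[T]_n] (fun x : 'rV[T]_n => x ord0 i).
Proof.
move=> _ Y mY; rewrite setTI; apply: sub_sigma_algebra => /=.
rewrite -bigcup_seq/=; exists i => /=; first by rewrite mem_index_enum.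
by exists Y => //; rewrite setTI.
Qed.

Lemma measurable_fun_rV d1 d2 (T1 : measurableType d1) (T2 : measurableType d2) n
    (f : T1 -> 'rV[T2]_n) :
  (forall i, measurable_fun setT (fun x => f x ord0 i)) ->
  measurable_fun [set: T1] f.
Proof.
move=> mf _ Y mY; rewrite setTI.
have : g_sigma_preimage (fun i (x : 'rV[T2]_n) => x ord0 i) Y := mY.
move: Y {mY}; apply: smallest_sub.
  split => //=.
  - by rewrite preimage_set0.
  - by move=> A mA; rewrite setTD preimage_setC; exact: measurableC.
  - by move=> F mF; rewrite preimage_bigcup; exact: bigcupT_measurable.
move=> A /=; rewrite -bigcup_seq/= => -[i _] [B mB <-].
by rewrite setTI -[X in measurable X]setTI; exact: mf.
Qed.

Definition cons_rV (T : Type) n (z : T * 'rV[T]_n) : 'rV[T]_n.+1 :=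
  row_mx (const_mx z.1 : 'rV[T]_1) z.2.

Definition behead_rV (T : Type) n (x : 'rV[T]_n.+1) : 'rV[T]_n :=
  @rsubmx T 1 1 n x.


Section lebesgue_step.
Local Open Scope ereal_scope.
Context {R : realType} (n : nat).
Variable mu : {sigma_finite_measure set 'rV[R]_n -> \bar R}.

Let leb : {sigma_finite_measure set (measurableTypeR R) -> \bar R} :=
  lebesgue_measure.
Let T : measurableType _ := (measurableTypeR R * 'rV[R]_n)%type.
Let f : T -> 'rV[R]_n.+1 := @cons_rV R n.

Let mf : measurable_fun [set: T] f.
Proof.
apply: measurable_fun_rV => i; rewrite /f /cons_rV.
have [j ->|j ->] := @split_ordP 1 n i.
  rewrite (_ : (fun _ => _) = fst); first exact: measurable_fst.
  by apply/funext => -[a x]; rewrite (@row_mxEl _ 1 1) mxE.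
rewrite (_ : (fun _ => _) = (fun x : 'rV[R]_n => x ord0 j) \o snd); last first.
  by apply/funext => -[a x]; rewrite (@row_mxEr _ 1 1).
exact: (measurableT_comp (measurable_coord_rV j) measurable_snd).
Qed.

Definition lebesgue_cons : set 'rV[R]_n.+1 -> \bar R :=
  pushforward (leb \x mu) (@cons_rV R n).

Let lebesgue_cons0 : lebesgue_cons set0 = 0.
Proof. by rewrite /lebesgue_cons /pushforward preimage_set0 measure0. Qed.

Let lebesgue_cons_ge0 A : 0 <= lebesgue_cons A.
Proof. exact: measure_ge0. Qed.

Let lebesgue_cons_sigma_additive : semi_sigma_additive lebesgue_cons.
Proof.
move=> F mF tF mUF; rewrite /lebesgue_cons /pushforward preimage_bigcup.
apply: (@measure_semi_sigma_additive _ T).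
- by move=> k; rewrite -[X in measurable X]setTI; exact: mf.
- apply/trivIsetP => /= i j _ _ ij; rewrite -preimage_setI.
  by move/trivIsetP : tF => /(_ _ _ _ _ ij) ->//; rewrite preimage_set0.
- by rewrite -preimage_bigcup -[X in measurable X]setTI; exact: mf.
Qed.

HB.instance Definition _ := isMeasure.Build _ _ _ lebesgue_cons
  lebesgue_cons0 lebesgue_cons_ge0 lebesgue_cons_sigma_additive.

Let g (x : 'rV[R]_n.+1) : T := (x ord0 ord0, behead_rV x).

Let fK : cancel f g.
Proof.
case=> a x; rewrite /f /g /cons_rV /behead_rV row_mxKr /=; congr (_, _).
have -> : ord0 = @lshift 1 n ord0 :> 'I_(1 + n) by exact: val_inj.
by rewrite (@row_mxEl _ 1 1) mxE.
Qed.

Let mg : measurable_fun setT g.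
Proof.
apply/measurable_fun_pairP; split; first exact: (measurable_coord_rV ord0).
apply: measurable_fun_rV => i; rewrite /g /behead_rV /=.
under eq_fun do rewrite /= mxE.
exact: (measurable_coord_rV (rshift 1 i)).
Qed.

Let sigma_finite_lebesgue_cons : sigma_finite setT lebesgue_cons.
Proof.
have [F [TF mF]] : exists F : (set T)^nat, setT = \bigcup_k F k /\
    forall k, measurable (F k) /\ (leb \x mu) (F k) < +oo.
  have /sigma_finiteP[F [TF ndF Foo]] := sigma_finiteT leb.
  have /sigma_finiteP[G [TG ndG Goo]] := sigma_finiteT mu.
  exists (fun n => F n `*` G n); split.
    rewrite -setXTT TF TG predeqE => -[x y]; split.
      move=> [/= [k _ Fnx] [l _ Gky]]; exists (maxn k l) => //; split.
      - by move: x Fnx; exact/subsetPset/ndF/leq_maxl.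
      - by move: y Gky; exact/subsetPset/ndG/leq_maxr.
    by move=> [k _ []/= ? ?]; split; exists k.
  move=> k; have [? ?] := Foo k; have [? ?] := Goo k.
  split; first exact: measurableX.
  by rewrite product_measure1E// lte_mul_pinfty// ge0_fin_numE.
exists (fun k => g @^-1` F k).
  by rewrite -preimage_bigcup -TF preimage_setT.
move=> k; have [mFk Fk] := mF k; split.
  by rewrite -[X in measurable X]setTI; exact: mg.
rewrite /lebesgue_cons /pushforward -comp_preimage.
by rewrite (_ : g \o @cons_rV R n = id)//; exact/funext/fK.
Qed.

HB.instance Definition _ := @Measure_isSigmaFinite.Build _ _ _
  lebesgue_cons sigma_finite_lebesgue_cons.

End lebesgue_step.

Fixpoint lebesgue_rV {R : realType} (n : nat) :
    {sigma_finite_measure set 'rV[R]_n -> \bar R} :=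
  match n with
  | 0 => dirac (0 : 'rV[R]_0)
  | m.+1 => lebesgue_cons (lebesgue_rV m)
  end.

(* Together with sigma-finiteness this characterizes Lebesgue measure. *)
Lemma lebesgue_rV_box (R : realType) n (A : 'I_n -> set R) :
  (forall i, measurable (A i)) ->
  lebesgue_rV n [set x | forall i, A i (x ord0 i)] =
  (\prod_(i < n) lebesgue_measure (A i))%E.
Proof.
elim: n A => [|n IHn] A mA.
  by rewrite big_ord0 /= diracE mem_set// => -[].
pose B := [set x : 'rV[R]_n | forall i, A (lift ord0 i) (x ord0 i)].
have mB : measurable B.
  rewrite (_ : B = \bigcap_k if insub k is Some i then
      (fun x : 'rV[R]_n => x ord0 i) @^-1` A (lift ord0 i) else setT).
    apply: bigcapT_measurable => k; case: insub => [i|//].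
    rewrite -[X in measurable X]setTI.
    exact: (@measurable_coord_rV _ R n i).
  apply/seteqP; split => x /= Bx.
    by move=> k _; case: insub => // i; exact: Bx.
  by move=> i; have := Bx i Logic.I; rewrite valK.
rewrite big_ord_recl -IHn// -/B.
rewrite -(product_measure1E lebesgue_measure (lebesgue_rV n) (mA ord0) mB).
rewrite /= /lebesgue_cons /pushforward; congr (product_measure1 _ _ _).
have e0 : @lshift 1 n ord0 = ord0 by exact: val_inj.
have e1 i : @rshift 1 n i = lift ord0 i by exact: val_inj.
apply/seteqP; split => -[a x]; rewrite /cons_rV /=.
  move=> h; split => [|i].
    by have := h (@lshift 1 n ord0); rewrite (@row_mxEl _ 1 1) mxE e0.
  by have := h (@rshift 1 n i); rewrite (@row_mxEr _ 1 1) e1.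
move=> [h0 h] i; have [j ->|j ->] := @split_ordP 1 n i.
  by rewrite (@row_mxEl _ 1 1) mxE (ord1 j) e0.
by rewrite (@row_mxEr _ 1 1) e1; exact: h.
Qed.

Section Lp_functions.
Context {R : realType} {n : nat}.
Local Notation Rn := 'rV[R]_n.
Local Notation mu := (@lebesgue_rV R n).
Implicit Types (p : R) (u v f g : Rn -> R[i]).

(* The norm that the library puts on 'rV[R]_n is the sup norm. *)
Definition enorm (x : Rn) : R := Num.sqrt (\sum_(i < n) x ord0 i ^+ 2).

Definition cmeasurable f : Prop :=
  measurable_fun setT (fun x => complex.Re (f x)) /\
  measurable_fun setT (fun x => complex.Im (f x)).

Definition cLnorm p f : \bar R := 'N[mu]_p%:E[EFin \o (fun x => normc (f x))]%E.

Definition Lp p f : Prop := cmeasurable f /\ (cLnorm p f < +oo)%E.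

Definition Lp_cvg p (u : nat -> Rn -> R[i]) v : Prop :=
  cLnorm p (fun x => u k x - v x) @[k --> \oo] --> 0%E.

Definition cintegral f : R[i] :=
  (\int[mu]_x complex.Re (f x)) +i* (\int[mu]_x complex.Im (f x)).

Definition pderiv (s : seq 'I_n) (phi : Rn -> R) : Rn -> R :=
  foldr (fun i psi x => 'D_(delta_mx ord0 i) psi x) phi s.

Definition test_function (phi : Rn -> R) : Prop :=
  [/\ forall s i x, derivable (pderiv s phi) x (delta_mx ord0 i),
      forall s, continuous (pderiv s phi)
    & compact (closure [set x | phi x != 0])].

(* Real-valued test functions suffice, both sides being C-linear in phi. *)
Definition weak_deriv (s : seq 'I_n) u v : Prop :=
  forall phi, test_function phi ->
    cintegral (fun x => u x * (pderiv s phi x)%:C) =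
    (-1) ^+ size s * cintegral (fun x => v x * (phi x)%:C).

Definition sobolev (k : nat) p u : Prop :=
  Lp p u /\
  forall s, (size s <= k)%N -> exists v, Lp p v /\ weak_deriv s u v.

End Lp_functions.

(* A (possibly unbounded) operator in L_p(R^n) is given by its graph, a relation
   between representatives of elements of L_p(R^n). The operations below make
   sense for arbitrary relations; [operator] singles out the graphs of linear
   operators on a.e. equality classes. *)
Section operators.
Context {R : realType} {n : nat}.
Local Notation Rn := 'rV[R]_n.
Local Notation mu := (@lebesgue_rV R n).
Local Notation rel_op := ((Rn -> R[i]) -> (Rn -> R[i]) -> Prop).
Variable p : R.
Implicit Types (S T : rel_op) (z : R[i]).

Record operator T : Prop := Operator {
  operator_Lp : forall u f, T u f -> Lp p u /\ Lp p f ;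
  operator_ae : forall u f v g, T u f -> Lp p v -> Lp p g ->
    u = v %[ae mu] -> f = g %[ae mu] -> T v g ;
  operator_zero : T (fun=> 0) (fun=> 0) ;
  operator_linear : forall c u f v g, T u f -> T v g ->
    T (fun x => c * u x + v x) (fun x => c * f x + g x) ;
  operator_functional : forall u f g, T u f -> T u g -> f = g %[ae mu] }.

Definition op_extends T S : Prop := forall u f, S u f -> T u f.

Definition op_add S T : rel_op := fun u f =>
  Lp p f /\ exists g h, [/\ S u g, T u h & f = (fun x => g x + h x) %[ae mu]].

Definition op_comp S T : rel_op := fun u f => exists g, T u g /\ S g f.

Definition op_inv T : rel_op := fun f u => T u f.

(* T - z *)
Definition op_shift T z : rel_op := fun u f =>
  Lp p f /\ exists g, T u g /\ f = (fun x => g x - z * u x) %[ae mu].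

(* multiplication by m, on its maximal domain *)
Definition mul_op (m : Rn -> R[i]) : rel_op := fun u f =>
  [/\ Lp p u, Lp p f & f = (fun x => m x * u x) %[ae mu]].

(* -Delta with domain W^2_p(R^n) *)
Definition neg_laplacian : rel_op := fun u f =>
  [/\ sobolev 2 p u, Lp p f &
    exists v : 'I_n -> Rn -> R[i],
      (forall i, Lp p (v i) /\ weak_deriv [:: i; i] u (v i)) /\
      f = (fun x => - \sum_(i < n) v i x) %[ae mu]].

Definition closed_operator T : Prop :=
  operator T /\
  forall (u f : nat -> Rn -> R[i]) v g,
    (forall k, T (u k) (f k)) -> Lp p v -> Lp p g ->
    Lp_cvg p u v -> Lp_cvg p f g -> T v g.

Definition densely_defined T : Prop :=
  forall f, Lp p f -> forall e : R, 0 < e ->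
    exists u g, T u g /\ (cLnorm p (fun x => f x - u x)%R < e%:E)%E.

(* Q is the bounded operator on the whole of L_p(R^n) extending T; it is unique
   because T is densely defined. *)
Definition bounded_extension T Q : Prop :=
  [/\ densely_defined T, operator Q, forall f, Lp p f -> exists g, Q f g,
      exists M : R, forall f g, Q f g -> (cLnorm p g <= M%:E * cLnorm p f)%E
    & op_extends Q T].

Definition op_eigenvalue T z : Prop :=
  exists u, ~ (u = (fun=> 0) %[ae mu]) /\ T u (fun x => z * u x).

Definition fredholm T : Prop :=
  [/\ exists m (e : 'I_m -> Rn -> R[i]), forall u, T u (fun=> 0) ->
        exists c : 'I_m -> R[i], u = (fun x => \sum_(j < m) c j * e j x) %[ae mu],
      forall f g, (forall k : nat, exists u, T u (f k)) -> Lp p g ->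
        Lp_cvg p f g -> exists u, T u g
    & exists m (e : 'I_m -> Rn -> R[i]), (forall j, Lp p (e j)) /\
        forall f, Lp p f -> exists (c : 'I_m -> R[i]) u,
          T u (fun x => f x - \sum_(j < m) c j * e j x)].

Definition ess_spectrum T : set R[i] := [set z | ~ fredholm (op_shift T z)].

End operators.

Section schrodinger.
Context {R : realType} {n : nat}.
Local Notation Rn := 'rV[R]_n.
Local Notation mu := (@lebesgue_rV R n).
Variables (p tau : R) (q : Rn -> R[i]).

Definition factor_a (x : Rn) : R[i] :=
  ((1 + enorm x ^+ 2) `^ (- (tau / 2)))%:C.

Definition factor_b (x : Rn) : R[i] :=
  ((1 + enorm x ^+ 2) `^ (tau / 2))%:C * q x.

(* For nu < n the library's convention 0 `^ (nu - n) = 0 only affects the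
   integrand at y = x. *)
Definition M_sup (nu s : R) (u : Rn -> R[i]) : \bar R :=
  ereal_sup (range (fun x : Rn =>
    \int[mu]_(y in [set y | (enorm (x - y) < 1)%R])
      (normc (u y) `^ s * enorm (x - y) `^ (nu - n%:R))%:E)%E).

(* p', with 1 / p + 1 / p' = 1 *)
Definition conj_exponent : R := (1 - p^-1)^-1.

Definition standing_assumptions : Prop :=
  [/\ exists nu : R, [/\ 0 < nu, nu < conj_exponent
        & (M_sup nu conj_exponent factor_a < +oo)%E],
      exists nu : R, [/\ 0 < nu, nu < p & (M_sup nu p factor_b < +oo)%E]
    & forall e : R, 0 < e -> exists rho : R, forall x : Rn, rho < enorm x ->
        (\int[mu]_(y in [set y | (enorm (x - y) < 1)%R]) (normc (q y))%:E < e%:E)%E].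

Local Notation H0 := (@neg_laplacian R n p).
Local Notation A := (mul_op p factor_a).
Local Notation B := (mul_op p factor_b).

(* B (H0 - z)^-1 A *)
Definition birman_schwinger (z : R[i]) :
    (Rn -> R[i]) -> (Rn -> R[i]) -> Prop :=
  op_comp B (op_comp (op_inv (op_shift p H0 z)) A).

(* In the partial order of R[i], 0 <= z means that z lies in [0, +oo[. *)
Record schrodinger_operator (H : (Rn -> R[i]) -> (Rn -> R[i]) -> Prop) : Prop :=
  SchrodingerOperator {
  schrodinger_closed : closed_operator p H ;
  schrodinger_extends : op_extends H (op_add p H0 (op_comp A B)) ;
  schrodinger_ess_spectrum :
    ess_spectrum p H = ess_spectrum p H0 /\
    ess_spectrum p H0 = [set z | 0 <= z] ;
  schrodinger_eigenvalue : forall z, ~ 0 <= z ->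
    (op_eigenvalue H z <->
     exists Q, bounded_extension p (birman_schwinger z) Q /\ op_eigenvalue Q (- 1))
  }.

End schrodinger.

Definition Gamma {R : realType} (s : R) : R :=
  \int[lebesgue_measure]_(t in `]0, +oo[) (t `^ (s - 1) * expR (- t)).

Definition C_const {R : realType} (n : nat) (r : R) : R :=
  (4 * pi) ^- n * (1 - 2 * r^-1) `^ (n%:R * (r - 2) / 2) *
  Gamma (1 - n%:R * r^-1) `^ r.

Definition C1_const {R : realType} (n : nat) (r tau : R) : R :=
  pi `^ (n%:R / 2) * C_const n r *
  (Gamma ((tau * r - n%:R) / 2) / Gamma (tau * r / 2)).

(* Main.v *)
(* The kernel of (-Delta - lambda)^-1 is int_0^oo e^(lambda t) k_t dt, k_t being the heat
   kernel, so for lambda = -c + i beta it is dominated by that of (c - Delta)^-1. An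
   eigenfunction of Q(lambda) for the eigenvalue -1 thus yields u <> 0 in L_p with
   |u| <= K |u|, where K = |b| (c - Delta)^-1 a. If a, b are in L_r, Hoelder's inequality
   applied to the integral over t and y gives
       ||K h||_p <= S ||a||_r ||b||_r ||h||_p   for r' <= p <= r,
       S = int_0^oo e^(-c t) ||k_t||_m dt,   1/m = 1 - 2/r,
   hence 1 <= S ||a||_r ||b||_r, whose r-th power is the claim; for p < r' one first gets
   u in L_r' from a <= 1.

   The domination is proved by testing the weak equation with Gaussians (cut off to become
   test functions), which turns it into an ODE in t for the heat flow of the solution; the
   flow is integrated in t, and the limit t -> 0 is taken in integrals over boxes. *)

Require Import Defs.
From HB Require Import structures.
From mathcomp Require Import all_boot all_order all_algebra.
From mathcomp Require Import complex.
From mathcomp Require Import ring lra.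
From mathcomp Require Import all_classical all_reals all_analysis measurable_realfun.
Set Implicit Arguments.
Unset Strict Implicit.
Unset Printing Implicit Defensive.
Import Order.TTheory GRing.Theory Num.Theory.
Import numFieldNormedType.Exports.
Local Open Scope classical_set_scope.
Local Open Scope ring_scope.

(** * Gaussian integrals over R^n *)

(** Weak derivatives are defined by compactly supported test functions alone, and no Fourier
    transform or semigroup theory is used: the heat kernel itself is the test function, and Fubini
    over a time interval [e, T] with e > 0 takes the place of differentiation under the integral
    sign. An eigenfunction u of the extension [Q] need not lie in the domain of B(H0 - z)^-1 A. It
    is only a limit of functions v of that domain, for which |Q v| <= K |v| holds pointwise. The
    passage to |u| <= K |u| therefore already uses that K is bounded from L_p to some L_p1, and it
    is made in measure. The explicit constant comes from k_t = N t^(-n/r) (k_(s t))^s with s = 1 -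
    2/r: a power of a Gaussian is again a Gaussian, so the norm in S is known, and its time integral
    is a multiple of c^(-(1 - n/r)) Gamma(1 - n/r), convergent because r > n. Hoelder's inequality
    is obtained from the pointwise weighted arithmetic-geometric mean, each factor being scaled by a
    bound for its integral. *)

Section rV_integral.
Context {R : realType}.
Local Open Scope ereal_scope.
Local Notation mu := (@lebesgue_rV R).
Local Notation leb := (@lebesgue_measure R).

Lemma measurable_cons_rV n :
  measurable_fun [set: measurableTypeR R * 'rV[R]_n] (@cons_rV R n).
Proof.
apply: measurable_fun_rV => i; rewrite /cons_rV.
have [j ->|j ->] := @split_ordP 1 n i.
  under eq_fun do rewrite (@row_mxEl _ 1 1) mxE; exact: measurable_fst.
under eq_fun do rewrite (@row_mxEr _ 1 1).
exact: (measurableT_comp (measurable_coord_rV j) measurable_snd).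
Qed.

Lemma cons_rV0 n (a : R) (x : 'rV[R]_n) : cons_rV (a, x) ord0 ord0 = a.
Proof.
transitivity ((const_mx a : 'rV[R]_1) ord0 ord0); last by rewrite mxE.
rewrite -(@row_mxEl R 1 1 n (const_mx a) x ord0 ord0).
by congr (row_mx _ _ _ _); exact: val_inj.
Qed.

Lemma cons_rVS n (a : R) (x : 'rV[R]_n) i :
  cons_rV (a, x) ord0 (lift ord0 i) = x ord0 i.
Proof.
rewrite -(@row_mxEr R 1 1 n (const_mx a) x ord0 i).
by congr (row_mx _ _ _ _); exact: val_inj.
Qed.

Lemma ge0_integral_lebesgue_cons n (F : 'rV[R]_n.+1 -> \bar R) :
  measurable_fun [set: 'rV[R]_n.+1] F -> (forall x, 0 <= F x) ->
  \int[mu n.+1]_x F x = \int[leb]_a \int[mu n]_x F (cons_rV (a, x)).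
Proof.
move=> mF F0.
have mc := @measurable_cons_rV n.
rewrite /= /lebesgue_cons.
rewrite (@ge0_integral_pushforward _ _ (measurableTypeR R * 'rV[R]_n)%type _ _
  _ mc (lebesgue_measure \x mu n) setT)//.
rewrite preimage_setT fubini_tonelli1 //; last by move=> z; exact: F0.
exact: measurableT_comp mF mc.
Qed.

Lemma ge0_integral_rV_prod n (F : 'I_n -> R -> R) :
  (forall i, measurable_fun setT (F i)) -> (forall i s, (0 <= F i s)%R) ->
  \int[mu n]_x (\prod_i F i (x ord0 i))%:E = \prod_i \int[leb]_s (F i s)%:E.
Proof.
elim: n F => [|n IHn] F mF F0.
  under eq_integral do rewrite big_ord0.
  by rewrite integral_cst//= diracT mule1 big_ord0.
rewrite ge0_integral_lebesgue_cons//; last 2 first.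
- apply/measurable_EFinP/measurable_prod => i _.
  exact: measurableT_comp (mF i) (measurable_coord_rV i).
- by move=> x; rewrite lee_fin prodr_ge0.
rewrite big_ord_recl -IHn//.
have h a x : (\prod_(i < n.+1) F i (cons_rV (a, x) ord0 i) =
   F ord0 a * \prod_(i < n) F (lift ord0 i) (x ord0 i))%R.
  rewrite big_ord_recl cons_rV0; congr (_ * _)%R.
  by apply: eq_bigr => i _; rewrite cons_rVS.
have m2 : measurable_fun [set: 'rV[R]_n]
    (fun x : 'rV[R]_n => \prod_(i < n) F (lift ord0 i) (x ord0 i))%R.
  apply: measurable_prod => i _.
  exact: measurableT_comp (mF _) (measurable_coord_rV i).
have p2 (x : 'rV[R]_n) : (0 <= \prod_(i < n) F (lift ord0 i) (x ord0 i))%R.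
  by rewrite prodr_ge0.
transitivity (\int[leb]_a ((F ord0 a)%:E *
    \int[mu n]_x (\prod_(i < n) F (lift ord0 i) (x ord0 i))%:E)).
  apply: eq_integral => a _; rewrite -ge0_integralZl//.
  - by apply: eq_integral => x _; rewrite h EFinM.
  - exact/measurable_EFinP.
  - by move=> x _; rewrite lee_fin.
  - by rewrite lee_fin.
rewrite ge0_integralZr//.
- by apply/measurable_EFinP; exact: mF.
- by move=> x _; rewrite lee_fin.
- by apply: integral_ge0 => x _; rewrite lee_fin.
Qed.

Lemma measurable_gauss1 (l s : R) :
  measurable_fun setT (fun x : R => expR (- (l * (x - s) ^+ 2))).
Proof.
apply: measurableT_comp; first exact: measurable_expR.
apply: measurableT_comp => //; apply: measurable_funM => //.
by apply: measurable_funX; exact: measurable_funB.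
Qed.

(** Read off from the total mass 1 of the normal density with mean [s] and variance 1/(2 l), whose
    peak is the inverse of the right-hand side. *)
Lemma integral_gauss1 (l s : R) : (0 < l)%R ->
  \int[leb]_x (expR (- (l * (x - s) ^+ 2)))%:E = (Num.sqrt (pi / l))%:E.
Proof.
move=> l0; pose sg := Num.sqrt ((l *+ 2)^-1).
have sg0 : sg != 0%R by rewrite gt_eqF// sqrtr_gt0 invr_gt0 mulrn_wgt0.
have sg2 : (sg ^+ 2 = (l *+ 2)^-1)%R.
  by rewrite sqr_sqrtr// invr_ge0 mulrn_wge0// ltW.
have := integral_normal_pdf s sg; rewrite normal_pdfE//.
under eq_integral do rewrite EFinM.
have pk : normal_peak sg = ((Num.sqrt (pi / l))^-1)%R.
  rewrite /normal_peak sg2; congr (Num.sqrt _)^-1%R.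
  rewrite -mulr_natr -(mulr_natr l); field; exact: lt0r_neq0.
have pk0 : (0 < Num.sqrt (pi / l))%R by rewrite sqrtr_gt0 divr_gt0// pi_gt0.
have E x : normal_fun s sg x = expR (- (l * (x - s) ^+ 2)).
  rewrite /normal_fun sg2; congr expR.
  rewrite -(mulr_natr l) -(mulr_natr _^-1); field; exact: lt0r_neq0.
under eq_integral do rewrite E.
rewrite ge0_integralZl//; first last.
- by rewrite lee_fin normal_peak_ge0.
- by apply/measurable_EFinP; exact: measurable_gauss1.
rewrite pk => /(congr1 (fun z => (Num.sqrt (pi / l))%:E * z)).
by rewrite muleA -EFinM divff ?gt_eqF// mul1e mule1.
Qed.

Definition sqnorm n (x : 'rV[R]_n) : R := (\sum_(i < n) x ord0 i ^+ 2)%R.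

Lemma sqnorm_ge0 n (x : 'rV[R]_n) : (0 <= sqnorm x)%R.
Proof. by apply: sumr_ge0 => i _; rewrite sqr_ge0. Qed.

Lemma expR_sqnorm n l (x : 'rV[R]_n) :
  expR (- (l * sqnorm x)) = (\prod_(i < n) expR (- (l * x ord0 i ^+ 2)))%R.
Proof. by rewrite -expR_sum sumrN mulr_sumr. Qed.

Lemma measurable_sqnorm n : measurable_fun [set: 'rV[R]_n] (@sqnorm n).
Proof.
apply: measurable_sum => i.
exact: (measurable_funX _ (measurable_coord_rV i)).
Qed.

Lemma integral_gauss n (l : R) (x : 'rV[R]_n) : (0 < l)%R ->
  \int[mu n]_y (expR (- (l * sqnorm (x - y))))%:E = (Num.sqrt (pi / l) ^+ n)%:E.
Proof.
move=> l0; under eq_integral do rewrite expR_sqnorm.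
pose F (i : 'I_n) (s : R) := expR (- (l * (s - x ord0 i) ^+ 2)).
transitivity (\int[mu n]_y (\prod_i F i (y ord0 i))%:E).
  apply: eq_integral => y _; congr EFin; apply: eq_bigr => i _.
  by rewrite /F !mxE -sqrrN opprB.
rewrite ge0_integral_rV_prod /F.
- under eq_bigr do rewrite integral_gauss1//.
  by rewrite prodEFin prodr_const card_ord.
- by move=> i; exact: measurable_gauss1.
- by move=> i s; rewrite expR_ge0.
Qed.

Lemma integral_gauss_sym n (l : R) (y : 'rV[R]_n) : (0 < l)%R ->
  \int[mu n]_x (expR (- (l * sqnorm (x - y))))%:E = (Num.sqrt (pi / l) ^+ n)%:E.
Proof.
move=> l0; rewrite -(integral_gauss y l0); apply: eq_integral => x _.
congr (expR (- (l * _)))%:E; apply: eq_bigr => i _.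
by rewrite !mxE -sqrrN opprB.
Qed.

End rV_integral.

(** * Functions determined by their integrals over boxes *)

Section boxes.
Context {R : realType} (n : nat).
Local Open Scope ereal_scope.
Local Notation mu := (@lebesgue_rV R n).

Definition box (a b : 'I_n -> R) : set 'rV[R]_n :=
  [set x | forall i, x ord0 i \in `]a i, b i]].

Definition cube (N : nat) : set 'rV[R]_n := box (fun=> - N%:R)%R (fun=> N%:R)%R.

Lemma boxE a b :
  box a b = [set x | forall i, `]a i, b i]%classic (x ord0 i)].
Proof. by []. Qed.

Lemma measurable_box a b : measurable (box a b).
Proof.
rewrite (_ : box a b = \bigcap_k if insub k is Some i then
    (fun x : 'rV[R]_n => x ord0 i) @^-1` `]a i, b i]%classic else setT).
  apply: bigcapT_measurable => k; case: insub => [i|//].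
  rewrite -[X in measurable X]setTI.
  by apply: (@measurable_coord_rV _ R n i).
apply/seteqP; split => x /= Bx; first by move=> k _; case: insub => // i; exact: Bx.
by move=> i; have := Bx i Logic.I; rewrite valK.
Qed.

Lemma lebesgue_box_fin a b : mu (box a b) < +oo.
Proof.
rewrite boxE (lebesgue_rV_box (fun i => measurable_itv `]a i, b i]))//.
have : (forall i, lebesgue_measure `]a i, b i]%classic \is a fin_num).
  move=> i; rewrite lebesgue_measure_itv/=; by case: ifP.
by move=> h; rewrite ltey_eq prode_fin_num.
Qed.

Lemma box_setI a b a' b' :
  box a b `&` box a' b' =
  box (fun i => Num.max (a i) (a' i)) (fun i => Num.min (b i) (b' i)).
Proof.
apply/seteqP; split => x /=.
  move=> [h1 h2] i; have := h1 i; have := h2 i.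
  by rewrite !in_itv/= => /andP[u1 u2] /andP[u3 u4]; rewrite gt_max ?le_min u1 u2 u3 u4.
move=> h; split => i; have := h i; rewrite !in_itv/= gt_max le_min;
 by move=> /andP[/andP[u1 u2] /andP[u3 u4]]; apply/andP.
Qed.

Lemma in_cube (x : 'rV[R]_n) : exists N, cube N x.
Proof.
exists (\sum_i Num.bound `|x ord0 i|)%N.+1 => i.
have h : (`|x ord0 i| < (\sum_i Num.bound `|x ord0 i|)%N.+1%:R)%R.
  apply: lt_le_trans (archi_boundP (normr_ge0 _)) _.
  by rewrite ler_nat (bigD1 i)//= -addnS leq_addr.
by move: h; rewrite ltr_norml in_itv/= => /andP[-> /ltW ->].
Qed.

Definition boxes : set (set 'rV[R]_n) := [set B | exists a b, B = box a b].

(** Only the slabs x_i in ]u, v] have to be generated by boxes; such a slab is the union over N of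
    the boxes whose other sides are ]-N, N]. *)
Lemma measurable_rV_boxes : @measurable _ 'rV[R]_n = <<s boxes >>.
Proof.
apply/seteqP; split; last first.
  apply: smallest_sub; first exact: sigma_algebra_measurable.
  by move=> _ [a [b ->]]; exact: measurable_box.
pose T := g_sigma_algebraType boxes.
have mT i : measurable_fun [set: T] (fun x : T => (x : 'rV[R]_n) ord0 i).
  apply: (@measurability _ _ T R setT _ (@ocitv R)) => //.
  move=> _ [_ [[u v]] _ <- <-]; rewrite setTI /=.
  rewrite (_ : _ @^-1` _ = \bigcup_N box (fun j => if j == i then u else - N%:R)%R
     (fun j => if j == i then v else N%:R)).
    apply: (@bigcupT_measurable _ T) => N; apply: sub_sigma_algebra.
    by exists (fun j => if j == i then u else - N%:R)%R,
     (fun j => if j == i then v else N%:R)%R.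
  apply/seteqP; split => x /=.
    move=> uv; have [N hN] := in_cube x; exists N => // j.
    by case: eqP => [->//|_]; exact: hN.
  by move=> [N _ /(_ i)]; rewrite eqxx.
apply: smallest_sub; first exact: smallest_sigma_algebra.
move=> A /=; rewrite -bigcup_seq/= => -[i _] [B mB <-].
exact: (mT i measurableT B mB).
Qed.

(** A pi-lambda argument on each cube: boxes are stable under intersection and generate the Borel
    sets, and the sets on which the two integrals agree form a Dynkin class. The cubes exhaust the
    space, so local integrability is enough. *)
Lemma integral_boxes_ae_eq (f g : 'rV[R]_n -> \bar R) :
  (forall N, mu.-integrable (cube N) f) -> (forall N, mu.-integrable (cube N) g) ->
  (forall a b, \int[mu]_(x in box a b) f x = \int[mu]_(x in box a b) g x) ->
  ae_eq mu setT f g.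
Proof.
move=> intf intg fg.
have mc N : measurable (cube N) by exact: measurable_box.
have H N : ae_eq mu (cube N) f g.
  apply: integral_ae_eq => //; first exact: (measurable_int mu (intg N)).
  suff h A : measurable A -> \int[mu]_(x in cube N `&` A) f x = \int[mu]_(x in cube N `&` A) g x.
    by move=> E EN mE; have := h _ mE; rewrite setIidr.
  rewrite measurable_rV_boxes.
  apply: (@dynkin_induction _ _ boxes (fun A =>
    \int[mu]_(x in cube N `&` A) f x = \int[mu]_(x in cube N `&` A) g x)).
  - exact: measurable_rV_boxes.
  - by move=> _ _ [a [b ->]] [a' [b' ->]]; rewrite box_setI; eexists; eexists.
  - by rewrite setIT; exact: fg.
  - by move=> _ [a [b ->]]; rewrite /cube box_setI; exact: fg.
  - move=> S mS IH.
    (* The complement is reached by subtraction, legitimate because integrals over parts of the cube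
       are finite. *)
    have K (h : 'rV[R]_n -> \bar R) : mu.-integrable (cube N) h ->
        \int[mu]_(x in cube N `&` ~` S) h x = \int[mu]_(x in cube N) h x -
          \int[mu]_(x in cube N `&` S) h x.
      move=> ih.
      have -> : \int[mu]_(x in cube N) h x = \int[mu]_(x in cube N `&` S) h x +
          \int[mu]_(x in cube N `&` ~` S) h x.
        rewrite -integral_setU ?setIUr ?setUCr ?setIT//.
        - by rewrite -setIUr setUCr setIT.
        - exact: measurableI.
        - by apply: measurableI => //; exact: measurableC.
        - by rewrite -setIUr setUCr setIT; exact: (measurable_int mu ih).
        - by apply/disj_setPS => x [[_ ?] [_ ?]].
      rewrite addeAC subee ?add0e//.
      apply: integrable_fin_num => //; first exact: measurableI.
      by apply: integrableS ih => //; exact: measurableI.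
    by rewrite !K// IH; congr (_ - _); exact: fg.
  - move=> F mF tF IH.
    rewrite setI_bigcupr !integral_bigcup//.
    + by apply: eq_eseriesr => k _; exact: IH.
    + exact: trivIset_setIl.
    + by move=> k; exact: measurableI.
    + by rewrite -setI_bigcupr; apply: integrableS (intg N) => //; apply: measurableI => //; exact: bigcupT_measurable.
    + exact: trivIset_setIl.
    + by move=> k; exact: measurableI.
    + by rewrite -setI_bigcupr; apply: integrableS (intf N) => //; apply: measurableI => //; exact: bigcupT_measurable.
apply: (@negligibleS _ _ _ mu (\bigcup_N ~` [set x | cube N x -> f x = g x])).
  move=> x /= /not_implyP[_ fgx]; have [N Nx] := in_cube x.
  by exists N => //= /(_ Nx).
by apply: negligible_bigcup => N; exact: H.
Qed.

End boxes.

(** * Smooth functions and cut-offs on the line *)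

Section smooth.
Context {R : realType}.
Implicit Types f g : R -> R.

(** Each level carries an explicit derivative, so that closed formulas, such as those for Gaussians
    and for [flat], give smoothness by induction on [k] without iterating [derive1]. *)
Fixpoint Ck (k : nat) f : Prop :=
  if k is k'.+1 then
    exists2 f' : R -> R, forall x : R, is_derive x 1 f (f' x) & Ck k' f'
  else True.

Definition smooth f := forall k, Ck k f.

Lemma CkW k f : Ck k.+1 f -> Ck k f.
Proof.
elim: k f => [//|k IH] f /= [f' df ckf].
by exists f' => //; exact: IH.
Qed.

Lemma Ck_cst k (c : R) : Ck k (fun=> c).
Proof.
elim: k c => [//|k IH] c /=; exists (fun=> 0); last exact: IH.
by move=> x; exact: is_derive_cst.
Qed.

Lemma CkD k f g : Ck k f -> Ck k g -> Ck k (fun x => f x + g x).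
Proof.
elim: k f g => [//|k IH] f g [f' df cf] [g' dg cg]; exists (fun x => f' x + g' x).
  by move=> x; exact: is_deriveD.
exact: IH.
Qed.

Lemma CkM k f g : Ck k f -> Ck k g -> Ck k (fun x => f x * g x).
Proof.
elim: k f g => [//|k IH] f g cf cg; have cf1 := CkW cf; have cg1 := CkW cg.
case: cf cg => [f' df cf] [g' dg cg].
exists (fun x => f x * g' x + g x * f' x); last by apply: CkD; apply: IH.
by move=> x; exact: (is_deriveM (df x) (dg x)).
Qed.

Lemma is_derive_affine (a b x : R) : is_derive x 1 (fun x : R => a * x + b) a.
Proof.
rewrite -[X in is_derive _ _ _ X](_ : a *: (1 : R) + 0 = a).
  exact: (@is_deriveD _ _ _ (fun x : R => a * x) (cst b)).
by rewrite addr0 /GRing.scale /= mulr1.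
Qed.

Lemma Ck_affine k (a b : R) : Ck k (fun x => a * x + b).
Proof.
case: k => [//|k]; exists (fun=> a); last exact: Ck_cst.
by move=> x; exact: is_derive_affine.
Qed.

Lemma Ck_comp_affine k f (a b : R) : Ck k f -> Ck k (fun x => f (a * x + b)).
Proof.
elim: k f => [//|k IH] f [f' df cf]; exists (fun x => f' (a * x + b) * a).
  move=> x; apply: (@is_derive1_comp _ f (fun x => a * x + b)).
  exact: is_derive_affine.
apply: CkM; [exact: IH|exact: Ck_cst].
Qed.

Lemma smooth_derive f : smooth f ->
  (forall x, derivable f x 1) /\ smooth (derive1 f).
Proof.
move=> sf; split.
  by move=> x; have [f' df _] := sf 1%N; have := df x; case.
move=> k; have [f' df cf] := sf k.+1.
rewrite (_ : derive1 f = f')//; apply/funext => x; rewrite derive1E.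
exact: derive_val.
Qed.

Lemma smooth_continuous f : smooth f -> continuous f.
Proof.
move=> /smooth_derive[df _] x.
exact/differentiable_continuous/derivable1_diffP/df.
Qed.

Definition gauss1 (l c x : R) := expR (- (l * (x - c) ^+ 2)).

Lemma is_derive_gauss1 (l c x : R) :
  is_derive x 1 (gauss1 l c) ((- (2 * l) * x + 2 * l * c) * gauss1 l c x).
Proof.
rewrite /gauss1 -[X in is_derive _ _ _ X](_ :
  expR (- (l * (x - c) ^+ 2)) * (- (l * (2 * (x - c)))) = _); last by ring.
apply: (@is_derive1_comp _ expR (fun x => - (l * (x - c) ^+ 2))).
apply: is_derive_eq; rewrite /GRing.scale /= subr0; ring.
Qed.

Lemma smooth_gauss1 (l c : R) : smooth (gauss1 l c).
Proof.
elim=> [//|k IH]; exists (fun x => (- (2 * l) * x + 2 * l * c) * gauss1 l c x).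
  by move=> x; exact: is_derive_gauss1.
by apply: CkM => //; exact: Ck_affine.
Qed.

(** The classical exp(-1/s) is the case m = 0. The factor s^-m closes the span of the family under
    differentiation, which is what the induction in [smooth_flat] needs. *)
Definition flat (m : nat) (s : R) : R := if 0 < s then s ^- m * expR (- s^-1) else 0.

(** Comes from exp(1/s) >= (1/s)^(m+2) / (m+2)!. The square on the right makes the difference
    quotient of [flat m] at 0 tend to 0. *)
Lemma flat_bound m s : `|flat m s| <= (m.+2)`!%:R * s ^+ 2.
Proof.
rewrite /flat; case: ltP => s0; last by rewrite normr0 mulr_ge0 ?sqr_ge0.
rewrite ger0_norm; last by rewrite mulr_ge0 ?expR_ge0// invr_ge0 exprn_ge0// ltW.
rewrite expRN ler_pdivrMr ?expR_gt0//.
have F0 : 0 < (m.+2)`!%:R :> R by rewrite ltr0n fact_gt0.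
have h2 : s^-1 ^+ m.+2 / (m.+2)`!%:R <= expR s^-1.
  by apply: le_trans (expR_ge1Dxn m.+1 _); rewrite ?lerDr// invr_ge0 ltW.
rewrite ler_pdivrMr// in h2.
have -> : s ^- m = s ^+ 2 * s^-1 ^+ m.+2.
  rewrite exprVn -(addn2 m) exprD; field; rewrite ?expf_neq0// gt_eqF//.
rewrite [leRHS](_ : _ = s ^+ 2 * (expR s^-1 * (m.+2)`!%:R)); last by ring.
by rewrite ler_wpM2l ?sqr_ge0.
Qed.

Lemma is_derive_flat m s :
  is_derive (s : R) 1 (flat m) (flat m.+2 s + - m%:R * flat m.+1 s).
Proof.
have [s0|s0|s0] := ltgtP 0 s; last 1 first.
- rewrite -s0 /flat ltxx mulr0 addr0.
  have C : (fun h : R => h^-1 *: (flat m (h *: 1 + 0) - flat m 0)) @ 0^' --> (0 : R).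
    apply/cvgrPdist_le => e e0; near=> h.
    rewrite sub0r normrN {2}/flat ltxx subr0 addr0 /GRing.scale/= mulr1 normrM.
    apply: le_trans (ler_wpM2l (normr_ge0 _) (flat_bound m h)) _.
    have h0 : h != 0 by near: h; exact: nbhs_dnbhs_neq.
    rewrite -[h ^+ 2]real_normK ?num_real// expr2 normfV mulrCA mulKf ?normr_eq0//.
    rewrite -ler_pdivlMl ?ltr0n ?fact_gt0//.
    near: h; apply: dnbhs0_le; rewrite mulr_gt0// invr_gt0 ltr0n fact_gt0//.
  apply: DeriveDef; first by apply/cvg_ex; exists 0.
  by apply/cvg_lim.
- apply: (@near_eq_is_derive _ R^o R^o (fun x : R => (x^-1) ^+ m * expR (- x^-1))).
  + near=> x; rewrite /flat ifT ?exprVn//; near: x; exact: lt_nbhsr.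
  have dV : is_derive (s : R) 1 (fun x : R => x^-1) (- s ^- 2).
    have := @is_deriveV _ id s 1 1 (lt0r_neq0 s0) (is_derive_id _ _).
    by rewrite /GRing.scale /= mulr1.
  have dE : is_derive (s : R) 1 (fun x : R => expR (- x^-1)) (expR (- s^-1) * - (- s ^- 2)).
    exact: (@is_derive1_comp _ expR (fun x => - x^-1)).
  have dX : is_derive (s : R) 1 (fun x : R => x^-1 ^+ m) (m%:R * s^-1 ^+ m.-1 * - s ^- 2).
    by have := is_deriveX m dV; rewrite exprfctE /GRing.scale.
  apply: (is_derive_eq (is_deriveM dX dE)).
  rewrite /flat s0 /GRing.scale /= -!exprVn.
  by case: m {dX} => [|m] /=; rewrite !exprS ?expr0; ring.
- apply: (@near_eq_is_derive _ R^o R^o (cst 0)).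
  + near=> x; rewrite /flat ifF//; apply/negbTE; rewrite -leNgt ltW//; near: x; exact: lt_nbhsl.
  rewrite /flat ltNge (ltW s0)/= mulr0 addr0; exact: is_derive_cst.
Unshelve. all: by end_near. Qed.

Lemma smooth_flat m : smooth (flat m).
Proof.
move=> k; elim: k m => [//|k IH] m.
exists (fun s => flat m.+2 s + - m%:R * flat m.+1 s); first exact: is_derive_flat.
by apply: CkD => //; apply: CkM => //; exact: Ck_cst.
Qed.

Lemma is_derive_vanish f : (forall s, 1 < `|s| -> f s = 0) ->
  forall s, 1 < `|s| -> derive1 f s = 0.
Proof.
move=> f0 s s1; rewrite derive1E -(derive_cst (0 : R^o) s 1); apply: near_eq_derive.
have : \forall x \near s, 1 < `|x|.
  have : open [set x : R | 1 < `|x|].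
    rewrite (_ : [set _ | _] = (fun x => `|x|) @^-1` [set x | 1 < x])//.
    by apply: open_comp; [move=> x _; exact: norm_continuous|exact: open_gt].
  by move=> h; apply: (open_nbhs_nbhs (conj h _)).
by apply: filterS => x; exact: f0.
Qed.

Lemma bounded_support f : continuous f -> (forall s, 1 < `|s| -> f s = 0) ->
  exists2 B, 0 <= B & forall s, `|f s| <= B.
Proof.
move=> cf f0.
have [c _ hc] := @EVT_max R (fun s => `|f s|) (-1) 1 ltac:(by lra) 
  (continuous_subspaceT (fun x => continuous_comp (cf x) (@norm_continuous _ _ _))).
exists `|f c| => // s; have [s1|s1] := leP `|s| 1; last by rewrite f0// normr0.
by apply: hc; rewrite in_itv/= -ler_norml.
Qed.

Definition cutoff (s : R) : R := expR 2 * (flat 0 (-1 * s + 1) * flat 0 (1 * s + 1)).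

Lemma smooth_cutoff : smooth cutoff.
Proof.
move=> k; apply: CkM; first exact: Ck_cst.
by apply: CkM; apply: Ck_comp_affine; exact: smooth_flat.
Qed.

Lemma cutoff0 : cutoff 0 = 1.
Proof.
rewrite /cutoff /flat !mulr0 !add0r ltr01 expr0 !invr1 !mul1r -!expRD.
by rewrite [X in expR X](_ : _ = 0) ?expR0//; ring.
Qed.

Lemma cutoff_support s : 1 <= `|s| -> cutoff s = 0.
Proof.
rewrite ler_normr /cutoff /flat => /orP[s1|s1].
  by rewrite ifF ?mul0r ?mulr0//; apply/negbTE; rewrite -leNgt; lra.
by rewrite [X in _ * (_ * X)]ifF ?mulr0//; apply/negbTE; rewrite -leNgt; lra.
Qed.

Lemma cutoff_bounded : exists2 B, 0 <= B & forall s,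
  [/\ `|cutoff s| <= B, `|derive1 cutoff s| <= B & `|derive1 (derive1 cutoff) s| <= B].
Proof.
have s0 := smooth_cutoff; have [_ s1] := smooth_derive s0.
have [_ s2] := smooth_derive s1.
have v0 s : 1 < `|s| -> cutoff s = 0 by move=> /ltW; exact: cutoff_support.
have v1 := is_derive_vanish v0; have v2 := is_derive_vanish v1.
have [B0 B00 h0] := bounded_support (smooth_continuous s0) v0.
have [B1 B10 h1] := bounded_support (smooth_continuous s1) v1.
have [B2 B20 h2] := bounded_support (smooth_continuous s2) v2.
exists (B0 + B1 + B2); first by rewrite !addr_ge0.
move=> s; split.
- by apply: le_trans (h0 s) _; lra.
- by apply: le_trans (h1 s) _; lra.
- by apply: le_trans (h2 s) _; lra.
Qed.

End smooth.

(** * Tensor products as test functions *)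

Section tensor.
Context {R : realType} (n : nat).
Implicit Types (psi : 'I_n -> R -> R) (y : 'rV[R]_n).

(** Gaussians and their cut-offs are products of functions of one coordinate, and on products a
    partial derivative changes a single factor. The proof uses no other test functions. *)
Definition tensor psi y : R := \prod_j psi j (y ord0 j).

Definition update psi i (g : R -> R) : 'I_n -> R -> R :=
  fun j => if j == i then g else psi j.

Lemma tensor_update psi i g y :
  tensor (update psi i g) y = g (y ord0 i) * \prod_(j | j != i) psi j (y ord0 j).
Proof.
rewrite /tensor (bigD1 i)//= /update eqxx; congr (_ * _).
by apply: eq_bigr => j /negbTE ->.
Qed.

Lemma is_derive_tensor psi i y : derivable (psi i) (y ord0 i) 1 ->
  is_derive y (delta_mx ord0 i) (tensor psi) (tensor (update psi i (derive1 (psi i))) y).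
Proof.
move=> dpsi; pose c := \prod_(j | j != i) psi j (y ord0 j).
have E (h : R) : tensor psi (h *: delta_mx ord0 i + y) = c * psi i (h + y ord0 i).
  rewrite /tensor (bigD1 i)//= mulrC !mxE !eqxx mulr1; congr (_ * _).
  by apply: eq_bigr => j ji; rewrite !mxE eqxx (negbTE ji) mulr0 add0r.
have E0 : tensor psi y = c * psi i (y ord0 i).
  by have := E 0; rewrite scale0r !add0r.
have dg : is_derive (y ord0 i) (1 : R) (fun s => c * psi i s) (c * derive1 (psi i) (y ord0 i)).
  apply: (@is_deriveZ _ _ _ (psi i) c); rewrite derive1E.
  by apply/derivableP.
have EE : (fun h : R => h^-1 *: ((tensor psi \o shift y) (h *: delta_mx ord0 i) - tensor psi y)) =
    (fun h : R => h^-1 *: (((fun s => c * psi i s) \o shift (y ord0 i)) (h *: (1 : R)) - c * psi i (y ord0 i))).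
  by apply/funext => h /=; rewrite E E0 /GRing.scale /= mulr1.
case: dg => d1 d2; apply: DeriveDef; first by rewrite /derivable EE.
by rewrite tensor_update [RHS]mulrC -/c -d2 /derive EE.
Qed.

Lemma continuous_tensor psi : (forall j, continuous (psi j)) -> continuous (tensor psi).
Proof.
move=> cpsi; suff h (s : seq 'I_n) : continuous (fun y : 'rV[R]_n => \prod_(j <- s) psi j (y ord0 j)).
  exact: h.
elim: s => [|i s IH].
  by under eq_fun do rewrite big_nil; exact: cst_continuous.
under eq_fun do rewrite big_cons.
move=> y.
have cc : {for y, continuous (fun y : 'rV[R]_n => psi i (y ord0 i))}.
  exact: (@continuous_comp _ _ _ (fun y : 'rV[R]_n => y ord0 i) (psi i) y
    (@coord_continuous _ 1 n ord0 i y) (cpsi i _)).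
exact: (cvgM cc (IH y)).
Qed.

Lemma smooth_update psi i g : (forall j, smooth (psi j)) -> smooth g ->
  forall j, smooth (update psi i g j).
Proof. by move=> spsi sg j; rewrite /update; case: ifP. Qed.

Lemma derive_tensor psi i : (forall j, smooth (psi j)) ->
  (fun y : 'rV[R]_n => 'D_(delta_mx ord0 i) (tensor psi) y) =
  tensor (update psi i (derive1 (psi i))).
Proof.
move=> spsi; apply/funext => y; apply: (@derive_val _ _ _ _ _ _ _ (is_derive_tensor _)).
exact: (smooth_derive (spsi i)).1.
Qed.

Lemma pderiv_tensor psi s : (forall j, smooth (psi j)) ->
  exists2 psi', (forall j, smooth (psi' j)) & pderiv s (tensor psi) = tensor psi'.
Proof.
move=> spsi; elim: s => [|i s [psi' spsi' IH]] /=; first by exists psi.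
exists (update psi' i (derive1 (psi' i))); last first.
  by rewrite /pderiv /= -/(pderiv s (tensor psi)) IH derive_tensor.
by apply: smooth_update => //; exact: (smooth_derive (spsi' i)).2.
Qed.

Lemma pderiv2_tensor psi i : (forall j, smooth (psi j)) ->
  pderiv [:: i; i] (tensor psi) = tensor (update psi i (derive1 (derive1 (psi i)))).
Proof.
move=> spsi; rewrite /pderiv /= derive_tensor// derive_tensor; last first.
  by apply: smooth_update => //; exact: (smooth_derive (spsi i)).2.
apply/funext => y; apply: eq_bigr => j _; rewrite /update eqxx.
by case: eqP.
Qed.

Lemma test_function_tensor psi (rho : R) : (forall j, smooth (psi j)) ->
  (forall j s, rho < `|s| -> psi j s = 0) -> test_function (tensor psi).
Proof.
move=> spsi psi0; split.
- move=> s i x; have [psi' spsi' ->] := pderiv_tensor s spsi.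
  have := (smooth_derive (spsi' i)).1 (x ord0 i).
  by move/is_derive_tensor; case.
- move=> s; have [psi' spsi' ->] := pderiv_tensor s spsi.
  by apply: continuous_tensor => j; exact: smooth_continuous.
- pose K := [set y : 'rV[R]_n | forall i, `[- rho, rho]%classic (y ord0 i)].
  have cK : compact K by apply: (@rV_compact _ _ (fun=> `[- rho, rho]%classic)) => i; exact: segment_compact.
  apply: (subclosed_compact _ cK); first exact: closed_closure.
  have cK' : closed K by apply: compact_closed => //; exact: norm_hausdorff.
  rewrite [X in _ `<=` X](closure_id K).1//.
  apply: closureS => y /= yn0 i; rewrite /= in_itv/= -ler_norml leNgt.
  apply: contra yn0 => h; rewrite /tensor (bigD1 i)//= psi0 ?mul0r//.
Qed.

End tensor.

(** * Weak derivatives tested against Gaussians *)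

Section weak_gauss.
Context {R : realType} (n : nat).
Local Notation mu := (@lebesgue_rV R n).
Implicit Types (x y : 'rV[R]_n) (v w h : 'rV[R]_n -> R).

(** The heat kernel at time 1/(4 l), up to its normalizing factor. *)
Definition heat_weight (l : R) x y : R := expR (- (l * sqnorm (x - y))).

Lemma heat_weight_ge0 l x y : 0 <= heat_weight l x y.
Proof. exact: expR_ge0. Qed.

Lemma heat_weight_le1 l x y : 0 <= l -> heat_weight l x y <= 1.
Proof.
by move=> l0; rewrite /heat_weight -expR0 ler_expR oppr_le0 mulr_ge0// sqnorm_ge0.
Qed.

Lemma heat_weightE l x y : heat_weight l x y = \prod_j gauss1 l (x ord0 j) (y ord0 j).
Proof.
rewrite /heat_weight expR_sqnorm; apply: eq_bigr => j _.
by rewrite /gauss1 !mxE -sqrrN opprB.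
Qed.

Lemma measurable_sqnorm_sub x :
  measurable_fun setT (fun y : 'rV[R]_n => sqnorm (x - y)).
Proof.
apply: measurable_sum => i; apply: measurable_funX.
under eq_fun do rewrite !mxE.
by apply: measurable_funB => //; exact: measurable_coord_rV.
Qed.

Lemma measurable_heat_weight l x :
  measurable_fun setT (fun y : 'rV[R]_n => heat_weight l x y).
Proof.
rewrite /heat_weight; apply: measurableT_comp; first exact: measurable_expR.
apply: measurableT_comp => //; apply: measurable_funM => //.
exact: measurable_sqnorm_sub.
Qed.

Lemma integrable_heat_weight l x : 0 < l ->
  mu.-integrable setT (EFin \o (heat_weight l x)).
Proof.
move=> l0; apply/integrableP; split.
  by apply/measurable_EFinP; exact: measurable_heat_weight.
rewrite (eq_integral (fun y => (heat_weight l x y)%:E)); last first.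
  by move=> y _ /=; rewrite ger0_norm// heat_weight_ge0.
by rewrite integral_gauss// ltry.
Qed.

(** With [h] integrable this class contains every L_p function for p >= 1, by a <= 1 + a^p with h =
    |v|^p, and its members can be integrated against Gaussians. One [h], a sum of such powers,
    serves for all functions of an equation, whatever [p] is. *)
Definition dominated h v := measurable_fun setT v /\ forall y, `|v y| <= 1 + h y.

Definition dominating h := [/\ measurable_fun setT h, forall y, 0 <= h y &
  mu.-integrable setT (EFin \o h)].

(** The summand 1 in the bound on [v] keeps the decay of the Gaussian, while for the summand [h] it
    suffices that the Gaussian is at most 1. *)
Lemma dominatedM_bound h v (F : 'rV[R]_n -> R) (C l : R) x : dominating h ->
  dominated h v -> 0 <= C -> 0 < l -> (forall y, `|F y| <= C * heat_weight l x y) ->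
  forall y, `|v y * F y| <= C * heat_weight l x y + C * h y.
Proof.
move=> [mh h0 ih] [mv vh] C0 l0 Fb y; rewrite normrM.
apply: le_trans (ler_pM (normr_ge0 _) (normr_ge0 _) (vh y) (Fb y)) _.
rewrite mulrDl mul1r lerD2l mulrCA ler_wpM2l// ler_piMr//.
exact: heat_weight_le1 (ltW l0).
Qed.

Lemma dominating_bound_integrable h (C l : R) x : dominating h -> 0 < l ->
  mu.-integrable setT (EFin \o (fun y => C * heat_weight l x y + C * h y)).
Proof.
move=> [mh h0 ih] l0.
have := integrableD measurableT
  (integrableZl measurableT C (integrable_heat_weight x l0))
  (integrableZl measurableT C ih).
by apply: eq_integrable => // y _ /=; rewrite EFinD !EFinM.
Qed.

Lemma dominated_integrable h v (F : 'rV[R]_n -> R) (C l : R) x : dominating h ->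
  dominated h v -> measurable_fun setT F -> 0 <= C -> 0 < l ->
  (forall y, `|F y| <= C * heat_weight l x y) ->
  mu.-integrable setT (EFin \o (fun y => v y * F y)).
Proof.
move=> dh dv mF C0 l0 Fb.
apply: (le_integrable _ _ _ (dominating_bound_integrable C x dh l0)) => //.
  by apply/measurable_EFinP; apply: measurable_funM => //; exact: dv.1.
move=> y _ /=; rewrite lee_fin; apply: le_trans (dominatedM_bound dh dv C0 l0 Fb y) _.
exact: ler_norm.
Qed.

Lemma dominated_gauss_cvg h v (F_ : nat -> 'rV[R]_n -> R) (F : 'rV[R]_n -> R)
    (C l : R) x : dominating h ->
  dominated h v -> (forall k, measurable_fun setT (F_ k)) -> 0 <= C -> 0 < l ->
  (forall k y, `|F_ k y| <= C * heat_weight l x y) ->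
  {ae mu, forall y, F_ k y @[k --> \oo] --> F y} -> measurable_fun setT F ->
  (\int[mu]_y (v y * F_ k y)%:E)%E @[k --> \oo] --> (\int[mu]_y (v y * F y)%:E)%E.
Proof.
move=> dh dv mF C0 l0 Fb cF mF'.
have cF' : {ae mu, forall y, setT y -> (v y * F_ k y)%:E @[k --> \oo] --> (v y * F y)%:E}.
  move: cF; apply: filterS => y Fy _; apply: cvg_EFin; first exact: nearW.
  by apply: cvgM; [exact: cvg_cst|exact: Fy].
have [_ _] := @dominated_convergence _ _ _ mu setT measurableT
  (fun k y => (v y * F_ k y)%:E) (fun y => (v y * F y)%:E)
  (fun y => (C * heat_weight l x y + C * h y)%:E)
  (fun k => (measurable_EFinP _ _).2 (measurable_funM dv.1 (mF k)))
  ((measurable_EFinP _ _).2 (measurable_funM dv.1 mF'))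
  cF'
  (dominating_bound_integrable C x dh l0)
  (aeW _ (fun y k _ => dominatedM_bound dh dv C0 l0 (Fb k) y)).
exact.
Qed.

Local Notation chi := (@cutoff R).
Local Notation chi1 := (derive1 chi).
Local Notation chi2 := (derive1 chi1).

(** Sorted by the number of derivatives that fall on the cut-off: the terms with [chi1] and [chi2]
    carry the factors a and a^2, which vanish in the limit. The summand 0 keeps the argument in
    affine form. *)
Lemma derive2_gauss_cutoff (l c a : R) :
  derive1 (derive1 (fun s => gauss1 l c s * chi (a * s + 0))) =
  fun s => gauss1 l c s * ((4 * l ^+ 2 * (c - s) ^+ 2 - 2 * l) * chi (a * s + 0)
    + 2 * a * (2 * l * (c - s)) * chi1 (a * s + 0) + a ^+ 2 * chi2 (a * s + 0)).
Proof.
have s0 := @smooth_cutoff R; have s1 := (smooth_derive s0).2.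
have D (f : R -> R) (s : R) : smooth f ->
    is_derive s 1 (fun s => f (a * s + 0)) (a * derive1 f (a * s + 0)).
  move=> sf; rewrite mulrC; apply: (@is_derive1_comp _ f (fun s => a * s + 0)).
    by rewrite derive1E; apply/derivableP; exact: (smooth_derive sf).1.
  exact: is_derive_affine.
have E1 : derive1 (fun s => gauss1 l c s * chi (a * s + 0)) =
    fun s => gauss1 l c s * ((- (2 * l) * s + 2 * l * c) * chi (a * s + 0) + a * chi1 (a * s + 0)).
  apply/funext => s; rewrite derive1E.
  apply: (@derive_val _ _ _ _ _ _ _ (is_derive_eq (is_deriveM (is_derive_gauss1 l c s) (D _ s s0)) _)).
  by rewrite /GRing.scale /=; ring.
rewrite E1; apply/funext => s; rewrite derive1E.
have d1 : is_derive s 1 (fun s => (- (2 * l) * s + 2 * l * c) * chi (a * s + 0))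
  (- (2 * l) * chi (a * s + 0) + (- (2 * l) * s + 2 * l * c) * (a * chi1 (a * s + 0))).
  apply: (is_derive_eq (is_deriveM (is_derive_affine _ _ s) (D _ s s0))).
  by rewrite /GRing.scale /=; ring.
have d2 : is_derive s 1 (fun s => a * chi1 (a * s + 0)) (a * (a * chi2 (a * s + 0))).
  exact: (is_deriveZ a (D _ s s1)).
have d3 := is_deriveM (is_derive_gauss1 l c s) (is_deriveD d1 d2).
apply: (@derive_val _ _ _ _ _ _ _ (is_derive_eq d3 _)).
by rewrite !fctE /GRing.scale /=; ring.
Qed.

Lemma gauss1_ge0 (l c s : R) : 0 <= gauss1 l c s.
Proof. exact: expR_ge0. Qed.

Lemma gauss1_half (l c s : R) : 0 <= l -> gauss1 l c s <= gauss1 (l / 2) c s.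
Proof.
move=> l0; rewrite /gauss1 ler_expR lerN2 -mulrA ler_wpM2l//.
by rewrite ler_piMl ?sqr_ge0//; lra.
Qed.

(** Half of the exponent absorbs the quadratic factor: with X half of the full exponent, X exp(-X)
    <= 1. *)
Lemma gauss1_sqr_half (l c s : R) : 0 <= l ->
  l * (c - s) ^+ 2 * gauss1 l c s <= 2 * gauss1 (l / 2) c s.
Proof.
move=> l0; rewrite /gauss1; set X := l / 2 * (s - c) ^+ 2.
have -> : l * (c - s) ^+ 2 = 2 * X by rewrite /X; field.
have -> : l * (s - c) ^+ 2 = X + X by rewrite /X; field.
rewrite -mulrA ler_pM2l// opprD expRD mulrA -[leRHS]mul1r.
rewrite ler_wpM2r ?expR_ge0// expRN ler_pdivrMr ?expR_gt0// mul1r.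
by apply: le_trans (expR_ge1Dx X); lra.
Qed.

(** The bound is uniform in [a], as dominated convergence for the widening cut-offs requires. With P
    = 2 l (c - s) the second factor is at most B (2 P^2 + 2 l + 2); halving the exponent turns 2 P^2
    into 16 l, which gives 18 l + 2. *)
Lemma derive2_gauss_cutoff_bound (l c a B : R) s : 0 < l -> 0 <= a <= 1 -> 0 <= B ->
  (forall s, [/\ `|chi s| <= B, `|chi1 s| <= B & `|chi2 s| <= B]) ->
  `|gauss1 l c s * ((4 * l ^+ 2 * (c - s) ^+ 2 - 2 * l) * chi (a * s + 0)
    + 2 * a * (2 * l * (c - s)) * chi1 (a * s + 0) + a ^+ 2 * chi2 (a * s + 0))|
  <= B * (18 * l + 2) * gauss1 (l / 2) c s.
Proof.
move=> l0 /andP[a0 a1] B0 hB; rewrite normrM ger0_norm ?gauss1_ge0//.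
have [b0 b1 b2] := hB (a * s + 0).
set P := 2 * l * (c - s).
have P2 : 4 * l ^+ 2 * (c - s) ^+ 2 = P ^+ 2 by rewrite /P; ring.
have h : `|(4 * l ^+ 2 * (c - s) ^+ 2 - 2 * l) * chi (a * s + 0)
    + 2 * a * P * chi1 (a * s + 0) + a ^+ 2 * chi2 (a * s + 0)| <=
    B * (2 * P ^+ 2 + (2 * l + 2)).
  rewrite P2; move: b0 b1 b2 {hB P2}.
  move: (chi _) (chi1 _) (chi2 _) => u0 u1 u2 b0 b1 b2; clearbody P.
  have q1 : `|P ^+ 2 - 2 * l| <= P ^+ 2 + 2 * l.
    apply: le_trans (ler_normB _ _) _.
    by rewrite (ger0_norm (sqr_ge0 _)) ger0_norm// mulr_ge0// ltW.
  have q2 : `|2 * a * P| <= P ^+ 2 + 1.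
    rewrite !normrM ger0_norm// (ger0_norm a0) -(real_normK (num_real P)).
    have := normr_ge0 P; move: (`|P|) => t t0.
    have : 0 <= (t - 1) ^+ 2 by rewrite sqr_ge0.
    have : a * t <= t by rewrite ler_piMl.
    by nra.
  have q3 : `|a ^+ 2| <= 1 by rewrite ger0_norm ?sqr_ge0// expr_le1.
  have r1 : `|(P ^+ 2 - 2 * l) * u0| <= (P ^+ 2 + 2 * l) * B by rewrite normrM ler_pM.
  have r2 : `|2 * a * P * u1| <= (P ^+ 2 + 1) * B by rewrite normrM ler_pM.
  have r3 : `|a ^+ 2 * u2| <= 1 * B by rewrite normrM ler_pM.
  apply: le_trans (ler_normD _ _) _; apply: le_trans (lerD (ler_normD _ _) (lexx _)) _.
  by apply: le_trans (lerD (lerD r1 r2) r3) _; lra.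
apply: le_trans (ler_wpM2l (gauss1_ge0 _ _ _) h) _.
have g1 := gauss1_sqr_half c s (ltW l0); have g2 := gauss1_half c s (ltW l0).
have -> : gauss1 l c s * (B * (2 * P ^+ 2 + (2 * l + 2))) =
  B * (8 * l * (l * (c - s) ^+ 2 * gauss1 l c s) + (2 * l + 2) * gauss1 l c s).
  by rewrite /P; ring.
rewrite -[leRHS]mulrA ler_wpM2l//.
have -> : (18 * l + 2) * gauss1 (l / 2) c s = 8 * l * (2 * gauss1 (l / 2) c s) + (2 * l + 2) * gauss1 (l / 2) c s by ring.
by apply: lerD; apply: ler_wpM2l => //; lra.
Qed.

Lemma tensor_bound (psi : 'I_n -> R -> R) (C l : R) x y :
  (forall j s, `|psi j s| <= C * gauss1 l (x ord0 j) s) ->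
  `|tensor psi y| <= C ^+ n * heat_weight l x y.
Proof.
move=> hpsi; rewrite /tensor normr_prod heat_weightE -[n in C ^+ n]card_ord -prodr_const.
by rewrite -big_split/=; apply: ler_prod => j _; rewrite normr_ge0 hpsi.
Qed.

Lemma tensor_cvg (psi_ : nat -> 'I_n -> R -> R) (psi : 'I_n -> R -> R) y :
  (forall j, psi_ k j (y ord0 j) @[k --> \oo] --> psi j (y ord0 j)) ->
  tensor (psi_ k) y @[k --> \oo] --> tensor psi y.
Proof.
move=> cpsi; rewrite /tensor; elim: (index_enum _) => [|i r IH].
  by under eq_fun do rewrite big_nil; rewrite big_nil; exact: cvg_cst.
by under eq_fun do rewrite big_cons; rewrite big_cons; apply: cvgM.
Qed.

Lemma measurable_tensor (psi : 'I_n -> R -> R) :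
  (forall j, smooth (psi j)) -> measurable_fun setT (tensor psi).
Proof.
move=> spsi; apply: measurable_prod => j _.
apply: (measurableT_comp _ (measurable_coord_rV j)).
by apply: continuous_measurable_fun; exact: smooth_continuous.
Qed.

(** A Gaussian has no compact support, so every one-variable factor is multiplied by the cut-off at
    scale k + 1. The weak equation holds for these products, and both sides converge as k grows,
    dominated by the Gaussian with half the rate. *)
Lemma weak_heat h v w i : dominating h -> dominated h v -> dominated h w ->
  (forall phi, test_function phi ->
    \int[mu]_y (v y * pderiv [:: i; i] phi y) = \int[mu]_y (w y * phi y)) ->
  forall (l : R) x, 0 < l ->
  (\int[mu]_y (v y * ((4 * l ^+ 2 * (x ord0 i - y ord0 i) ^+ 2 - 2 * l) * heat_weight l x y))%:E =
   \int[mu]_y (w y * heat_weight l x y)%:E)%E.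
Proof.
move=> dh dv dw vw l x l0.
have [B B0 hB] := @cutoff_bounded R.
pose a (k : nat) : R := k.+1%:R^-1.
have a01 k : 0 <= a k <= 1 by rewrite invr_ge0 ler0n invf_le1 ?ltr0n// ler1n.
pose psi k (j : 'I_n) s := gauss1 l (x ord0 j) s * chi (a k * s + 0).
have spsi k j : smooth (psi k j).
  move=> m; apply: CkM; first exact: smooth_gauss1.
  by apply: Ck_comp_affine; exact: smooth_cutoff.
have spsi2 k j : smooth (update (psi k) i (derive1 (derive1 (psi k i))) j).
  apply: smooth_update => //.
  exact: (smooth_derive (smooth_derive (spsi k i)).2).2.
have tf k : test_function (tensor (psi k)).
  apply: (@test_function_tensor _ _ _ k.+1%:R) => // j s ks.
  rewrite /psi cutoff_support ?mulr0// addr0 normrM /a normfV (ger0_norm (ler0n _ _)).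
  by rewrite mulrC ler_pdivlMr ?mul1r ?ltr0n// ltW.
(* One constant for both kinds of factors: the first summand bounds the twice differentiated one,
   the second the others. *)
pose C := B * (18 * l + 2) + B.
have C0 : 0 <= C by rewrite addr_ge0// mulr_ge0//; lra.
have l2 : 0 < l / 2 by lra.
have b1 k j s : `|psi k j s| <= C * gauss1 (l / 2) (x ord0 j) s.
  rewrite /psi normrM ger0_norm ?gauss1_ge0// mulrC.
  apply: ler_pM; rewrite ?normr_ge0 ?gauss1_ge0//; last exact: gauss1_half (ltW l0).
  have [+ _ _] := hB (a k * s + 0); move/le_trans; apply.
  by rewrite lerDr mulr_ge0//; lra.
have b2 k j s : `|update (psi k) i (derive1 (derive1 (psi k i))) j s| <= C * gauss1 (l / 2) (x ord0 j) s.
  rewrite /update; case: eqP => [->|_]; last exact: b1.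
  rewrite derive2_gauss_cutoff.
  apply: le_trans (derive2_gauss_cutoff_bound _ _ l0 (a01 k) B0 hB) _.
  by rewrite ler_wpM2r ?gauss1_ge0// lerDl.
have ca s : (a k * s + 0) @[k --> \oo] --> (0 : R).
  rewrite -[X in _ --> X]addr0 -[X in X + 0](mul0r s); apply: cvgD; last exact: cvg_cst.
  by apply: cvgM; [exact: cvg_harmonic|exact: cvg_cst].
have cchi s : chi (a k * s + 0) @[k --> \oo] --> (1 : R).
  rewrite -(@cutoff0 R); apply: continuous_cvg; last exact: ca.
  exact/smooth_continuous/smooth_cutoff.
have c1 j s : psi k j s @[k --> \oo] --> gauss1 l (x ord0 j) s.
  rewrite -[X in _ --> X]mulr1; apply: cvgM; [exact: cvg_cst|exact: cchi].
have c2 j s : update (psi k) i (derive1 (derive1 (psi k i))) j s @[k --> \oo] -->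
    update (fun j => gauss1 l (x ord0 j)) i (fun s => gauss1 l (x ord0 i) s * (4 * l ^+ 2 * (x ord0 i - s) ^+ 2 - 2 * l)) j s.
  rewrite /update; case: eqP => [_|_]; last exact: c1.
  under eq_fun do rewrite derive2_gauss_cutoff.
  apply: cvgM; first exact: cvg_cst.
  rewrite -[X in _ --> X]addr0; apply: cvgD.
    rewrite -[X in _ --> X]addr0; apply: cvgD.
      rewrite -[X in _ --> X]mulr1; apply: cvgM; [exact: cvg_cst|exact: cchi].
    apply/cvgr0Pnorm_le => e e0.
    have c3 : a k * (2 * `|2 * l * (x ord0 i - s)| * B) @[k --> \oo] --> (0 : R).
      rewrite -[X in _ --> X](mul0r (2 * `|2 * l * (x ord0 i - s)| * B)).
      by apply: cvgM; [exact: cvg_harmonic|exact: cvg_cst].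
    have /cvgr0Pnorm_le/(_ e e0) := c3; apply: filterS => k; apply: le_trans.
    have /andP[a0 _] := a01 k; have [_ h1 _] := hB (a k * s + 0).
    rewrite !normrM (ger0_norm a0) !normr_id (ger0_norm (ler0n _ 2)) (ger0_norm B0).
    have := normr_ge0 l; have := normr_ge0 (x ord0 i - s).
    move: (`|l|) (`|x ord0 i - s|) => t1 t2 t10 t20.
    rewrite -!mulrA mulrCA ler_wpM2l// ler_wpM2l// ler_wpM2l//.
    by rewrite ler_wpM2l// ler_wpM2l.
  apply/cvgr0Pnorm_le => e e0.
  have c3 : a k * B @[k --> \oo] --> (0 : R).
    by rewrite -[X in _ --> X](mul0r B); apply: cvgM; [exact: cvg_harmonic|exact: cvg_cst].
  have /cvgr0Pnorm_le/(_ e e0) := c3; apply: filterS => k; apply: le_trans.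
  have /andP[a0 a1] := a01 k; have [_ _ h1] := hB (a k * s + 0).
  rewrite !normrM (ger0_norm a0) (ger0_norm B0) -mulrA ler_wpM2l//.
  by rewrite -[leRHS]mul1r ler_pM.
have E1 y : tensor (fun j => gauss1 l (x ord0 j)) y = heat_weight l x y.
  by rewrite heat_weightE.
have E2 y : tensor (update (fun j => gauss1 l (x ord0 j)) i (fun s => gauss1 l (x ord0 i) s * (4 * l ^+ 2 * (x ord0 i - s) ^+ 2 - 2 * l))) y =
    (4 * l ^+ 2 * (x ord0 i - y ord0 i) ^+ 2 - 2 * l) * heat_weight l x y.
  rewrite tensor_update -E1 /tensor [in RHS](bigD1 i)//= [RHS]mulrA.
  by congr (_ * _); rewrite mulrC.
have Cn0 : 0 <= C ^+ n by exact: exprn_ge0.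
have mT k := measurable_tensor (spsi k).
have mT2 k := measurable_tensor (spsi2 k).
have L1 : (\int[mu]_y (w y * tensor (psi k) y)%:E)%E @[k --> \oo] -->
    (\int[mu]_y (w y * heat_weight l x y)%:E)%E.
  apply: (dominated_gauss_cvg dh dw mT Cn0 l2) => //.
  - by move=> k y; exact: tensor_bound.
  - by apply: aeW => y; rewrite -E1; apply: tensor_cvg => j; exact: c1.
  - exact: measurable_heat_weight.
have L2 : (\int[mu]_y (v y * tensor (update (psi k) i (derive1 (derive1 (psi k i)))) y)%:E)%E @[k --> \oo] -->
    (\int[mu]_y (v y * ((4 * l ^+ 2 * (x ord0 i - y ord0 i) ^+ 2 - 2 * l) * heat_weight l x y))%:E)%E.
  apply: (dominated_gauss_cvg dh dv mT2 Cn0 l2) => //.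
  - by move=> k y; exact: tensor_bound.
  - by apply: aeW => y; rewrite -E2; apply: tensor_cvg => j; exact: c2.
  - apply: measurable_funM; last exact: measurable_heat_weight.
    apply: measurable_funB => //; apply: measurable_funM => //; apply: measurable_funX.
    by apply: measurable_funB => //; exact: measurable_coord_rV.
apply: (cvg_unique _ L2) => //.
rewrite (_ : (fun k => _) = (fun k => \int[mu]_y (w y * tensor (psi k) y)%:E)%E)//.
apply/funext => k.
have := vw _ (tf k); rewrite pderiv2_tensor// /Rintegral.
have i1 := integrable_fin_num measurableT (dominated_integrable dh dw (mT k) Cn0 l2 (fun y => tensor_bound y (b1 k))).
have i2 := integrable_fin_num measurableT (dominated_integrable dh dv (mT2 k) Cn0 l2 (fun y => tensor_bound y (b2 k))).
by move=> E; rewrite -(fineK i1) -(fineK i2) E.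
Qed.

End weak_gauss.

(** * The heat kernel *)

Section heat_kernel.
Context {R : realType} (n : nat).
Local Notation mu := (@lebesgue_rV R n).
Local Notation leb := (@lebesgue_measure R).
Local Notation mR := (measurableTypeR R).
Implicit Types (x y : 'rV[R]_n) (v w h : 'rV[R]_n -> R) (t : R).

Definition heat_peak t : R := (4 * pi * t) `^ (- (n%:R / 2)).

(** Writing the inverse as a power reduces joint measurability to that of [powR]. The value 0 for t
    <= 0 makes the kernel nonnegative everywhere and lets integrals over ]0, +oo[ be taken over the
    whole line. *)
Definition heat_kernel t x y : R :=
  if 0 < t then heat_peak t * heat_weight ((4 * t) `^ (-1)) x y else 0.

Lemma heat_kernelE t x y : 0 < t ->
  heat_kernel t x y = heat_peak t * heat_weight (4 * t)^-1 x y.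
Proof. by move=> t0; rewrite /heat_kernel t0 powR_inv1// mulr_ge0// ltW. Qed.

Lemma heat_peak_gt0 t : 0 < t -> 0 < heat_peak t.
Proof. by move=> t0; rewrite powR_gt0// !mulr_gt0// pi_gt0. Qed.

Lemma heat_peak_le s t : 0 < s -> s <= t -> heat_peak t <= heat_peak s.
Proof.
move=> s0 st; have t0 := lt_le_trans s0 st; have p0 := pi_gt0 R.
rewrite /heat_peak !powRN lef_pV2 ?posrE ?powR_gt0 ?mulr_gt0//.
apply: ge0_ler_powR; rewrite ?divr_ge0 ?nnegrE//.
- by rewrite ltW// !mulr_gt0.
- by rewrite ltW// !mulr_gt0.
- by rewrite ler_pM2l// mulr_gt0.
Qed.

Lemma heat_kernel_ge0 t x y : 0 <= heat_kernel t x y.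
Proof.
rewrite /heat_kernel; case: ifP => // t0.
by rewrite mulr_ge0 ?heat_weight_ge0// ltW// heat_peak_gt0.
Qed.

Lemma inv4_gt0 t : 0 < t -> 0 < (4 * t)^-1.
Proof. by move=> t0; rewrite invr_gt0 mulr_gt0. Qed.

Lemma heat_kernel_le t x y : 0 < t -> heat_kernel t x y <= heat_peak t.
Proof.
move=> t0; rewrite heat_kernelE// ler_piMr ?heat_weight_le1 ?ltW ?heat_peak_gt0//.
exact: inv4_gt0.
Qed.

Lemma heat_peakE t : 0 < t -> heat_peak t = (Num.sqrt (pi / (4 * t)^-1) ^+ n)^-1.
Proof.
move=> t0; have p0 := pi_gt0 R; rewrite invrK /heat_peak powRN [n%:R / 2]mulrC powRrM.
have u0 : 0 <= 4 * pi * t by rewrite ltW// !mulr_gt0.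
by rewrite powR12_sqrt// powR_mulrn// [in RHS]mulrCA mulrA.
Qed.

Lemma measurable_heat_kernel_y t x : measurable_fun setT (heat_kernel t x).
Proof.
rewrite (_ : heat_kernel t x = if 0 < t then
  (fun y => heat_peak t * heat_weight ((4 * t) `^ (-1)) x y) else cst 0).
  by case: ifP => // _; apply: measurable_funM => //; exact: measurable_heat_weight.
by apply/funext => y; rewrite /heat_kernel; case: ifP.
Qed.

Lemma integral_heat_kernel t x : 0 < t -> (\int[mu]_y (heat_kernel t x y)%:E = 1)%E.
Proof.
move=> t0; under eq_integral do rewrite heat_kernelE// EFinM.
rewrite ge0_integralZl_EFin//.
- rewrite integral_gauss ?inv4_gt0// heat_peakE// -EFinM mulVf// gt_eqF//.
  by rewrite exprn_gt0// sqrtr_gt0 divr_gt0 ?pi_gt0 ?inv4_gt0.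
- by move=> y _; rewrite lee_fin heat_weight_ge0.
- by apply/measurable_EFinP; exact: measurable_heat_weight.
- exact/ltW/heat_peak_gt0.
Qed.

Lemma heat_kernel_sym t x y : heat_kernel t x y = heat_kernel t y x.
Proof.
rewrite /heat_kernel /heat_weight; case: ifP => // _; congr (_ * expR (- (_ * _))).
by apply: eq_bigr => i _; rewrite !mxE -sqrrN opprB.
Qed.

Lemma measurable_heat_kernel :
  measurable_fun setT (fun z : (mR * 'rV[R]_n) * 'rV[R]_n => heat_kernel z.1.1 z.1.2 z.2).
Proof.
have mt : measurable_fun setT (fun z : (mR * 'rV[R]_n) * 'rV[R]_n => z.1.1 : R).
  exact: (measurableT_comp measurable_fst measurable_fst).
have mp (a c : R) : measurable_fun setT (fun z : (mR * 'rV[R]_n) * 'rV[R]_n => (c * z.1.1) `^ a : R).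
  apply: (measurableT_comp (measurable_powR a)).
  exact: measurable_funM.
rewrite /heat_kernel; apply: measurable_fun_ifT => //.
  exact: measurable_fun_ltr.
apply: measurable_funM; first exact: mp.
apply: (measurableT_comp (@measurable_expR R)); apply: measurableT_comp => //.
apply: measurable_funM; first exact: mp.
apply: (measurableT_comp (@measurable_sqnorm R n)).
apply: measurable_fun_rV => i; under eq_fun do rewrite !mxE.
apply: measurable_funB.
  apply: (measurableT_comp (measurable_coord_rV i)).
  exact: (measurableT_comp measurable_snd measurable_fst).
exact: (measurableT_comp (measurable_coord_rV i) measurable_snd).
Qed.

Lemma heat_kernel_bound t x y : 0 < t ->
  `|heat_kernel t x y| <= heat_peak t * heat_weight (4 * t)^-1 x y.
Proof. by move=> t0; rewrite ger0_norm ?heat_kernel_ge0// heat_kernelE. Qed.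

Lemma integrable_dominated_heat h v t x : dominating h -> dominated h v -> 0 < t ->
  mu.-integrable setT (EFin \o (fun y => v y * heat_kernel t x y)).
Proof.
move=> dh dv t0.
apply: (dominated_integrable dh dv (measurable_heat_kernel_y t x)
  (ltW (heat_peak_gt0 t0)) (inv4_gt0 t0)) => y.
exact: heat_kernel_bound.
Qed.

(** For t > 0 this is at once the time derivative of the kernel ([is_derive_heat_kernel]) and its
    Laplacian in y (exploited in [weak_heat_sum]). *)
Definition heat_kernel_dt t x y : R :=
  (sqnorm (x - y) / (4 * t ^+ 2) - n%:R / (2 * t)) * heat_kernel t x y.

Lemma is_derive_heat_kernel t x y : 0 < t ->
  is_derive t 1 (fun t => heat_kernel t x y) (heat_kernel_dt t x y).
Proof.
move=> t0; have p0 := pi_gt0 R.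
apply: (@near_eq_is_derive _ R^o R^o (fun t : R => (4 * pi * t) `^ (- (n%:R / 2)) *
   expR (- ((4 * t)^-1 * sqnorm (x - y))))).
  near=> s; rewrite -heat_kernelE//; near: s; exact: lt_nbhsr.
have d1 : is_derive (t : R) 1 (fun t => (4 * pi * t) `^ (- (n%:R / 2)))
   ((- (n%:R / 2)) * (4 * pi * t) `^ (- (n%:R / 2) - 1) * (4 * pi)).
  apply: (@is_derive1_comp _ (fun u => u `^ (- (n%:R / 2))) (fun t => 4 * pi * t)).
    by apply: is_derive1_powR; rewrite !mulr_gt0.
  have := is_derive_affine (4 * pi) 0 t.
  by rewrite (_ : (fun s : R => _) = (fun s => 4 * pi * s))//; apply/funext => ?; rewrite addr0.
have d2 : is_derive (t : R) 1 (fun t => expR (- ((4 * t)^-1 * sqnorm (x - y))))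
   (expR (- ((4 * t)^-1 * sqnorm (x - y))) * (4 * t ^+ 2)^-1 * sqnorm (x - y)).
  rewrite -mulrA; apply: (@is_derive1_comp _ expR (fun t => - ((4 * t)^-1 * sqnorm (x - y)))).
  have d4 : is_derive (t : R) 1 (fun t => 4 * t) 4.
    have := is_derive_affine 4 0 t.
    by rewrite (_ : (fun s : R => _) = (fun s => 4 * s))//; apply/funext => ?; rewrite addr0.
  have t4 : 4 * t != 0 by rewrite mulf_neq0 ?gt_eqF.
  have d3 := is_deriveN (is_deriveM (is_deriveV t4 d4) (is_derive_cst (sqnorm (x - y)) t (1 : R))).
  apply: (is_derive_eq d3); rewrite /GRing.scale /=.
  by field; exact: lt0r_neq0.
apply: (is_derive_eq (is_deriveM d1 d2)).
rewrite /heat_kernel_dt heat_kernelE// /heat_peak /heat_weight /GRing.scale /=.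
have u0 : 0 < 4 * pi * t by rewrite !mulr_gt0.
have -> : (4 * pi * t) `^ (- (n%:R / 2) - 1) = (4 * pi * t) `^ (- (n%:R / 2)) / (4 * pi * t).
  by rewrite powRD ?powR_inv1 ?(ltW u0)// (gt_eqF u0) implybT.
move: (pi) p0 u0 => q p0 u0.
set A := expR _; set B := (4 * q * t) `^ (- (n%:R / 2)).
by field; rewrite !lt0r_neq0.
Unshelve. all: by end_near. Qed.

(** The heat equation of the kernel: for l = 1/(4 t), summing 4 l^2 (x_i - y_i)^2 - 2 l over i gives
    |x - y|^2 / (4 t^2) - n / (2 t), so adding the n Gaussian identities pairs [v] with the time
    derivative. *)
Lemma weak_heat_sum h v (w : 'I_n -> 'rV[R]_n -> R) :
  dominating h -> dominated h v -> (forall i, dominated h (w i)) ->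
  (forall i phi, test_function phi ->
    \int[mu]_y (v y * pderiv [:: i; i] phi y) = \int[mu]_y (w i y * phi y)) ->
  forall t x, 0 < t ->
  (\int[mu]_y (v y * heat_kernel_dt t x y)%:E =
   \int[mu]_y ((\sum_i w i y) * heat_kernel t x y)%:E)%E.
Proof.
move=> dh dv dw vw t x t0.
pose l := (4 * t)^-1; have l0 : 0 < l by exact: inv4_gt0.
pose q i y := (4 * l ^+ 2 * (x ord0 i - y ord0 i) ^+ 2 - 2 * l) * heat_weight l x y.
have E1 y : heat_kernel_dt t x y = heat_peak t * \sum_i q i y.
  rewrite /heat_kernel_dt heat_kernelE// mulrCA; congr (_ * _).
  rewrite -mulr_suml; congr (_ * _); rewrite sumrB -mulr_sumr sumr_const card_ord.
  have -> : \sum_i (x ord0 i - y ord0 i) ^+ 2 = sqnorm (x - y).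
    by apply: eq_bigr => i _; rewrite !mxE.
  by rewrite -mulr_natr /l; field; exact: lt0r_neq0.
have l2 : 0 < l / 2 by rewrite divr_gt0.
(* Halving the rate turns the quadratic term into 8 l; the constant term adds 2 l. *)
have qb i y : `|q i y| <= (10 * l) * heat_weight (l / 2) x y.
  rewrite /q normrM (ger0_norm (heat_weight_ge0 _ _ _)).
  have hs : heat_weight l x y <= heat_weight (l / 2) x y.
    rewrite /heat_weight ler_expR lerN2 ler_wpM2r ?sqnorm_ge0//.
    by rewrite ler_pdivrMr// ler_peMr ?ler1n// ltW.
  have hs2 : l * sqnorm (x - y) * heat_weight l x y <= 2 * heat_weight (l / 2) x y.
    rewrite /heat_weight; set X := l / 2 * sqnorm (x - y).
    have -> : l * sqnorm (x - y) = X + X by rewrite /X; field.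
    rewrite opprD expRD (_ : (X + X) * _ = 2 * (X * expR (- X) * expR (- X))); last by ring.
    rewrite ler_pM2l// -[leRHS]mul1r ler_wpM2r ?expR_ge0// expRN ler_pdivrMr ?expR_gt0// mul1r.
    by apply: le_trans (expR_ge1Dx X); rewrite lerDr.
  have hi : (x ord0 i - y ord0 i) ^+ 2 <= sqnorm (x - y).
    rewrite /sqnorm (bigD1 i)//= !mxE lerDl; apply: sumr_ge0 => j _; exact: sqr_ge0.
  apply: le_trans (_ : (4 * l ^+ 2 * sqnorm (x - y) + 2 * l) * heat_weight l x y <= _).
    apply: ler_wpM2r; first exact: heat_weight_ge0.
    apply: le_trans (ler_normB _ _) _; apply: lerD; last by rewrite ger0_norm// mulr_ge0// ltW.
    rewrite ger0_norm; last by rewrite mulr_ge0 ?sqr_ge0// mulr_ge0 ?sqr_ge0.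
    by apply: ler_wpM2l => //; rewrite mulr_ge0 ?sqr_ge0.
  rewrite mulrDl (_ : 10 * l = 8 * l + 2 * l); last by ring.
  rewrite [leRHS]mulrDl; apply: lerD; last by rewrite ler_wpM2l// mulr_ge0// ltW.
  rewrite (_ : 4 * l ^+ 2 * _ * _ = 4 * l * (l * sqnorm (x - y) * heat_weight l x y)); last by ring.
  by rewrite (_ : 8 * l * _ = 4 * l * (2 * heat_weight (l / 2) x y)) ?ler_wpM2l ?mulr_ge0 ?(ltW l0)//; ring.
have mq i : measurable_fun setT (q i).
  apply: measurable_funM; last exact: measurable_heat_weight.
  apply: measurable_funB => //; apply: measurable_funM => //; apply: measurable_funX.
  by apply: measurable_funB => //; exact: measurable_coord_rV.
have l10 : 0 <= 10 * l by rewrite mulr_ge0// ltW.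
have iq i := dominated_integrable dh dv (mq i) l10 l2 (qb i).
(* The nested term is merely a proof that the absolute value of [heat_weight l x y] is at most 1
   times it. *)
have iw i := dominated_integrable dh (dw i) (measurable_heat_weight l x) ler01 l0
  (fun y => eq_ind_r (fun u => _ <= u) (eq_ind_r (fun u => u <= _) (lexx _) (ger0_norm (heat_weight_ge0 l x y))) (mul1r _)).
transitivity (\int[mu]_y ((heat_peak t)%:E * \sum_i (v y * q i y)%:E))%E.
  apply: eq_integral => y _; rewrite E1 sumEFin -EFinM; congr EFin.
  by rewrite mulrCA mulr_sumr.
have is1 : mu.-integrable setT (fun y => \sum_i (v y * q i y)%:E)%E.
  by apply: integrable_sum => //= i _; exact: iq.
have is2 : mu.-integrable setT (fun y => \sum_i (w i y * heat_weight l x y)%:E)%E.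
  by apply: integrable_sum => //= i _; exact: iw.
rewrite integralZl// integral_sum//.
rewrite (eq_bigr (fun i => \int[mu]_y (w i y * heat_weight l x y)%:E)%E); last first.
  by move=> i _; exact: (weak_heat dh dv (dw i) (vw i) x l0).
rewrite -integral_sum// -integralZl//; apply: eq_integral => y _.
by rewrite sumEFin -EFinM heat_kernelE// -mulr_suml mulrCA.
Qed.

End heat_kernel.

(** * The heat semigroup and its time integral *)

Section heat_time.
Context {R : realType} (n : nat).
Local Notation mu := (@lebesgue_rV R n).
Local Notation leb := (@lebesgue_measure R).
Local Notation mR := (measurableTypeR R).
Implicit Types (x y : 'rV[R]_n) (v w h : 'rV[R]_n -> R) (t : R).

(** The power with exponent -1 is the inverse on the nonnegative half-line; the negative one is
    treated by reflection, and the last factor keeps the value 0 at 0. *)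
Lemma measurable_inv : measurable_fun setT (fun t : R => t^-1).
Proof.
rewrite (_ : (fun t : R => t^-1) = fun t => if 0 < t then t `^ (-1) else - (- t) `^ (-1) * (if t < 0 then 1 else 0)).
  apply: measurable_fun_ifT.
  - exact: measurable_fun_ltr.
  - exact: measurable_powR.
  - apply: measurable_funM.
      apply: measurableT_comp => //; apply: (measurableT_comp (measurable_powR _)).
      by apply: continuous_measurable_fun; exact: opp_continuous.
    apply: measurable_fun_ifT => //.
    exact: measurable_fun_ltr.
apply/funext => t; have [t0|t0|<-] := ltgtP 0 t.
- by rewrite powR_inv1// ltW.
- by rewrite powR_inv1 ?oppr_ge0 ?ltW// mulr1 invrN opprK.
- by rewrite invr0 mulr0.
Qed.

Lemma measurable_heat_kernel_ty x :
  measurable_fun setT (fun z : mR * 'rV[R]_n => heat_kernel z.1 x z.2).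
Proof.
apply: (measurableT_comp (@measurable_heat_kernel R n)
  (g := fun z : mR * 'rV[R]_n => ((z.1, x), z.2))).
by apply: measurable_fun_pair => //; apply: measurable_fun_pair.
Qed.

Lemma measurable_heat_kernel_dt x :
  measurable_fun setT (fun z : mR * 'rV[R]_n => heat_kernel_dt z.1 x z.2).
Proof.
rewrite /heat_kernel_dt; apply: measurable_funM; last exact: measurable_heat_kernel_ty.
have m1 : measurable_fun setT (fun z : mR * 'rV[R]_n => z.1 : R) by exact: measurable_fst.
apply: measurable_funB; apply: measurable_funM => //.
- exact: (measurableT_comp (measurable_sqnorm_sub x) measurable_snd).
- apply: (measurableT_comp measurable_inv); apply: measurable_funM => //.
  exact: measurable_funX.
- by apply: (measurableT_comp measurable_inv); apply: measurable_funM.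
Qed.

Lemma heat_weight_le l1 l2 x y : l1 <= l2 -> heat_weight l2 x y <= heat_weight l1 x y.
Proof. by move=> l12; rewrite /heat_weight ler_expR lerN2 ler_wpM2r// sqnorm_ge0. Qed.

Lemma heat_weight_sqnorm (l : R) x y : 0 <= l ->
  l * sqnorm (x - y) * heat_weight l x y <= 2 * heat_weight (l / 2) x y.
Proof.
move=> l0; rewrite /heat_weight; set X := l / 2 * sqnorm (x - y).
have -> : l * sqnorm (x - y) = X + X by rewrite /X; field.
rewrite opprD expRD (_ : (X + X) * _ = 2 * (X * expR (- X) * expR (- X))); last by ring.
rewrite ler_pM2l// -[leRHS]mul1r ler_wpM2r ?expR_ge0// expRN ler_pdivrMr ?expR_gt0// mul1r.
by apply: le_trans (expR_ge1Dx X); rewrite lerDr.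
Qed.

(** The peak is largest at time [e] and the spread at time [T]. The rate 1/(8 T), half that of the
    kernel at time [T], leaves room for the quadratic factor of the time derivative, so that one
    Gaussian bounds both. *)
Lemma heat_kernel_time_bound (e T : R) : 0 < e -> e <= T ->
  forall t x y, e <= t -> t <= T ->
  heat_kernel t x y <= heat_peak n e * heat_weight (8 * T)^-1 x y.
Proof.
move=> e0 eT t x y et tT; have t0 := lt_le_trans e0 et.
rewrite heat_kernelE// ler_pM ?heat_weight_ge0 ?(ltW (heat_peak_gt0 _ t0))//.
  exact: heat_peak_le.
by apply: heat_weight_le; rewrite lef_pV2 ?posrE; lra.
Qed.

Lemma heat_kernel_dt_time_bound (e T : R) : 0 < e -> e <= T ->
  forall t x y, e <= t -> t <= T ->
  `|heat_kernel_dt t x y| <= heat_peak n e * (2 / e + n%:R / (2 * e)) * heat_weight (8 * T)^-1 x y.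
Proof.
move=> e0 eT t x y et tT; have t0 := lt_le_trans e0 et.
have hp := heat_peak_gt0 n t0.
rewrite /heat_kernel_dt heat_kernelE// mulrCA normrM (ger0_norm (ltW hp)) -mulrA.
apply: ler_pM => //; [exact: ltW|exact: heat_peak_le|].
rewrite normrM (ger0_norm (heat_weight_ge0 _ _ _)).
apply: le_trans (_ : (sqnorm (x - y) / (4 * t ^+ 2) + n%:R / (2 * t)) * heat_weight (4 * t)^-1 x y <= _).
  apply: ler_wpM2r; first exact: heat_weight_ge0.
  apply: le_trans (ler_normB _ _) _.
  by rewrite !ger0_norm// ?divr_ge0 ?sqnorm_ge0 ?mulr_ge0 ?sqr_ge0// ltW.
rewrite mulrDl [leRHS]mulrDl; apply: lerD.
  have := @heat_weight_sqnorm (4 * t)^-1 x y (ltW (inv4_gt0 t0)).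
  have -> : sqnorm (x - y) / (4 * t ^+ 2) * heat_weight (4 * t)^-1 x y =
     t^-1 * ((4 * t)^-1 * sqnorm (x - y) * heat_weight (4 * t)^-1 x y).
    by field; exact: lt0r_neq0.
  move=> h1; apply: le_trans (ler_wpM2l _ h1) _; first by rewrite invr_ge0 ltW.
  rewrite mulrA; apply: ler_pM; rewrite ?heat_weight_ge0 ?mulr_ge0 ?invr_ge0 ?(ltW t0)//.
    by rewrite mulrC ler_pM2l// lef_pV2 ?posrE.
  apply: heat_weight_le; rewrite -invfM lef_pV2 ?posrE ?mulr_gt0//; last by lra.
  by lra.
apply: ler_pM; rewrite ?heat_weight_ge0 ?divr_ge0 ?mulr_ge0 ?(ltW t0)//.
  by rewrite ler_wpM2l// lef_pV2 ?posrE ?mulr_gt0//; lra.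
by apply: heat_weight_le; rewrite lef_pV2 ?posrE ?mulr_gt0//; lra.
Qed.

Definition heat v t x : R := \int[mu]_y (v y * heat_kernel t x y).
Definition heat_dt v t x : R := \int[mu]_y (v y * heat_kernel_dt t x y).

Lemma EFin_heat h v t x : dominating h -> dominated h v -> 0 < t ->
  (heat v t x)%:E = (\int[mu]_y (v y * heat_kernel t x y)%:E)%E.
Proof.
move=> dh dv t0; rewrite /heat /Rintegral fineK//.
exact: integrable_fin_num (integrable_dominated_heat x dh dv t0).
Qed.

Lemma measurable_heat_kernel_dt_y t x : measurable_fun setT (heat_kernel_dt t x).
Proof.
exact: (measurableT_comp (measurable_heat_kernel_dt x) (pair1_measurable t)).
Qed.

Lemma integrable_dominated_heat_dt h v t x : dominating h -> dominated h v -> 0 < t ->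
  mu.-integrable setT (EFin \o (fun y => v y * heat_kernel_dt t x y)).
Proof.
move=> dh dv t0.
apply: (@dominated_integrable _ _ h v _ (heat_peak n t * (2 / t + n%:R / (2 * t))) (8 * t)^-1 x) => //.
- exact: measurable_heat_kernel_dt_y.
- by rewrite mulr_ge0 ?(ltW (heat_peak_gt0 _ _))// addr_ge0// divr_ge0 ?mulr_ge0 ?(ltW t0).
- by rewrite invr_gt0 mulr_gt0.
- by move=> y; exact: heat_kernel_dt_time_bound.
Qed.

Lemma EFin_heat_dt h v t x : dominating h -> dominated h v -> 0 < t ->
  (heat_dt v t x)%:E = (\int[mu]_y (v y * heat_kernel_dt t x y)%:E)%E.
Proof.
move=> dh dv t0; rewrite /heat_dt /Rintegral fineK//.
exact: integrable_fin_num (integrable_dominated_heat_dt x dh dv t0).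
Qed.

(** * The heat flow multiplied by a scalar function of time, integrated in time *)

Section time_integral.
Variables (E E' : R -> R) (C : R).
Hypothesis dE : forall t : R, is_derive t 1 E (E' t).
Hypothesis cE' : continuous E'.
Hypothesis E_le1 : forall t, 0 < t -> `|E t| <= 1.
Hypothesis E'_leC : forall t, 0 < t -> `|E' t| <= C.

Let cE : continuous E.
Proof.
move=> t; apply/differentiable_continuous/derivable1_diffP.
by have := dE t; case.
Qed.

Let F t x y := E' t * heat_kernel t x y + E t * heat_kernel_dt t x y.

Let dFP t x y : 0 < t -> is_derive t 1 (fun t => E t * heat_kernel t x y) (F t x y).
Proof.
move=> t0; apply: (is_derive_eq (is_deriveM (dE t) (is_derive_heat_kernel x y t0))).
by rewrite /GRing.scale /= /F; ring.
Qed.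

Let continuous_F t x y : 0 < t -> {for t, continuous (fun t => F t x y)}.
Proof.
move=> t0.
have ck : {for t, continuous (fun t => heat_kernel t x y)}.
  apply/differentiable_continuous/derivable1_diffP.
  by have := is_derive_heat_kernel x y t0; case.
apply: cvgD; apply: cvgM; [exact: cE'|exact: ck|exact: cE|].
apply: cvgM; last exact: ck.
apply: (@cvgB _ R^o); apply: cvgM; try exact: cvg_cst.
  apply: cvgV; first by rewrite mulf_neq0 ?expf_neq0 ?gt_eqF.
  by apply: cvgM; [exact: cvg_cst|exact: exprn_continuous].
apply: cvgV; first by rewrite mulf_neq0 ?gt_eqF.
by apply: cvgM; [exact: cvg_cst|exact: cvg_id].
Qed.

Let integral_F (e T : R) x y : 0 < e -> e < T ->
  (\int[leb]_(t in `[e, T]) (F t x y)%:E = (E T * heat_kernel T x y - E e * heat_kernel e x y)%:E)%E.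
Proof.
move=> e0 eT.
have pos t : t \in `[e, T] -> 0 < t.
  by rewrite in_itv/= => /andP[+ _]; exact: lt_le_trans.
have cG t : 0 < t -> {for t, continuous (fun t => E t * heat_kernel t x y)}.
  move=> t0; apply/differentiable_continuous/derivable1_diffP.
  by have := dFP x y t0; case.
rewrite (@continuous_FTC2 _ _ (fun t => E t * heat_kernel t x y))//.
- apply: continuous_in_subspaceT => t; rewrite inE/= => /pos; exact: continuous_F.
- split.
  + move=> t teT; have t0 : 0 < t by apply: pos; exact: subset_itv_oo_cc.
    by have := dFP x y t0; case.
  + exact/cvg_at_right_filter/cG.
  + by apply/cvg_at_left_filter/cG; exact: lt_trans eT.
- move=> t teT; have t0 : 0 < t by apply: pos; exact: subset_itv_oo_cc.
  by rewrite derive1E; apply: derive_val; exact: dFP.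
Qed.

Let measurable_E : measurable_fun setT E.
Proof. exact: continuous_measurable_fun. Qed.

Let measurable_E' : measurable_fun setT E'.
Proof. exact: continuous_measurable_fun. Qed.

Let measurable_F x : measurable_fun setT (fun z : mR * 'rV[R]_n => F z.1 x z.2).
Proof.
apply: measurable_funD; apply: measurable_funM.
- exact: (measurableT_comp measurable_E' measurable_fst).
- exact: measurable_heat_kernel_ty.
- exact: (measurableT_comp measurable_E measurable_fst).
- exact: measurable_heat_kernel_dt.
Qed.

Let F_bound (e T : R) : 0 < e -> e <= T ->
  exists2 K, 0 <= K & forall t x y, e <= t -> t <= T ->
  `|F t x y| <= K * heat_weight (8 * T)^-1 x y.
Proof.
move=> e0 eT; exists (C * heat_peak n e + heat_peak n e * (2 / e + n%:R / (2 * e))).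
  have C0 : 0 <= C by apply: le_trans (E'_leC e0); rewrite normr_ge0.
  by rewrite addr_ge0 ?mulr_ge0 ?(ltW (heat_peak_gt0 _ _))// addr_ge0// divr_ge0 ?mulr_ge0 ?(ltW e0).
move=> t x y et tT; have t0 := lt_le_trans e0 et.
rewrite mulrDl; apply: le_trans (ler_normD _ _) _; rewrite (normrM (E' t)) (normrM (E t)); apply: lerD.
  rewrite -mulrA ler_pM//; first exact: E'_leC.
  by rewrite ger0_norm ?heat_kernel_ge0//; exact: heat_kernel_time_bound.
rewrite -[leRHS]mul1r ler_pM//; first exact: E_le1.
exact: heat_kernel_dt_time_bound.
Qed.

(** For each fixed y the fundamental theorem of calculus is applied to E(t) k_t(x, y) on [e, T], and
    Fubini exchanges the integrals in t and y. This avoids differentiating [heat v t x] under the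
    integral; staying away from t = 0 provides the common Gaussian majorant. *)
Lemma integral_heat_time h v (e T : R) x : dominating h -> dominated h v ->
  0 < e -> e < T ->
  leb.-integrable `[e, T] (fun t => (E' t * heat v t x + E t * heat_dt v t x)%:E) /\
  (\int[leb]_(t in `[e, T]) (E' t * heat v t x + E t * heat_dt v t x)%:E =
   (E T * heat v T x - E e * heat v e x)%:E)%E.
Proof.
move=> dh dv e0 eT; have [K K0 FK] := F_bound e0 (ltW eT).
have T0 := lt_trans e0 eT.
have l0 : 0 < (8 * T)^-1 by rewrite invr_gt0 mulr_gt0.
(* The indicator turns the integral over the time interval into one over the whole product space,
   where Fubini is stated. *)
pose G (z : mR * 'rV[R]_n) := (\1_(`[e, T]%classic : set R) z.1 * (v z.2 * F z.1 x z.2)).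
have mG : measurable_fun setT G.
  apply: measurable_funM.
    apply: (measurableT_comp _ measurable_fst); exact: measurable_indic.
  apply: measurable_funM; last exact: measurable_F.
  exact: (measurableT_comp dv.1 measurable_snd).
have iE := dominating_bound_integrable K x dh l0.
have GK t y : `|G (t, y)| <= \1_(`[e, T]%classic : set R) t * (K * heat_weight (8 * T)^-1 x y + K * h y).
  rewrite /G /= normrM indicE; case: (boolP (_ \in _)) => /=; last by rewrite normr0 !mul0r.
  rewrite inE/= in_itv/= => /andP[et tT]; rewrite normr1 !mul1r.
  by apply: (dominatedM_bound dh dv K0 l0) => z; exact: FK.
have iG : (leb \x mu)%E.-integrable setT (EFin \o G).
  apply/integrable12ltyP; first exact/measurable_EFinP.
  pose M := fine (\int[mu]_y (K * heat_weight (8 * T)^-1 x y + K * h y)%:E)%E.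
  have ME : M%:E = (\int[mu]_y (K * heat_weight (8 * T)^-1 x y + K * h y)%:E)%E.
    by rewrite /M fineK//; exact: integrable_fin_num iE.
  apply: (@le_lt_trans _ _ (\int[leb]_t (\1_(`[e, T]%classic : set R) t * M)%:E)%E).
    apply: ge0_le_integral => //.
    - by move=> t _; apply: integral_ge0.
    - apply: (@measurable_fun_fubini_tonelli_F _ _ mR _ _ mu (fun z => `|(G z)%:E|)%E) => //.
      by apply: measurableT_comp => //; exact/measurable_EFinP.
    - by apply/measurable_EFinP; apply: measurable_funM => //; exact: measurable_indic.
    - move=> t _; rewrite EFinM ME -(integralZl measurableT iE).
      apply: ge0_le_integral => //.
      + by apply: measurableT_comp => //; apply/measurable_EFinP; exact: (measurableT_comp mG (pair1_measurable t)).
      + by apply: emeasurable_funM => //; exact: (measurable_int _ iE).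
      + by move=> y _ /=; rewrite -EFinM lee_fin; exact: GK.
  under eq_integral do rewrite EFinM.
  rewrite ge0_integralZr//.
  - by rewrite integral_indic//= setIT lebesgue_measure_itv/= lte_fin eT -EFinB -EFinM ltry.
  - by apply/measurable_EFinP; exact: measurable_indic.
  - rewrite ME; apply: integral_ge0 => y _; rewrite lee_fin.
    by rewrite addr_ge0 ?mulr_ge0 ?heat_weight_ge0//; case: dh.
have inner t : t \in `[e, T] -> (\int[mu]_y (G (t, y))%:E)%E = (E' t * heat v t x + E t * heat_dt v t x)%:E.
  move=> teT; have t0 : 0 < t by move: teT; rewrite in_itv/= => /andP[+ _]; exact: lt_le_trans.
  have i1 := integrable_dominated_heat x dh dv t0.
  have i2 := integrable_dominated_heat_dt x dh dv t0.
  rewrite EFinD !EFinM (EFin_heat _ dh)// (EFin_heat_dt _ dh)// -!integralZl// -integralD//.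
  - apply: eq_integral => y _; rewrite /G /= indicE mem_set// mul1r -!EFinM -EFinD.
    by congr EFin; rewrite /F; ring.
  - exact: integrableZl.
  - exact: integrableZl.
have E1 : (fun t => \int[mu]_y (G (t, y))%:E)%E =
    (fun t => (E' t * heat v t x + E t * heat_dt v t x)%:E) \_ `[e, T].
  apply/funext => t; rewrite patchE; case: ifPn => [|tn].
    by rewrite inE/= => teT; exact: inner.
  rewrite -[RHS](integral0 mu setT); apply: eq_integral => y _.
  by rewrite /G /= indicE (negbTE tn) mul0r.
split.
  apply/(integrable_mkcond _ _).2 => //.
  by have := integrable_fubini_F iG; rewrite /fubini_F /= E1.
rewrite integral_mkcond -E1 (Fubini iG).
have T1 := integrable_dominated_heat x dh dv T0.
have T2 := integrable_dominated_heat x dh dv e0.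
transitivity (\int[mu]_y ((E T)%:E * (v y * heat_kernel T x y)%:E
    - (E e)%:E * (v y * heat_kernel e x y)%:E))%E; last first.
  rewrite (integralB measurableT (integrableZl measurableT _ T1) (integrableZl measurableT _ T2)).
  have H1 := EFin_heat x dh dv T0; have H2 := EFin_heat x dh dv e0.
  have -> : (E T * heat v T x - E e * heat v e x)%:E =
    ((E T)%:E * (heat v T x)%:E - (E e)%:E * (heat v e x)%:E)%E by [].
  congr (_ - _)%E.
    exact: (etrans (integralZl measurableT T1 _) (congr1 (fun z => (E T)%:E * z)%E (esym H1))).
  exact: (etrans (integralZl measurableT T2 _) (congr1 (fun z => (E e)%:E * z)%E (esym H2))).
apply: eq_integral => y _.
have iF : leb.-integrable `[e, T] (EFin \o (fun t => F t x y)).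
  apply: continuous_compact_integrable; first exact: segment_compact.
  apply: continuous_in_subspaceT => t; rewrite inE/= in_itv/= => /andP[et _].
  exact: continuous_F (lt_le_trans e0 et).
transitivity ((v y)%:E * \int[leb]_(t in `[e, T]) (F t x y)%:E)%E; last first.
  rewrite integral_F// -!EFinM -EFinB; congr EFin; ring.
rewrite -(integralZl _ iF)// [in RHS]integral_mkcond.
apply: eq_integral => t _; rewrite /= patchE /G /= indicE.
by case: (boolP (_ \in _)) => _; rewrite ?mul1r ?mul0r.
Qed.

End time_integral.
End heat_time.

(** * Small times *)

(** Tonelli's measurability, applied to the positive and the negative part. *)
Lemma measurable_fubini d1 d2 (T1 : measurableType d1) (T2 : measurableType d2)
    (R : realType) (m : {sigma_finite_measure set T2 -> \bar R})
    (f : T1 * T2 -> \bar R) : measurable_fun setT f ->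
  measurable_fun setT (fun x => \int[m]_y f (x, y))%E.
Proof.
move=> mf; under eq_fun do rewrite integralE.
apply: emeasurable_funB.
- have mp : measurable_fun setT (f^\+)%E by exact: measurable_funepos.
  have H := @measurable_fun_fubini_tonelli_F _ _ T1 T2 R m _ mp.
  rewrite (_ : (fun x => _) = fubini_F m (f^\+)%E); last first.
    by apply/funext => x; apply: eq_integral => y _; rewrite !funeposE.
  by apply: H => x; exact: funepos_ge0.
- have mn : measurable_fun setT (f^\-)%E by exact: measurable_funeneg.
  have H := @measurable_fun_fubini_tonelli_F _ _ T1 T2 R m _ mn.
  rewrite (_ : (fun x => _) = fubini_F m (f^\-)%E); last first.
    by apply/funext => x; apply: eq_integral => y _; rewrite !funenegE.
  by apply: H => x; exact: funeneg_ge0.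
Qed.

(** * The heat flow of an interval on the line *)

Section heat_box.
Context {R : realType}.
Local Notation leb := (@lebesgue_measure R).
Local Notation mR := (measurableTypeR R).

Definition heat1 (t s u : R) : R := (Num.sqrt (4 * pi * t))^-1 * gauss1 (4 * t)^-1 s u.

(** The heat flow at time [t] of the indicator of ]a, b], evaluated at [s]. *)
Definition heat1_itv (a b t s : R) : R := \int[leb]_(u in `]a, b]) heat1 t s u.

Lemma sqrt4pi_gt0 (t : R) : 0 < t -> 0 < Num.sqrt (4 * pi * t).
Proof. by move=> t0; rewrite sqrtr_gt0 !mulr_gt0// pi_gt0. Qed.

Lemma heat1_ge0 (t s u : R) : 0 <= heat1 t s u.
Proof. by rewrite /heat1 mulr_ge0 ?gauss1_ge0// invr_ge0 sqrtr_ge0. Qed.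

Lemma measurable_heat1 (t s : R) : measurable_fun setT (heat1 t s).
Proof.
apply: measurable_funM => //; exact: measurable_gauss1.
Qed.

Lemma integral_heat1 (t s : R) : 0 < t -> (\int[leb]_u (heat1 t s u)%:E = 1)%E.
Proof.
move=> t0; under eq_integral do rewrite EFinM.
rewrite ge0_integralZl_EFin//.
- rewrite integral_gauss1 ?inv4_gt0// invrK -EFinM; congr EFin.
  rewrite (_ : pi * (4 * t) = 4 * pi * t); last by ring.
  by rewrite mulVf// gt_eqF// sqrt4pi_gt0.
- by move=> u _; rewrite lee_fin gauss1_ge0.
- by apply/measurable_EFinP; exact: measurable_gauss1.
Qed.

Lemma integrable_heat1 (t s : R) (D : set R) : measurable D -> 0 < t ->
  leb.-integrable D (EFin \o heat1 t s).
Proof.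
move=> mD t0; apply: (@integrableS _ _ _ _ setT) => //; apply/integrableP; split.
  by apply/measurable_EFinP; exact: measurable_heat1.
under eq_integral do rewrite /= ger0_norm ?heat1_ge0//.
by rewrite integral_heat1// ltry.
Qed.

Lemma EFin_heat1_itv (a b t s : R) : 0 < t ->
  (heat1_itv a b t s)%:E = (\int[leb]_(u in `]a, b]) (heat1 t s u)%:E)%E.
Proof.
move=> t0; rewrite /heat1_itv /Rintegral fineK//.
by apply: integrable_fin_num => //; exact: integrable_heat1.
Qed.

Lemma heat1_itv_ge0 (a b t s : R) : 0 <= heat1_itv a b t s.
Proof. by apply: Rintegral_ge0 => u _; exact: heat1_ge0. Qed.

(** Half of the exponent is split off as a decay factor; the other half is still a probability
    density, at time 2 t. The ratio of the two peaks is the square root of 2. *)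
Lemma heat1_half (t s u : R) : 0 < t ->
  heat1 t s u = Num.sqrt 2 * expR (- ((u - s) ^+ 2 / (8 * t))) * heat1 (2 * t) s u.
Proof.
move=> t0; rewrite /heat1 /gauss1.
have -> : 4 * pi * (2 * t) = 2 * (4 * pi * t) by ring.
rewrite (sqrtrM _ (ler0n _ 2)).
have s20 : Num.sqrt (2 : R) != 0 by rewrite gt_eqF// sqrtr_gt0.
have -> : (4 * t)^-1 * (u - s) ^+ 2 = (u - s) ^+ 2 / (8 * t) + (4 * (2 * t))^-1 * (u - s) ^+ 2.
  by field; exact: lt0r_neq0.
rewrite opprD expRD; move: (expR _) (expR _) => A B.
by field; rewrite s20 gt_eqF// sqrt4pi_gt0.
Qed.

(** A majorant independent of [t], for dominated convergence as t tends to 0: the split-off decay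
    factor is bounded on the interval and the remaining density has mass at most 1. *)
Lemma heat1_itv_bound (a b M t s : R) : 0 < t -> t <= 1 -> `|a| <= M -> `|b| <= M ->
  heat1_itv a b t s <= Num.sqrt 2 * expR (M ^+ 2 / 8) * gauss1 (16^-1) 0 s.
Proof.
move=> t0 t1 aM bM; set K := _ * _ * _.
have t20 : 0 < 2 * t by rewrite mulr_gt0.
have K0 : 0 <= K by rewrite !mulr_ge0 ?sqrtr_ge0 ?expR_ge0 ?gauss1_ge0.
rewrite -lee_fin EFin_heat1_itv//.
apply: (@le_trans _ _ (\int[leb]_(u in `]a, b]) (K%:E * (heat1 (2 * t) s u)%:E))%E).
  apply: ge0_le_integral => //.
  - by move=> u _; rewrite lee_fin heat1_ge0.
  - by apply/measurable_EFinP/measurable_funTS; exact: measurable_heat1.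
  - by apply: emeasurable_funM => //; apply/measurable_EFinP/measurable_funTS; exact: measurable_heat1.
  - move=> u /=; rewrite in_itv/= => /andP[au ub].
    rewrite -EFinM lee_fin heat1_half// ler_wpM2r ?heat1_ge0//.
    rewrite /K /gauss1 -mulrA ler_wpM2l ?sqrtr_ge0// -expRD ler_expR subr0.
    have u2 : u ^+ 2 <= M ^+ 2.
      have uM : `|u| <= M.
        rewrite ler_norml; move: aM bM; rewrite !ler_norml => /andP[? ?] /andP[? ?].
        by apply/andP; split; lra.
      by rewrite -(real_normK (num_real u)) lerXn2r ?nnegrE// (le_trans _ uM).
    have h1 : (u - s) ^+ 2 / 8 <= (u - s) ^+ 2 / (8 * t).
      by rewrite ler_wpM2l ?sqr_ge0// lef_pV2 ?posrE ?mulr_gt0//; lra.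
    (* Rearranged, this square says (u - s)^2 / 8 >= s^2 / 16 - u^2 / 8, whence the rate 1/16. *)
    have h2 : 0 <= (2 * u - s) ^+ 2 by rewrite sqr_ge0.
    by nra.
rewrite ge0_integralZl_EFin//.
- rewrite -[leRHS]mule1 lee_wpmul2l ?lee_fin// -(integral_heat1 s t20).
  apply: ge0_subset_integral => //.
  + by apply/measurable_EFinP; exact: measurable_heat1.
  + by move=> u _; rewrite lee_fin heat1_ge0.
- by move=> u _; rewrite lee_fin heat1_ge0.
- by apply/measurable_EFinP/measurable_funTS; exact: measurable_heat1.
Qed.

(** The split-off factor exp(-X) is at most 1/X, and X >= de^2 / (8 t) at distance [de] from [s]. *)
Lemma integral_heat1_far (D : set R) (t s de : R) : measurable D -> 0 < t -> 0 < de ->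
  (forall u, D u -> de <= `|u - s|) ->
  (\int[leb]_(u in D) (heat1 t s u)%:E <= (Num.sqrt 2 * (8 * t / de ^+ 2))%:E)%E.
Proof.
move=> mD t0 de0 hD; set K := _ * _.
have t20 : 0 < 2 * t by rewrite mulr_gt0.
have K0 : 0 <= K by rewrite !mulr_ge0 ?invr_ge0 ?sqr_ge0 ?sqrtr_ge0 ?(ltW t0).
apply: (@le_trans _ _ (\int[leb]_(u in D) (K%:E * (heat1 (2 * t) s u)%:E))%E).
  apply: ge0_le_integral => //.
  - by move=> u _; rewrite lee_fin heat1_ge0.
  - by apply/measurable_EFinP/measurable_funTS; exact: measurable_heat1.
  - by apply: emeasurable_funM => //; apply/measurable_EFinP/measurable_funTS; exact: measurable_heat1.
  - move=> u Du; rewrite -EFinM lee_fin heat1_half// ler_wpM2r ?heat1_ge0//.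
    rewrite /K ler_wpM2l ?sqrtr_ge0//.
    set X := (u - s) ^+ 2 / (8 * t).
    have dX : de ^+ 2 / (8 * t) <= X.
      rewrite ler_wpM2r ?invr_ge0 ?mulr_ge0 ?(ltW t0)// -(real_normK (num_real (u - s))).
      by rewrite lerXn2r ?nnegrE ?normr_ge0 ?(ltW de0)// hD.
    have X0 : 0 < de ^+ 2 / (8 * t) by rewrite divr_gt0 ?exprn_gt0 ?mulr_gt0.
    rewrite expRN -[leRHS]invrK lef_pV2 ?posrE ?invr_gt0 ?expR_gt0//; last first.
      by rewrite divr_gt0 ?exprn_gt0 ?mulr_gt0.
    rewrite invf_div; apply: le_trans dX _; apply: le_trans (expR_ge1Dx X).
    by rewrite lerDr.
rewrite ge0_integralZl_EFin//.
- rewrite -[leRHS]mule1 lee_wpmul2l ?lee_fin// -(integral_heat1 s t20).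
  apply: ge0_subset_integral => //.
  + by apply/measurable_EFinP; exact: measurable_heat1.
  + by move=> u _; rewrite lee_fin heat1_ge0.
- by move=> u _; rewrite lee_fin heat1_ge0.
- by apply/measurable_EFinP/measurable_funTS; exact: measurable_heat1.
Qed.

(** The error is the mass lost outside the interval when [s] lies inside it, and the mass gained
    when [s] lies outside; either way this mass sits at a distance from [s] not below that of the
    nearer endpoint. The bound degenerates at the endpoints, hence their exclusion. *)
Lemma heat1_itv_near (a b t s : R) : 0 < t -> s != a -> s != b ->
  `|heat1_itv a b t s - \1_(`]a, b]%classic : set R) s| <=
  Num.sqrt 2 * (8 * t / Num.min `|s - a| `|s - b| ^+ 2).
Proof.
move=> t0 sa sb; set de := Num.min _ _.
have de0 : 0 < de by rewrite lt_min !normr_gt0 !subr_eq0 sa sb.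
have dea : de <= `|s - a| by rewrite ge_min lexx.
have deb : de <= `|s - b| by rewrite ge_min lexx orbT.
rewrite indicE; have [sin|sout] := boolP (s \in _).
  have : (\int[leb]_(u in ~` `]a, b]) (heat1 t s u)%:E <= (Num.sqrt 2 * (8 * t / de ^+ 2))%:E)%E.
    apply: integral_heat1_far => //; first exact: measurableC.
    move=> u /=; rewrite in_itv/= => /negP; rewrite negb_and -leNgt -ltNge.
    move: sin; rewrite inE/= in_itv/= => /andP[as_ sb_] /orP[ua|bu].
      apply: le_trans dea _; rewrite (distrC u) [leLHS]ger0_norm; last by rewrite subr_ge0 ltW.
      by apply: le_trans (ler_norm _); lra.
    apply: le_trans deb _; rewrite distrC [leLHS]ger0_norm; last by rewrite subr_ge0.
    by apply: le_trans (ler_norm _); lra.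
  have E := integral_heat1 s t0.
  rewrite -(setUCr (`]a, b]%classic : set R)) ge0_integral_setU// in E; last 4 first.
  - exact: measurableC.
  - by rewrite setUCr; apply/measurable_EFinP; exact: measurable_heat1.
  - by move=> u _; rewrite lee_fin heat1_ge0.
  - by apply/disj_setPCl.
  rewrite -EFin_heat1_itv// in E.
  have := E; set J := (\int[leb]_(u in ~` _) _)%E => EJ.
  have J1 : J = (1 - heat1_itv a b t s)%:E.
    by rewrite EFinB -EJ addeAC subee// add0e.
  rewrite J1 lee_fin => hJ; apply: le_trans hJ => /=.
  rewrite distrC ger0_norm// -lee_fin -J1; apply: integral_ge0 => u _.
  by rewrite lee_fin heat1_ge0.
rewrite subr0 ger0_norm ?heat1_itv_ge0// -lee_fin EFin_heat1_itv//.
apply: integral_heat1_far => // u /=; rewrite in_itv/= => /andP[au ub].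
move: sout; rewrite notin_setE/= in_itv/= => /negP; rewrite negb_and -leNgt -ltNge => /orP[ua|bu].
  apply: le_trans dea _; rewrite distrC [leLHS]ger0_norm; last by rewrite subr_ge0.
  by apply: le_trans (ler_norm _); lra.
apply: le_trans deb _; rewrite (distrC u) [leLHS]ger0_norm; last by rewrite subr_ge0 ltW.
by apply: le_trans (ler_norm _); lra.
Qed.

End heat_box.

(** * The heat flow of a box and its limit at time 0 *)

Section heat_box_rV.
Context {R : realType} (n : nat).
Local Notation mu := (@lebesgue_rV R n).
Local Notation leb := (@lebesgue_measure R).
Implicit Types (x y : 'rV[R]_n) (v w h : 'rV[R]_n -> R) (t : R) (a b : 'I_n -> R).

Lemma heat_kernel_prod t x y : 0 < t ->
  heat_kernel t x y = \prod_i heat1 t (y ord0 i) (x ord0 i).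
Proof.
move=> t0; rewrite heat_kernel_sym heat_kernelE// heat_weightE.
rewrite /heat1 big_split /= prodr_const card_ord heat_peakE// exprVn.
by congr (_^-1 * _); congr (Num.sqrt _ ^+ n); rewrite invrK; ring.
Qed.

(** The heat flow of the indicator of the box, which is a product because kernel and indicator are
    ([integral_box_heat]). *)
Definition box_heat a b t y : R := tensor (fun i => heat1_itv (a i) (b i) t) y.

Lemma indic_box a b x :
  \1_(box a b) x = \prod_i \1_(`]a i, b i]%classic : set R) (x ord0 i) :> R.
Proof.
rewrite indicE; case: (boolP (x \in _)) => [|] xab.
  rewrite big1// => i _; rewrite indicE mem_set//.
  by move: xab; rewrite inE => /(_ i).
have [i xi] : exists i, x ord0 i \notin `]a i, b i].
  apply/existsP; move: xab; apply: contraNT; rewrite negb_exists => /forallP h.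
  by rewrite inE => i; have := h i; rewrite negbK.
by rewrite (bigD1 i)//= indicE memNset ?mul0r// => /=; exact/negP.
Qed.

Lemma integral_box_heat a b t y : 0 < t ->
  (\int[mu]_(x in box a b) (heat_kernel t x y)%:E = (box_heat a b t y)%:E)%E.
Proof.
move=> t0; rewrite integral_mkcond.
pose F i (u : R) := \1_(`]a i, b i]%classic : set R) u * heat1 t (y ord0 i) u.
transitivity (\int[mu]_x (\prod_i F i (x ord0 i))%:E)%E.
  apply: eq_integral => x _; rewrite patchE big_split/= -indic_box indicE.
  by case: ifPn => _; rewrite ?mul1r ?mul0r// heat_kernel_prod.
rewrite ge0_integral_rV_prod.
- rewrite /box_heat /tensor -prodEFin; apply: eq_bigr => i _.
  rewrite EFin_heat1_itv// [in RHS]integral_mkcond; apply: eq_integral => u _.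
  by rewrite patchE /F indicE; case: ifPn => _; rewrite ?mul1r ?mul0r.
- by move=> i; apply: measurable_funM => //; exact: measurable_heat1.
- by move=> i u; rewrite mulr_ge0 ?heat1_ge0.
Qed.

Lemma measurable_box_heat a b t : 0 < t -> measurable_fun setT (box_heat a b t).
Proof.
move=> t0; apply/measurable_EFinP.
have mk : measurable_fun setT (fun z : 'rV[R]_n * 'rV[R]_n =>
    (\1_(box a b) z.2 * heat_kernel t z.2 z.1)%:E).
  apply/measurable_EFinP; apply: measurable_funM.
    apply: (measurableT_comp _ measurable_snd).
    by apply: measurable_indic; exact: measurable_box.
  apply: (measurableT_comp (@measurable_heat_kernel R n)
    (g := fun z : 'rV[R]_n * 'rV[R]_n => ((t : measurableTypeR R, z.2), z.1))).
  by apply: measurable_fun_pair => //; apply: measurable_fun_pair.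
have := measurable_fubini mu mk.
apply: eq_measurable_fun => y _ /=; rewrite -integral_box_heat// [in RHS]integral_mkcond.
by apply: eq_integral => x _; rewrite patchE indicE; case: ifPn => _; rewrite ?mul1r ?mul0r.
Qed.

Lemma box_heat_bound a b : exists2 C : R, 0 <= C & forall t y, 0 < t -> t <= 1 ->
  `|box_heat a b t y| <= C * heat_weight 16^-1 0 y.
Proof.
pose M := \sum_i (`|a i| + `|b i|).
have aM i : `|a i| <= M.
  rewrite /M (bigD1 i)//= -addrA lerDl addr_ge0//; apply: sumr_ge0 => j _.
  by rewrite addr_ge0.
have bM i : `|b i| <= M.
  rewrite /M (bigD1 i)//= addrAC lerDr addr_ge0//; apply: sumr_ge0 => j _.
  by rewrite addr_ge0.
exists ((Num.sqrt 2 * expR (M ^+ 2 / 8)) ^+ n).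
  by rewrite exprn_ge0// mulr_ge0 ?sqrtr_ge0 ?expR_ge0.
move=> t y t0 t1; apply: tensor_bound => j s; rewrite mxE ger0_norm ?heat1_itv_ge0//.
exact: heat1_itv_bound.
Qed.

(** Fubini moves the heat flow from [v] to the indicator of the box. The limit t -> 0 is then needed
    only for indicators, where it holds almost everywhere under a Gaussian majorant, so no
    regularity of [v] enters. *)
Lemma integral_heat_box h v a b t : dominating h -> dominated h v -> 0 < t -> t <= 1 ->
  mu.-integrable (box a b) (EFin \o heat v t) /\
  (\int[mu]_(x in box a b) (heat v t x)%:E = \int[mu]_y (v y * box_heat a b t y)%:E)%E.
Proof.
move=> dh dv t0 t1.
have mB : measurable (box a b) by exact: measurable_box.
pose G (z : 'rV[R]_n * 'rV[R]_n) := \1_(box a b) z.1 * (v z.2 * heat_kernel t z.1 z.2).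
have mG : measurable_fun setT G.
  apply: measurable_funM.
    by apply: (measurableT_comp _ measurable_fst); exact: measurable_indic.
  apply: measurable_funM; first exact: (measurableT_comp dv.1 measurable_snd).
  apply: (measurableT_comp (@measurable_heat_kernel R n)
    (g := fun z : 'rV[R]_n * 'rV[R]_n => ((t : measurableTypeR R, z.1), z.2))).
  by apply: measurable_fun_pair => //; apply: measurable_fun_pair.
have [C C0 bC] := box_heat_bound a b.
have l0 : 0 < 16^-1 :> R by [].
have iv := dominated_integrable dh dv (measurable_box_heat a b t0) C0 l0 (fun y => bC t y t0 t1).
(* Used twice: with c = |v y| for integrability and with c = v y for the value. *)
have inner (c : R) y : (\int[mu]_x (\1_(box a b) x * (c * heat_kernel t x y))%:E = (c * box_heat a b t y)%:E)%E.
  rewrite EFinM -integral_box_heat// -integralZl//; last first.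
    apply: (@integrableS _ _ _ _ setT) => //; apply/integrableP; split.
      by apply/measurable_EFinP; under eq_fun do rewrite heat_kernel_sym; exact: measurable_heat_kernel_y.
    under eq_integral do rewrite /= ger0_norm ?heat_kernel_ge0// heat_kernel_sym.
    by rewrite integral_heat_kernel// ltry.
  rewrite [in RHS]integral_mkcond; apply: eq_integral => x _.
  by rewrite patchE indicE -EFinM; case: ifPn => _; rewrite ?mul1r ?mul0r.
have iG : (mu \x mu)%E.-integrable setT (EFin \o G).
  apply/integrable21ltyP; first exact/measurable_EFinP.
  have [_] := integrableP _ _ _ iv; apply: le_lt_trans.
  rewrite le_eqVlt; apply/orP; left; apply/eqP; apply: eq_integral => y _.
  rewrite /= normrM (ger0_norm (x := box_heat a b t y)); last first.
    by rewrite prodr_ge0// => i _; exact: heat1_itv_ge0.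
  rewrite -inner; apply: eq_integral => x _; rewrite /G /= !normrM.
  rewrite (ger0_norm (heat_kernel_ge0 _ _ _)) ger0_norm// indicE.
have outer x : (\int[mu]_y (G (x, y))%:E = (EFin \o heat v t \_ (box a b)) x)%E.
  rewrite /= patchE /G; case: ifPn => xB /=.
    rewrite (EFin_heat _ dh)//; apply: eq_integral => y _.
    by rewrite indicE xB mul1r.
  by rewrite -[RHS](integral0 mu setT); apply: eq_integral => y _; rewrite indicE (negbTE xB) mul0r.
split.
  apply/(integrable_mkcond _ mB).2 => //.
  have := integrable_fubini_F iG; rewrite /fubini_F; apply: eq_integrable => // x _.
  by rewrite outer /= !patchE; case: ifP.
transitivity (\int[mu]_x \int[mu]_y (G (x, y))%:E)%E.
  rewrite integral_mkcond; apply: eq_integral => x _; rewrite outer /= !patchE.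
  by case: ifP.
have FF := Fubini iG; rewrite [LHS]FF; apply: eq_integral => y _.
by rewrite -inner; apply: eq_integral => x _.
Qed.

Lemma coord_negligible (i : 'I_n) (c : R) :
  {ae mu, forall y, y ord0 i != c}.
Proof.
pose A j : set R := if j == i then [set c] else setT.
have mA j : measurable (A j) by rewrite /A; case: ifP.
exists [set x : 'rV[R]_n | forall j, A j (x ord0 j)]; split.
- rewrite (_ : [set _ | _] = (fun x : 'rV[R]_n => x ord0 i) @^-1` [set c]).
    by rewrite -[X in measurable X]setTI; apply: (@measurable_coord_rV _ R n i) => //.
  apply/seteqP; split => x /=; first by move/(_ i); rewrite /A eqxx.
  by move=> xc j; rewrite /A; case: eqP => // ->.
- rewrite lebesgue_rV_box// (bigD1 i)//= /A eqxx lebesgue_measure_set1 mul0e//.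
- by move=> x /= /negP; rewrite negbK => /eqP xc j; rewrite /A; case: eqP => // ->.
Qed.

(** The offset 2 gives [small_time k < k.+2%:R] for every k, 0 included; the flow is later
    integrated over this interval. *)
Definition small_time (k : nat) : R := k.+2%:R^-1.

Lemma small_time_gt0 k : 0 < small_time k.
Proof. by rewrite invr_gt0 ltr0n. Qed.

Lemma small_time_le1 k : small_time k <= 1.
Proof. by rewrite invf_le1 ?ltr0n// ler1n. Qed.

Lemma cvg_small_time : small_time k @[k --> \oo] --> (0 : R).
Proof.
have := @cvg_harmonic R; rewrite -(@cvg_shiftS R (fun k => k.+1%:R^-1 : R)).
exact.
Qed.

Lemma cvg_heat1_itv (c d s : R) : s != c -> s != d ->
  heat1_itv c d (small_time k) s @[k --> \oo] --> (\1_(`]c, d]%classic : set R) s : R).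
Proof.
move=> sc sd; set K := Num.sqrt 2 * (8 / Num.min `|s - c| `|s - d| ^+ 2).
apply/cvgrPdist_le => e e0.
have c0 : K * small_time k @[k --> \oo] --> (0 : R).
  by rewrite -[X in _ --> X](mulr0 K); apply: cvgM; [exact: cvg_cst|exact: cvg_small_time].
have /cvgr0Pnorm_le/(_ e e0) := c0; apply: filterS => k; apply: le_trans.
rewrite distrC; apply: le_trans (heat1_itv_near (small_time_gt0 k) sc sd) _.
by apply: le_trans (ler_norm _); rewrite /K -!mulrA [_^-1 * small_time k]mulrC.
Qed.

Lemma heat_box_cvg h v a b : dominating h -> dominated h v ->
  (\int[mu]_(x in box a b) (heat v (small_time k) x)%:E)%E @[k --> \oo] -->
  (\int[mu]_(x in box a b) (v x)%:E)%E.
Proof.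
move=> dh dv; have [C C0 bC] := box_heat_bound a b.
have mB : measurable (box a b) by exact: measurable_box.
rewrite (_ : (fun k => _) = (fun k => \int[mu]_y (v y * box_heat a b (small_time k) y)%:E)%E); last first.
  apply/funext => k.
  exact: (integral_heat_box a b dh dv (small_time_gt0 k) (small_time_le1 k)).2.
rewrite (_ : (\int[mu]_(x in box a b) _)%E = (\int[mu]_y (v y * \1_(box a b) y)%:E)%E); last first.
  rewrite integral_mkcond; apply: eq_integral => y _; rewrite patchE indicE.
  by case: ifP => _; rewrite ?mulr1 ?mulr0.
apply: (@dominated_gauss_cvg _ _ h v _ _ C 16^-1 0) => //.
- by move=> k; apply: measurable_box_heat; exact: small_time_gt0.
- by move=> k y; apply: bC; [exact: small_time_gt0|exact: small_time_le1].
(* Pointwise convergence is known off the faces of the box only, that is, off finitely many null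
   hyperplanes. *)
- have aea : {ae mu, forall y i, y ord0 i != a i}.
    by apply: filter_forall => i; exact: coord_negligible.
  have aeb : {ae mu, forall y i, y ord0 i != b i}.
    by apply: filter_forall => i; exact: coord_negligible.
  move: aea aeb; apply: filterS2 => y ya yb; rewrite indic_box.
  apply: (@tensor_cvg _ _ (fun k i => heat1_itv (a i) (b i) (small_time k))
    (fun i => \1_(`]a i, b i]%classic : set R))) => j.
  exact: cvg_heat1_itv.
Qed.

End heat_box_rV.

(** * Representation of weak solutions *)

Section heat_bounds.
Context {R : realType} (n : nat).
Local Notation mu := (@lebesgue_rV R n).
Local Notation leb := (@lebesgue_measure R).
Local Notation mR := (measurableTypeR R).
Implicit Types (x y : 'rV[R]_n) (v w h : 'rV[R]_n -> R) (t : R).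

Lemma integrable_heat_kernel t x : 0 < t -> mu.-integrable setT (EFin \o heat_kernel t x).
Proof.
move=> t0; apply/integrableP; split.
  by apply/measurable_EFinP; exact: measurable_heat_kernel_y.
under eq_integral do rewrite /= ger0_norm ?heat_kernel_ge0//.
by rewrite integral_heat_kernel// ltry.
Qed.

Lemma dominating_self h : dominating h -> dominated h h.
Proof.
by move=> [mh h0 _]; split => // y; rewrite ger0_norm// lerDr.
Qed.

Lemma heat_ge0 v t x : (forall y, 0 <= v y) -> 0 <= heat v t x.
Proof. by move=> v0; apply: Rintegral_ge0 => y _; rewrite mulr_ge0 ?heat_kernel_ge0. Qed.

Lemma heat_abs_le h v t x : dominating h -> dominated h v -> 0 < t ->
  `|heat v t x| <= 1 + heat h t x.
Proof.
move=> dh dv t0; have iv := integrable_dominated_heat x dh dv t0.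
have ih := integrable_dominated_heat x dh (dominating_self dh) t0.
have ik := integrable_heat_kernel x t0.
apply: le_trans (le_normr_Rintegral measurableT iv) _.
have -> : 1 + heat h t x = \int[mu]_y (heat_kernel t x y + h y * heat_kernel t x y).
  by rewrite RintegralD//; congr (_ + _); rewrite /Rintegral integral_heat_kernel.
apply: le_Rintegral => //.
- exact: integrable_norm.
- exact: (integrableD measurableT ik ih).
- move=> y _; rewrite normrM (ger0_norm (heat_kernel_ge0 _ _ _)) -{2}[heat_kernel t x y]mul1r -mulrDl.
  by rewrite ler_wpM2r ?heat_kernel_ge0//; exact: dv.2.
Qed.

Lemma heat_le_peak h t x : dominating h -> 0 < t ->
  heat h t x <= heat_peak n t * \int[mu]_y h y.
Proof.
move=> dh t0; have ih := integrable_dominated_heat x dh (dominating_self dh) t0.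
have [mh h0 ihh] := dh.
rewrite -RintegralZl//; apply: le_Rintegral => //; first exact: (integrableZl measurableT _ ihh).
by move=> y _; rewrite mulrC ler_wpM2r// heat_kernel_le.
Qed.

Lemma measurable_heat v : measurable_fun setT v ->
  measurable_fun setT (fun z : mR * 'rV[R]_n => heat v z.1 z.2).
Proof.
move=> mv; apply: (measurableT_comp (@fine_measurable R _ measurableT)).
apply: (@measurable_fubini _ _ (mR * 'rV[R]_n)%type 'rV[R]_n R mu
  (fun z => (v z.2 * heat_kernel z.1.1 z.1.2 z.2)%:E)).
apply/measurable_EFinP; apply: measurable_funM; last exact: measurable_heat_kernel.
exact: (measurableT_comp mv measurable_snd).
Qed.

Lemma measurable_heat_x v t : measurable_fun setT v -> measurable_fun setT (heat v t).
Proof.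
move=> mv; apply: (measurableT_comp (measurable_heat mv)
  (g := fun x : 'rV[R]_n => ((t : mR), x))).
by apply: measurable_fun_pair.
Qed.

Lemma measurable_heat_t v x : measurable_fun setT v ->
  measurable_fun setT (fun t : R => heat v t x).
Proof.
move=> mv; apply: (measurableT_comp (measurable_heat mv)
  (g := fun t : mR => (t, x))).
by apply: measurable_fun_pair.
Qed.

Lemma integral_heat h t : dominating h -> 0 < t ->
  (\int[mu]_x (heat h t x)%:E = \int[mu]_y (h y)%:E)%E.
Proof.
move=> dh t0; have [mh h0 _] := dh.
under eq_integral do rewrite (EFin_heat _ dh (dominating_self dh) t0).
rewrite (@fubini_tonelli _ _ _ _ R mu mu (fun z : 'rV[R]_n * 'rV[R]_n => (h z.2 * heat_kernel t z.1 z.2)%:E)) /=.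
- apply: eq_integral => y _; under eq_integral do rewrite EFinM heat_kernel_sym.
  rewrite ge0_integralZl_EFin//.
  + by rewrite integral_heat_kernel// mule1.
  + by move=> x _; rewrite lee_fin heat_kernel_ge0.
  + by apply/measurable_EFinP; exact: measurable_heat_kernel_y.
- apply/measurable_EFinP; apply: measurable_funM; first exact: (measurableT_comp mh measurable_snd).
  apply: (measurableT_comp (@measurable_heat_kernel R n)
    (g := fun z : 'rV[R]_n * 'rV[R]_n => ((t : mR, z.1), z.2))).
  by apply: measurable_fun_pair => //; apply: measurable_fun_pair.
- by move=> z; rewrite lee_fin mulr_ge0 ?heat_kernel_ge0.
Qed.

End heat_bounds.

(** * Solutions as time integrals of the heat flow *)

Section representation.
Context {R : realType} (n : nat).
Local Notation mu := (@lebesgue_rV R n).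
Local Notation leb := (@lebesgue_measure R).
Local Notation mR := (measurableTypeR R).
Variables (c be : R) (h v1 v2 f1 f2 : 'rV[R]_n -> R).
Hypotheses (c0 : 0 < c) (dh : dominating h).
Hypotheses (dv1 : dominated h v1) (dv2 : dominated h v2).
Hypotheses (df1 : dominated h f1) (df2 : dominated h f2).
Hypothesis heq1 : forall t x, 0 < t ->
  heat_dt v1 t x = - heat f1 t x + c * heat v1 t x + be * heat v2 t x.
Hypothesis heq2 : forall t x, 0 < t ->
  heat_dt v2 t x = - heat f2 t x + c * heat v2 t x - be * heat v1 t x.
Implicit Types (x y : 'rV[R]_n) (t : R).

(** With [expsin], the real and imaginary parts of e^(lambda t) for lambda = -c + i be. The
    hypotheses say that the heat flow V of v1 + i v2 satisfies V' = -F - lambda V, with F the flow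
    of f1 + i f2; hence (e^(lambda t) V)' = -e^(lambda t) F. The real parts of e^(lambda t) V and
    e^(lambda t) F are [flow] and [source]. *)
Definition expcos t : R := expR (- (c * t)) * cos (be * t).
Definition expsin t : R := expR (- (c * t)) * sin (be * t).

Lemma is_derive_expcos t : is_derive t 1 expcos (- c * expcos t - be * expsin t).
Proof.
have d1 : is_derive t 1 (fun t => expR (- (c * t))) (expR (- (c * t)) * - c).
  apply: (@is_derive1_comp _ expR (fun t => - (c * t))).
  have := is_derive_affine (- c) 0 t.
  by rewrite (_ : (fun s : R => _) = (fun s => - (c * s)))//; apply/funext => s; rewrite addr0 mulNr.
have d2 : is_derive t 1 (fun t => cos (be * t)) (- sin (be * t) * be).
  apply: (@is_derive1_comp _ cos (fun t => be * t)).
  have := is_derive_affine be 0 t.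
  by rewrite (_ : (fun s : R => _) = (fun s => be * s))//; apply/funext => s; rewrite addr0.
apply: (is_derive_eq (is_deriveM d1 d2)).
by rewrite /expcos /expsin /GRing.scale /=; ring.
Qed.

Lemma is_derive_expsin t : is_derive t 1 expsin (- c * expsin t + be * expcos t).
Proof.
have d1 : is_derive t 1 (fun t => expR (- (c * t))) (expR (- (c * t)) * - c).
  apply: (@is_derive1_comp _ expR (fun t => - (c * t))).
  have := is_derive_affine (- c) 0 t.
  by rewrite (_ : (fun s : R => _) = (fun s => - (c * s)))//; apply/funext => s; rewrite addr0 mulNr.
have d2 : is_derive t 1 (fun t => sin (be * t)) (cos (be * t) * be).
  apply: (@is_derive1_comp _ sin (fun t => be * t)).
  have := is_derive_affine be 0 t.
  by rewrite (_ : (fun s : R => _) = (fun s => be * s))//; apply/funext => s; rewrite addr0.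
apply: (is_derive_eq (is_deriveM d1 d2)).
by rewrite /expcos /expsin /GRing.scale /=; ring.
Qed.

Lemma expcos_le t : `|expcos t| <= expR (- (c * t)).
Proof. by rewrite normrM ger0_norm ?expR_ge0// ler_piMr ?expR_ge0// cos_max. Qed.

Lemma expsin_le t : `|expsin t| <= expR (- (c * t)).
Proof. by rewrite normrM ger0_norm ?expR_ge0// ler_piMr ?expR_ge0// sin_max. Qed.

Let decay_le1 t : 0 < t -> expR (- (c * t)) <= 1.
Proof. by move=> t0; rewrite -expR0 ler_expR oppr_le0 ltW// mulr_gt0. Qed.

Lemma continuous_expcos : continuous expcos.
Proof.
move=> t; apply/differentiable_continuous/derivable1_diffP.
by have := is_derive_expcos t; case.
Qed.

Lemma continuous_expsin : continuous expsin.
Proof.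
move=> t; apply/differentiable_continuous/derivable1_diffP.
by have := is_derive_expsin t; case.
Qed.

Definition source t x := expcos t * heat f1 t x - expsin t * heat f2 t x.
Definition flow t x := expcos t * heat v1 t x - expsin t * heat v2 t x.

(** The two real time integrals for [v1] with factor [expcos] and [v2] with factor [expsin] are
    subtracted; all terms in [c] and [be] cancel. *)
Lemma integral_source (e T : R) x : 0 < e -> e < T ->
  leb.-integrable `[e, T] (fun t => (source t x)%:E) /\
  (\int[leb]_(t in `[e, T]) (source t x)%:E = (flow e x - flow T x)%:E)%E.
Proof.
move=> e0 eT.
have cb u w : `|u| <= 1 -> `|w| <= 1 -> `|- c * u - be * w| <= c + `|be|.
  move=> u1 w1; apply: le_trans (ler_normB _ _) _; rewrite !normrM normrN (ger0_norm (ltW c0)).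
  by apply: lerD; rewrite ler_piMr// ltW.
have ec t : 0 < t -> `|expcos t| <= 1 by move=> t0; apply: le_trans (expcos_le t) (decay_le1 t0).
have es t : 0 < t -> `|expsin t| <= 1 by move=> t0; apply: le_trans (expsin_le t) (decay_le1 t0).
have ecN t : 0 < t -> `|- expcos t| <= 1 by rewrite normrN; exact: ec.
have ct (p q : R) (f g : R -> R) : continuous f -> continuous g -> continuous (fun t => p * f t + q * g t).
  by move=> cf cg t; apply: cvgD; apply: cvgM; [exact: cvg_cst|exact: cf|exact: cvg_cst|exact: cg].
have dc t : is_derive t 1 expcos (- c * expcos t + - be * expsin t).
  by rewrite [- be * _]mulNr; exact: is_derive_expcos.
have bc t : 0 < t -> `|- c * expcos t + - be * expsin t| <= c + `|be|.
  by move=> t0; rewrite [- be * _]mulNr; apply: cb; [exact: ec|exact: es].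
have bs t : 0 < t -> `|- c * expsin t + be * expcos t| <= c + `|be|.
  by move=> t0; rewrite -[be * _]opprK -mulrN; apply: cb; [exact: es|exact: ecN].
have [i1 I1] := integral_heat_time dc (ct _ _ _ _ continuous_expcos continuous_expsin)
  ec bc x dh dv1 e0 eT.
have [i2 I2] := integral_heat_time is_derive_expsin (ct _ _ _ _ continuous_expsin continuous_expcos)
  es bs x dh dv2 e0 eT.
have E t : t \in `[e, T]%classic -> (source t x)%:E =
    (((- c * expsin t + be * expcos t) * heat v2 t x + expsin t * heat_dt v2 t x)%:E -
    ((- c * expcos t + - be * expsin t) * heat v1 t x + expcos t * heat_dt v1 t x)%:E)%E.
  rewrite inE/= in_itv/= => /andP[et _]; have t0 := lt_le_trans e0 et.
  have E : source t x = (- c * expsin t + be * expcos t) * heat v2 t x + expsin t * heat_dt v2 t x -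
      ((- c * expcos t + - be * expsin t) * heat v1 t x + expcos t * heat_dt v1 t x).
    by rewrite (heq1 x t0) (heq2 x t0) /source; ring.
  by rewrite E.
have mI : measurable (`[e, T]%classic : set mR) by exact: measurable_itv.
have iB := integrableB mI i2 i1.
split.
  have E' : {in (`[e, T]%classic : set mR), _ =1 (fun t => (source t x)%:E)} := fun t te => esym (E t te).
  exact: (eq_integrable mI _ _ E' iB).
transitivity (\int[leb]_(t in `[e, T])
  (((- c * expsin t + be * expcos t) * heat v2 t x + expsin t * heat_dt v2 t x)%:E -
    ((- c * expcos t + - be * expsin t) * heat v1 t x + expcos t * heat_dt v1 t x)%:E))%E.
  by apply: eq_integral => t te; exact: E.
rewrite (integralB mI i2 i1) I1 I2.
have -> : flow e x - flow T x = (expsin T * heat v2 T x - expsin e * heat v2 e x) -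
    (expcos T * heat v1 T x - expcos e * heat v1 e x).
  by rewrite /flow; move: (heat v1) (heat v2) => p1 p2; ring.
by [].
Qed.

Lemma source_le t x : 0 < t -> `|source t x| <= 2 * expR (- (c * t)) * (1 + heat h t x).
Proof.
move=> t0; apply: le_trans (ler_normB _ _) _; rewrite (normrM (expcos t)) (normrM (expsin t)).
have := ler_pM (normr_ge0 _) (normr_ge0 _) (expcos_le t) (heat_abs_le x dh df1 t0).
have := ler_pM (normr_ge0 _) (normr_ge0 _) (expsin_le t) (heat_abs_le x dh df2 t0).
by lra.
Qed.

Lemma flow_le t x : 0 < t -> `|flow t x| <= 2 * expR (- (c * t)) * (1 + heat h t x).
Proof.
move=> t0; apply: le_trans (ler_normB _ _) _; rewrite (normrM (expcos t)) (normrM (expsin t)).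
have := ler_pM (normr_ge0 _) (normr_ge0 _) (expcos_le t) (heat_abs_le x dh dv1 t0).
have := ler_pM (normr_ge0 _) (normr_ge0 _) (expsin_le t) (heat_abs_le x dh dv2 t0).
by lra.
Qed.

Lemma measurable_decay : measurable_fun setT (fun t : R => expR (- (c * t))).
Proof.
apply: continuous_measurable_fun => t; apply: continuous_comp; last exact: continuous_expR.
by apply: (@cvgN _ R^o); apply: cvgM; [exact: cvg_cst|exact: cvg_id].
Qed.

Lemma integral_decay : (\int[leb]_(t in `]0%R, +oo[) (expR (- (c * t)))%:E = (c^-1)%:E)%E.
Proof.
have c00 : c != 0 by exact: lt0r_neq0.
have E := @integral_exponential_pdf R c c0.
rewrite integral_itv_obnd_cbnd; last by apply/measurable_EFinP/measurable_funTS; exact: measurable_decay.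
rewrite integral_mkcond.
transitivity ((c^-1)%:E * \int[leb]_t (exponential_pdf c t)%:E)%E; last by rewrite E mule1.
rewrite -ge0_integralZl_EFin ?invr_ge0 ?(ltW c0)//.
- apply: eq_integral => t _; rewrite /exponential_pdf !patchE; case: ifP => _.
    by rewrite -EFinM mulKf// mulNr.
  by rewrite mule0.
- by move=> t _; rewrite lee_fin exponential_pdf_ge0// ltW.
- by apply/measurable_EFinP; exact: measurable_exponential_pdf.
Qed.

Let resolvent x : \bar R := (\int[leb]_(t in `]0%R, +oo[) (expR (- (c * t)) * heat h t x)%:E)%E.

(** By Tonelli and conservation of mass the integral is at most that of [h] divided by [c]. Hence
    [resolvent] is finite almost everywhere, and at such points the time integrals converge
    absolutely. *)
Lemma integrable_resolvent : mu.-integrable setT resolvent.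
Proof.
have [mh h0 ih] := dh.
pose G (z : 'rV[R]_n * mR) : \bar R := (\1_(`]0, +oo[%classic : set R) z.2 * (expR (- (c * z.2)) * heat h z.2 z.1))%:E.
have mG : measurable_fun setT G.
  apply/measurable_EFinP; apply: measurable_funM.
    apply: (measurableT_comp _ measurable_snd); exact: measurable_indic.
  apply: measurable_funM; first exact: (measurableT_comp measurable_decay measurable_snd).
  apply: (measurableT_comp (measurable_heat mh) (g := fun z : 'rV[R]_n * mR => (z.2, z.1))).
  exact: measurable_fun_pair.
have G0 z : (0 <= G z)%E by rewrite lee_fin !mulr_ge0 ?expR_ge0// heat_ge0.
have RE : resolvent = (fun x => \int[leb]_t G (x, t))%E.
  apply/funext => x; rewrite /resolvent integral_mkcond; apply: eq_integral => t _.
  by rewrite patchE /G indicE; case: ifP => _; rewrite ?mul1r ?mul0r.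
apply/integrableP; split.
  by rewrite RE; exact: measurable_fubini.
rewrite (eq_integral (fun x => \int[leb]_t G (x, t))%E); last first.
  by move=> x _; rewrite RE gee0_abs//; exact: integral_ge0.
rewrite (@fubini_tonelli _ _ _ _ R mu leb G)//.
apply: (@le_lt_trans _ _ (\int[leb]_(t in `]0%R, +oo[) ((expR (- (c * t)))%:E * \int[mu]_y (h y)%:E))%E).
  rewrite [leRHS]integral_mkcond; apply: ge0_le_integral => //.
  - by move=> t _; apply: integral_ge0.
  - exact: (measurable_fun_fubini_tonelli_G _ mG).
  - apply/(measurable_restrict _ _ _).1 => //; apply: emeasurable_funM => //.
    by apply/measurable_EFinP/measurable_funTS; exact: measurable_decay.
  - move=> t _; rewrite patchE /G /= indicE; case: ifPn => tn.
      have t0 : 0 < t by move: tn; rewrite inE/= in_itv/= andbT.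
      rewrite -(integral_heat dh t0).
      rewrite le_eqVlt; apply/orP; left; apply/eqP; rewrite -ge0_integralZl_EFin ?expR_ge0//.
      + by apply: eq_integral => x _; rewrite mul1r EFinM.
      + by move=> x _; rewrite lee_fin heat_ge0.
      + by apply/measurable_EFinP; exact: measurable_heat_x.
    by rewrite integral0_eq// => x _; rewrite mul0r.
rewrite ge0_integralZr//.
- rewrite integral_decay -(fineK (integrable_fin_num measurableT ih)) -EFinM ltry//.
- by apply/measurable_EFinP/measurable_funTS; exact: measurable_decay.
- by apply: integral_ge0 => y _; rewrite lee_fin.
Qed.

Definition source_total x : \bar R := (\int[leb]_(t in `]0%R, +oo[) (source t x)%:E)%E.

Let bound t x := 2 * expR (- (c * t)) * (1 + heat h t x).

Let heat0 t x : 0 <= heat h t x.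
Proof. by apply: heat_ge0; case: dh. Qed.

Let bound_ge0 t x : 0 <= bound t x.
Proof. by rewrite !mulr_ge0 ?expR_ge0// addr_ge0. Qed.

Let measurable_bound x : measurable_fun setT (fun t : R => bound t x).
Proof.
have [mh _ _] := dh.
apply: measurable_funM; first by apply: measurable_funM => //; exact: measurable_decay.
by apply: measurable_funD => //; exact: measurable_heat_t.
Qed.

Let integral_bound x :
  (\int[leb]_(t in `]0%R, +oo[) (bound t x)%:E = (2 / c)%:E + 2%:E * resolvent x)%E.
Proof.
have [mh _ _] := dh.
have m1 : measurable_fun (`]0%R, +oo[%classic : set R) (fun t => (expR (- (c * t)))%:E).
  by apply/measurable_EFinP/measurable_funTS; exact: measurable_decay.
have m2 : measurable_fun (`]0%R, +oo[%classic : set R) (fun t => (expR (- (c * t)) * heat h t x)%:E).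
  apply/measurable_EFinP/measurable_funTS; apply: measurable_funM; first exact: measurable_decay.
  exact: measurable_heat_t.
rewrite EFinM -integral_decay /resolvent.
rewrite -ge0_integralZl_EFin//; try by move=> t _; rewrite lee_fin expR_ge0.
rewrite -ge0_integralZl_EFin//; last by move=> t _; rewrite lee_fin mulr_ge0 ?expR_ge0.
rewrite -ge0_integralD//.
- by apply: eq_integral => t _; rewrite -!EFinM -EFinD /bound; congr EFin; ring.
- by apply: emeasurable_funM.
- by move=> t _; rewrite mule_ge0// lee_fin mulr_ge0// expR_ge0.
- by apply: emeasurable_funM.
Qed.

Let measurable_source x : measurable_fun setT (fun t : R => source t x).
Proof.
apply: measurable_funB; apply: measurable_funM.
- by apply: continuous_measurable_fun; exact: continuous_expcos.
- by apply: measurable_heat_t; case: df1.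
- by apply: continuous_measurable_fun; exact: continuous_expsin.
- by apply: measurable_heat_t; case: df2.
Qed.

Let integrable_bound x : (resolvent x < +oo)%E ->
  leb.-integrable `]0%R, +oo[ (fun t => (bound t x)%:E).
Proof.
move=> rx; apply/integrableP; split.
  by apply/measurable_EFinP/measurable_funTS; exact: measurable_bound.
under eq_integral do rewrite /= ger0_norm ?bound_ge0//.
by rewrite integral_bound lte_add_pinfty ?ltry// lte_mul_pinfty.
Qed.

Let abs_integral_source (D : set mR) x : measurable D -> D `<=` `]0%R, +oo[ ->
  (`|\int[leb]_(t in D) (source t x)%:E| <= (2 / c)%:E + 2%:E * resolvent x)%E.
Proof.
move=> mD D0.
apply: le_trans (le_abse_integral _ mD _) _.
  by apply/measurable_EFinP/measurable_funTS; exact: measurable_source.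
rewrite -integral_bound.
apply: (@le_trans _ _ (\int[leb]_(t in D) (bound t x)%:E)%E).
  apply: ge0_le_integral => //.
  - by apply: measurableT_comp => //; apply/measurable_EFinP/measurable_funTS; exact: measurable_source.
  - by apply/measurable_EFinP/measurable_funTS; exact: measurable_bound.
  - by move=> t /D0/=; rewrite in_itv/= andbT => t0; rewrite lee_fin; exact: source_le.
apply: ge0_subset_integral => //.
  by apply/measurable_EFinP/measurable_funTS; exact: measurable_bound.
by move=> t _; rewrite lee_fin.
Qed.

Lemma abs_source_total x : (`|source_total x| <= (2 / c)%:E + 2%:E * resolvent x)%E.
Proof. exact: abs_integral_source. Qed.

Lemma integrable_source x : (resolvent x < +oo)%E ->
  leb.-integrable `]0%R, +oo[ (fun t => (source t x)%:E).
Proof.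
move=> rx; apply: le_integrable (integrable_bound rx) => //.
  by apply/measurable_EFinP/measurable_funTS; exact: measurable_source.
move=> t /=; rewrite in_itv/= andbT => t0; rewrite lee_fin (ger0_norm (bound_ge0 _ _)).
exact: source_le.
Qed.

(** For T >= 1 the peak of the kernel is at most its value at time 1, so the flow decays like e^(-c
    T) with this constant. *)
Let tail : R := 2 * (1 + heat_peak n 1 * \int[mu]_y h y).

Let flow_large T x : 1 <= T -> `|flow T x| <= tail * expR (- (c * T)).
Proof.
move=> T1; have T0 := lt_le_trans ltr01 T1.
apply: le_trans (flow_le x T0) _; rewrite mulrAC ler_wpM2r ?expR_ge0// /tail ler_pM2l//.
rewrite lerD2l; apply: le_trans (heat_le_peak x dh T0) _.
rewrite ler_wpM2r ?heat_peak_le//.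
by apply: Rintegral_ge0 => y _; case: dh.
Qed.

Let small_large k : @small_time R k < k.+2%:R.
Proof. by apply: le_lt_trans (@small_time_le1 R k) _; rewrite ltr1n. Qed.

Let flow_small k x : (flow (@small_time R k) x)%:E =
  (\int[leb]_(t in `[@small_time R k, k.+2%:R]) (source t x)%:E + (flow k.+2%:R x)%:E)%E.
Proof.
by rewrite (integral_source x (@small_time_gt0 R k) (small_large k)).2 -EFinD subrK.
Qed.

(** A majorant free of [k]: the flow at the small time is the time integral of the source up to k +
    2 plus the flow at that late time. *)
Lemma abs_flow_small k x :
  (`|(flow (@small_time R k) x)%:E| <= (2 / c)%:E + 2%:E * resolvent x + tail%:E)%E.
Proof.
rewrite flow_small; apply: le_trans (lee_abs_add _ _) _; apply: leeD.
  apply: abs_integral_source => // t /=; rewrite !in_itv/= andbT => /andP[+ _].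
  exact: lt_le_trans (@small_time_gt0 R k).
rewrite lee_fin; apply: le_trans (flow_large _ _) _; first by rewrite ler1n.
rewrite ler_piMr ?decay_le1 ?ltr0n//.
rewrite mulr_ge0// addr_ge0// mulr_ge0 ?(ltW (heat_peak_gt0 _ _))//.
by apply: Rintegral_ge0 => y _; case: dh.
Qed.

Lemma flow_cvg x : (resolvent x < +oo)%E ->
  (flow (@small_time R k) x)%:E @[k --> \oo] --> source_total x.
Proof.
move=> rx.
have c1 : (\int[leb]_(t in `[@small_time R k, k.+2%:R]) (source t x)%:E)%E @[k --> \oo] --> source_total x.
  rewrite (_ : (fun k => _) = (fun k => \int[leb]_(t in `]0%R, +oo[)
      ((fun t => (source t x)%:E) \_ `[@small_time R k, k.+2%:R]) t)%E); last first.
    apply/funext => k; rewrite -integral_mkcondr setIidr// => t /=.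
    by rewrite !in_itv/= andbT => /andP[+ _]; exact: lt_le_trans (@small_time_gt0 R k).
  apply: (dominated_cvg _ _ _ _ (integrable_bound rx)) => //.
  - move=> k; apply/(measurable_restrict _ _ _).1 => //.
    by apply/measurable_EFinP/measurable_funTS; exact: measurable_source.
  - move=> t /=; rewrite in_itv/= andbT => t0; apply: cvg_near_cst.
    (* Both 1/(k+2) <= t and t <= k+2 hold as soon as k+2 >= t + 1/t, so [t] eventually lies in the
       interval. *)
    have [N hN] : exists N : nat, t^-1 + t <= N%:R.
      exists (Num.bound (t^-1 + t)).
      by rewrite ltW// archi_boundP// addr_ge0 ?invr_ge0// ltW.
    exists N => // k /= Nk; rewrite patchE mem_set//= in_itv/=.
    have k2 : N%:R <= k.+2%:R :> R by rewrite ler_nat; exact: leq_trans Nk (leq_trans (leqnSn _) (leqnSn _)).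
    have i0 : 0 < t^-1 by rewrite invr_gt0.
    apply/andP; split; last by lra.
    by rewrite /small_time -[leRHS]invrK lef_pV2 ?posrE ?invr_gt0 ?ltr0n//; lra.
  - move=> k t /=; rewrite in_itv/= andbT => t0; rewrite patchE; case: ifP => _.
      by rewrite lee_fin; exact: source_le.
    by rewrite abse0 lee_fin.
have c2 : flow k.+2%:R x @[k --> \oo] --> (0 : R).
  apply/cvgr0Pnorm_le => e e0.
  have c3 : (tail / c) * @small_time R k @[k --> \oo] --> (0 : R).
    rewrite -[X in _ --> X](mulr0 (tail / c)).
    by apply: cvgM; [exact: cvg_cst|exact: cvg_small_time].
  have /cvgr0Pnorm_le/(_ e e0) := c3; apply: filterS => k; apply: le_trans.
  apply: le_trans (flow_large _ _) _; first by rewrite ler1n.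
  apply: le_trans (ler_norm _); rewrite -mulrA ler_wpM2l//.
    rewrite mulr_ge0// addr_ge0// mulr_ge0 ?(ltW (heat_peak_gt0 _ _))//.
    by apply: Rintegral_ge0 => y _; case: dh.
  have ck : 0 < c * k.+2%:R by rewrite mulr_gt0.
  rewrite /small_time -invfM expRN lef_pV2 ?posrE ?expR_gt0//.
  by apply: le_trans (expR_ge1Dx _); rewrite lerDr.
rewrite -[X in _ --> X]adde0.
rewrite (_ : (fun k => _) = (fun k => \int[leb]_(t in `[@small_time R k, k.+2%:R]) (source t x)%:E + (flow k.+2%:R x)%:E)%E); last first.
  by apply/funext => k; exact: flow_small.
apply: cvgeD; [|exact: c1|].
  by rewrite fin_num_adde_defl.
by apply: cvg_EFin; [exact: nearW|exact: c2].
Qed.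

Lemma integrable_box_cst a b (K : R) : mu.-integrable (box a b) (cst K%:E).
Proof.
have mB : measurable (box a b) by exact: measurable_box.
apply/integrableP; split => //.
rewrite (eq_integral (cst `|K|%:E))// integral_cst//.
by rewrite lte_mul_pinfty ?lee_fin// lebesgue_box_fin.
Qed.

Lemma integrable_box_bound a b (K : R) :
  mu.-integrable (box a b) (fun x => (2 / c)%:E + 2%:E * resolvent x + K%:E)%E.
Proof.
have mB : measurable (box a b) by exact: measurable_box.
have iR : mu.-integrable (box a b) resolvent.
  by apply: (integrableS measurableT) => //; exact: integrable_resolvent.
exact: (integrableD mB (integrableD mB (integrable_box_cst a b (2 / c))
  (integrableZl mB 2 iR)) (integrable_box_cst a b K)).
Qed.

Lemma measurable_source_total : measurable_fun setT source_total.
Proof.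
pose G (z : 'rV[R]_n * mR) : \bar R := (\1_(`]0, +oo[%classic : set R) z.2 * source z.2 z.1)%:E.
have mh v : dominated h v -> measurable_fun setT (fun z : 'rV[R]_n * mR => heat v z.2 z.1).
  move=> [mv _].
  apply: (measurableT_comp (measurable_heat mv) (g := fun z : 'rV[R]_n * mR => (z.2, z.1))).
  exact: measurable_fun_pair.
have mG : measurable_fun setT G.
  apply/measurable_EFinP; apply: measurable_funM.
    by apply: (measurableT_comp _ measurable_snd); exact: measurable_indic.
  apply: measurable_funB; apply: measurable_funM; try exact: mh.
    by apply: (measurableT_comp _ measurable_snd); apply: continuous_measurable_fun; exact: continuous_expcos.
  by apply: (measurableT_comp _ measurable_snd); apply: continuous_measurable_fun; exact: continuous_expsin.
rewrite (_ : source_total = (fun x => \int[leb]_t G (x, t))%E).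
  exact: measurable_fubini.
apply/funext => x; rewrite /source_total integral_mkcond; apply: eq_integral => t _.
by rewrite patchE /G indicE; case: ifP => _; rewrite ?mul1r ?mul0r.
Qed.

Lemma measurable_flow t : measurable_fun setT (flow t).
Proof.
by apply: measurable_funB; apply: measurable_funM => //; apply: measurable_heat_x;
  [case: dv1|case: dv2].
Qed.

Let resolvent_ae : {ae mu, forall x, (resolvent x < +oo)%E}.
Proof.
have := integrable_ae measurableT integrable_resolvent.
by apply: filterS => x /(_ Logic.I); rewrite fin_numE => /andP[_ ?]; rewrite ltey.
Qed.

(** The box integrals of the flow at small times have two limits: that of [source_total], by
    dominated convergence, and that of [v1], by [heat_box_cvg], as [expcos] tends to 1 and [expsin]
    to 0. *)
Lemma source_total_box a b :
  (\int[mu]_(x in box a b) source_total x = \int[mu]_(x in box a b) (v1 x)%:E)%E.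
Proof.
have mB : measurable (box a b) by exact: measurable_box.
have c1 : (\int[mu]_(x in box a b) (flow (small_time k) x)%:E)%E @[k --> \oo] -->
    (\int[mu]_(x in box a b) source_total x)%E.
  have [_ _] := @dominated_convergence _ _ _ mu (box a b) mB
    (fun k x => (flow (small_time k) x)%:E) source_total
    (fun x => (2 / c)%:E + 2%:E * resolvent x + tail%:E)%E
    (fun k => (measurable_EFinP _ _).2 (measurable_funTS (measurable_flow _)))
    (measurable_funTS measurable_source_total)
    (filterS (fun x rx _ => flow_cvg rx) resolvent_ae)
    (integrable_box_bound a b tail)
    (aeW _ (fun x k _ => abs_flow_small k x)).
  exact.
pose A v k := \int[mu]_(x in box a b) heat v (@small_time R k) x.
have iA v k : dominated h v -> mu.-integrable (box a b) (EFin \o heat v (small_time k)).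
  move=> dv.
  exact: (integral_heat_box a b dh dv (small_time_gt0 k) (small_time_le1 k)).1.
have iv v : dominated h v -> mu.-integrable (box a b) (EFin \o v).
  move=> [mv vh]; have [_ h0 ih] := dh.
  have i1 : mu.-integrable (box a b) (EFin \o h) by exact: (integrableS measurableT).
  apply: (le_integrable mB _ _ (integrableD mB (integrable_box_cst a b 1) i1)).
    by apply/measurable_EFinP/measurable_funTS.
  move=> x _ /=; rewrite lee_fin; apply: le_trans (vh x) _; exact: ler_norm.
have cA v : dominated h v -> A v k @[k --> \oo] --> \int[mu]_(x in box a b) v x.
  move=> dv; apply: fine_cvg; rewrite /Rintegral fineK; last exact: integrable_fin_num (iv v dv).
  exact: heat_box_cvg dh dv.
have flowE k : (\int[mu]_(x in box a b) (flow (small_time k) x)%:E)%E =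
    (expcos (small_time k) * A v1 k - expsin (small_time k) * A v2 k)%:E.
  have j1 := integrableZl mB (expcos (small_time k)) (iA v1 k dv1).
  have j2 := integrableZl mB (expsin (small_time k)) (iA v2 k dv2).
  transitivity (\int[mu]_(x in box a b) ((expcos (small_time k))%:E * (heat v1 (small_time k) x)%:E
    - (expsin (small_time k))%:E * (heat v2 (small_time k) x)%:E))%E; first by [].
  rewrite (integralB mB j1 j2).
  have -> : (expcos (small_time k) * A v1 k - expsin (small_time k) * A v2 k)%:E =
    ((expcos (small_time k))%:E * (A v1 k)%:E - (expsin (small_time k))%:E * (A v2 k)%:E)%E by [].
  have AE v : dominated h v -> (A v k)%:E = (\int[mu]_(x in box a b) (heat v (small_time k) x)%:E)%E.
    by move=> dv; rewrite /A /Rintegral fineK//; exact: integrable_fin_num (iA v k dv).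
  rewrite (AE v1 dv1) (AE v2 dv2); congr (_ - _)%E.
    exact: (integralZl mB (iA v1 k dv1)).
  exact: (integralZl mB (iA v2 k dv2)).
have ccos : expcos (@small_time R k) @[k --> \oo] --> (1 : R).
  have -> : 1 = expcos 0 by rewrite /expcos !mulr0 oppr0 expR0 cos0 mulr1.
  apply: continuous_cvg; [exact: continuous_expcos|exact: cvg_small_time].
have csin : expsin (@small_time R k) @[k --> \oo] --> (0 : R).
  have -> : 0 = expsin 0 :> R by rewrite /expsin !mulr0 oppr0 expR0 sin0 mulr0.
  apply: continuous_cvg; [exact: continuous_expsin|exact: cvg_small_time].
have c2 : (expcos (small_time k) * A v1 k - expsin (small_time k) * A v2 k) @[k --> \oo] -->
    \int[mu]_(x in box a b) v1 x.
  rewrite -[X in _ --> X]subr0 -[X in X - 0]mul1r -(mul0r (\int[mu]_(x in box a b) v2 x)).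
  by apply: (@cvgB _ R^o); apply: cvgM => //; exact: cA.
have c3 : (\int[mu]_(x in box a b) (flow (small_time k) x)%:E)%E @[k --> \oo] -->
    (\int[mu]_(x in box a b) (v1 x)%:E)%E.
  rewrite -(fineK (integrable_fin_num mB (iv v1 dv1))).
  rewrite (_ : (fun k => _) = (fun k => (expcos (small_time k) * A v1 k - expsin (small_time k) * A v2 k)%:E)); last exact/funext.
  by apply: cvg_EFin; [exact: nearW|exact: c2].
exact: (cvg_unique _ c1 c3).
Qed.

(** The real part of the formula v = (integral over t > 0 of e^(lambda t) e^(t Delta) f dt), that
    is, of v = (-Delta - lambda)^-1 f. *)
Lemma representation : ae_eq mu setT (EFin \o v1) source_total.
Proof.
apply: ae_eq_sym; apply: integral_boxes_ae_eq => [N|N|a b].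
- have mB : measurable (cube N : set 'rV[R]_n) by exact: measurable_box.
  have iB : mu.-integrable (cube N) (fun x => (2 / c)%:E + 2%:E * resolvent x + 0%:E)%E.
    exact: integrable_box_bound.
  apply: (le_integrable mB _ _ iB).
    exact: (measurable_funTS measurable_source_total).
  by move=> x _; rewrite adde0; apply: le_trans (abs_source_total x) _; exact: lee_abs.
- have mB : measurable (cube N : set 'rV[R]_n) by exact: measurable_box.
  have [mv vh] := dv1; have [_ h0 ih] := dh.
  have i1 : mu.-integrable (cube N) (EFin \o h) by exact: (integrableS measurableT).
  apply: (le_integrable mB _ _ (integrableD mB (integrable_box_cst _ _ 1) i1)).
    by apply/measurable_EFinP/measurable_funTS.
  move=> x _ /=; rewrite lee_fin; apply: le_trans (vh x) _; exact: ler_norm.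
- exact: source_total_box.
Qed.

End representation.

(** * Domination by the resolvent *)

Lemma cauchy_schwarz2 {R : realType} (a b c d : R) : a ^+ 2 + b ^+ 2 = 1 ->
  `|a * c + b * d| <= Num.sqrt (c ^+ 2 + d ^+ 2).
Proof.
move=> ab; rewrite -sqrtr_sqr ler_wsqrtr//.
have -> : c ^+ 2 + d ^+ 2 = (a * c + b * d) ^+ 2 + (a * d - b * c) ^+ 2.
  transitivity ((a ^+ 2 + b ^+ 2) * (c ^+ 2 + d ^+ 2)); first by rewrite ab mul1r.
  by ring.
by rewrite lerDl sqr_ge0.
Qed.

Section modulus.
Context {R : realType} {n : nat}.
Local Notation mu := (@lebesgue_rV R n).
Local Notation leb := (@lebesgue_measure R).
Local Notation mR := (measurableTypeR R).
Implicit Types (x y : 'rV[R]_n) (t : R).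

(* For g >= 0 this is (c - Delta)^-1 g. *)
Definition heat_resolvent (c : R) (g : 'rV[R]_n -> R) x : \bar R :=
  (\int[leb]_(t in `]0%R, +oo[) \int[mu]_y (expR (- (c * t)) * heat_kernel t x y * g y)%:E)%E.

Variables (c be : R) (h v1 v2 f1 f2 : 'rV[R]_n -> R).
Hypotheses (c0 : 0 < c) (dh : dominating h).
Hypotheses (dv1 : dominated h v1) (dv2 : dominated h v2).
Hypotheses (df1 : dominated h f1) (df2 : dominated h f2).
Hypothesis heq1 : forall t x, 0 < t ->
  heat_dt v1 t x = - heat f1 t x + c * heat v1 t x + be * heat v2 t x.
Hypothesis heq2 : forall t x, 0 < t ->
  heat_dt v2 t x = - heat f2 t x + c * heat v2 t x - be * heat v1 t x.

Let g y := Num.sqrt (f1 y ^+ 2 + f2 y ^+ 2).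

Let mg : measurable_fun setT g.
Proof.
apply: measurableT_comp => //; first by apply: continuous_measurable_fun; exact: sqrt_continuous.
by apply: measurable_funD; apply: measurable_funX; [case: df1|case: df2].
Qed.

Let mG : measurable_fun setT (fun z : ('rV[R]_n * mR) * 'rV[R]_n =>
  (expR (- (c * z.1.2)) * heat_kernel z.1.2 z.1.1 z.2 * g z.2)%:E).
Proof.
apply/measurable_EFinP; apply: measurable_funM; last exact: (measurableT_comp mg measurable_snd).
apply: measurable_funM.
  apply: measurableT_comp => //; apply: measurableT_comp => //; apply: measurable_funM => //.
  exact: (measurableT_comp measurable_snd measurable_fst).
pose G (z : ('rV[R]_n * mR) * 'rV[R]_n) := ((z.1.2 : mR, z.1.1), z.2).
have mG : measurable_fun setT G.
  apply: measurable_fun_pair => //=; apply: measurable_fun_pair => /=.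
    exact: (measurableT_comp measurable_snd measurable_fst).
  exact: (measurableT_comp measurable_fst measurable_fst).
exact: (measurableT_comp (@measurable_heat_kernel R n) mG).
Qed.

Lemma weighted_heat_le a b t x : a ^+ 2 + b ^+ 2 = 1 -> 0 < t ->
  ((expR (- (c * t)) * (a * heat f1 t x + b * heat f2 t x))%:E <=
   \int[mu]_y (expR (- (c * t)) * heat_kernel t x y * g y)%:E)%E.
Proof.
move=> ab t0.
have i1 := integrable_dominated_heat x dh df1 t0.
have i2 := integrable_dominated_heat x dh df2 t0.
pose e := expR (- (c * t)).
have j1 := integrableZl measurableT (e * a) i1.
have j2 := integrableZl measurableT (e * b) i2.
have -> : (expR (- (c * t)) * (a * heat f1 t x + b * heat f2 t x))%:E =
    ((e * a)%:E * (heat f1 t x)%:E + (e * b)%:E * (heat f2 t x)%:E)%E.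
  by rewrite -/e mulrDr !mulrA.
rewrite (EFin_heat x dh df1 t0) (EFin_heat x dh df2 t0).
rewrite (_ : ((e * a)%:E * _)%E = (\int[mu]_y ((e * a)%:E * (f1 y * heat_kernel t x y)%:E))%E); last first.
  by rewrite (integralZl measurableT i1).
rewrite (_ : ((e * b)%:E * _)%E = (\int[mu]_y ((e * b)%:E * (f2 y * heat_kernel t x y)%:E))%E); last first.
  by rewrite (integralZl measurableT i2).
rewrite -(integralD measurableT j1 j2).
apply: le_trans (lee_abs _) _; apply: le_trans (le_abse_integral _ measurableT _) _.
  exact: (measurable_int mu (integrableD measurableT j1 j2)).
apply: ge0_le_integral => //.
- by apply: measurableT_comp => //; exact: (measurable_int mu (integrableD measurableT j1 j2)).
- have mk : measurable_fun setT (fun y => expR (- (c * t)) * heat_kernel t x y * g y).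
    by apply: measurable_funM mg; apply: measurable_funM => //; exact: measurable_heat_kernel_y.
  by apply/measurable_EFinP; exact: mk.
- move=> y _; rewrite lee_fin.
  have -> : e * a * (f1 y * heat_kernel t x y) + e * b * (f2 y * heat_kernel t x y) =
    e * heat_kernel t x y * (a * f1 y + b * f2 y) by ring.
  rewrite normrM ger0_norm ?mulr_ge0 ?expR_ge0 ?heat_kernel_ge0//.
  by rewrite ler_wpM2l ?mulr_ge0 ?expR_ge0 ?heat_kernel_ge0// cauchy_schwarz2.
Qed.

(** At a point where v is nonzero, |v| = a v1 + b v2 for the unit vector (a, b) along (v1, v2).
    Inserting the representations, the factor e^(i be t) only rotates (a, b), so Cauchy-Schwarz
    bounds the integrand by e^(-c t) k_t |f|. *)
Lemma modulus_le_resolvent :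
  {ae mu, forall x, ((Num.sqrt (v1 x ^+ 2 + v2 x ^+ 2))%:E <= heat_resolvent c g x)%E}.
Proof.
have r1 := representation c0 dh dv1 dv2 df1 df2 heq1 heq2.
have dN v : dominated h v -> dominated h (- v).
  by move=> [mv vh]; split=> [|y]; [exact: measurableT_comp|rewrite normrN].
have hN v t x : dominated h v -> 0 < t -> heat (- v) t x = - heat v t x.
  move=> dv t0; rewrite /heat -[RHS]mulN1r -RintegralZl//; last exact: integrable_dominated_heat dh dv t0.
  by apply: eq_Rintegral => y _; rewrite mulN1r fctE mulNr.
have hdN v t x : dominated h v -> 0 < t -> heat_dt (- v) t x = - heat_dt v t x.
  move=> dv t0; rewrite /heat_dt -[RHS]mulN1r -RintegralZl//; last exact: integrable_dominated_heat_dt dh dv t0.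
  by apply: eq_Rintegral => y _; rewrite mulN1r fctE mulNr.
(* The imaginary part is the real part of -i v: the equations are invariant under (v1, v2) -> (v2,
   -v1) and (f1, f2) -> (f2, -f1). *)
have r2 : ae_eq mu setT (EFin \o v2) (source_total c be f2 (- f1)).
  apply: (representation (h := h) (v2 := - v1)) => //; try exact: dN.
    by move=> t x t0; rewrite heq2// hN// mulrN.
  by move=> t x t0; rewrite hdN// heq1// !hN//; ring.
have ir := integrable_resolvent c0 dh.
have rae := integrable_ae measurableT ir.
move: r1 r2 rae; apply: filterS3 => x /(_ Logic.I) e1 /(_ Logic.I) e2 /(_ Logic.I) rx.
have rx' : (\int[leb]_(t in `]0%R, +oo[) (expR (- (c * t)) * heat h t x)%:E < +oo)%E.
  by rewrite ltey; move: rx; rewrite fin_numE => /andP[].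
have i1 := integrable_source be c0 dh df1 df2 rx'.
have i2 := integrable_source be c0 dh df2 (dN _ df1) rx'.
set m := Num.sqrt _.
have [m0|m0] := eqVneq m 0.
  rewrite m0; apply: integral_ge0 => t _; apply: integral_ge0 => y _.
  by rewrite lee_fin !mulr_ge0 ?expR_ge0 ?heat_kernel_ge0 ?sqrtr_ge0.
have mm : m ^+ 2 = v1 x ^+ 2 + v2 x ^+ 2 by rewrite sqr_sqrtr// addr_ge0 ?sqr_ge0.
pose a := v1 x / m; pose b := v2 x / m.
have ab : a ^+ 2 + b ^+ 2 = 1.
  by rewrite /a /b !exprMn -mulrDl -mm exprVn divff// expf_neq0.
have -> : m%:E = (a%:E * (v1 x)%:E + b%:E * (v2 x)%:E)%E.
  rewrite (_ : (_ + _)%E = (a * v1 x + b * v2 x)%:E)//; congr (_%:E).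
  have -> : a * v1 x + b * v2 x = (v1 x ^+ 2 + v2 x ^+ 2) / m by rewrite /a /b; field.
  by rewrite -mm expr2 mulfK.
have mI : measurable (`]0, +oo[%classic : set mR) by exact: measurable_itv.
have j1 := integrableZl mI a i1.
have j2 := integrableZl mI b i2.
move: e1 e2 => /= -> ->.
rewrite -(integralZl mI i1) -(integralZl mI i2) -(integralD mI j1 j2).
apply: le_trans (lee_abs _) _; apply: le_trans (le_abse_integral _ mI _) _.
  exact: (measurable_int leb (integrableD mI j1 j2)).
apply: ge0_le_integral => //.
- by apply: measurableT_comp => //; exact: (measurable_int leb (integrableD mI j1 j2)).
- apply: measurable_funTS.
  exact: (measurableT_comp (measurable_fubini mu mG) (measurable_fun_pair (measurable_cst x) (@measurable_id _ mR setT))).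
- move=> t /=; rewrite in_itv/= andbT => t0.
  pose C := cos (be * t); pose S := sin (be * t).
  (* The vector (a, b) rotated by the angle be t; it remains a unit vector. *)
  pose ga := a * C + b * S; pose gb := b * C - a * S.
  have gg : ga ^+ 2 + gb ^+ 2 = 1.
    transitivity ((a ^+ 2 + b ^+ 2) * (C ^+ 2 + S ^+ 2)); first by rewrite /ga /gb; ring.
    by rewrite ab cos2Dsin2 mulr1.
  pose z := expR (- (c * t)) * (ga * heat f1 t x + gb * heat f2 t x).
  have zE : a * source c be f1 f2 t x + b * source c be f2 (- f1) t x = z.
    rewrite /source hN//; rewrite /z /ga /gb /C /S /expcos /expsin; ring.
  rewrite zE.
  case: (leP 0 z) => z0; first by rewrite ger0_norm//; exact: weighted_heat_le.
  rewrite ltr0_norm//.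
  have -> : - z = expR (- (c * t)) * ((- ga) * heat f1 t x + (- gb) * heat f2 t x) by rewrite /z; ring.
  by apply: weighted_heat_le => //; rewrite !sqrrN.
Qed.

End modulus.

(** * Complex L_p solutions of the weak resolvent equation *)

Section weak_resolvent.
Context {R : realType} {n : nat}.
Local Notation Rn := 'rV[R]_n.
Local Notation mu := (@lebesgue_rV R n).
Local Notation normc := Normc.normc.
Implicit Types (u v f : Rn -> R[i]).

Lemma normc_sqrtE (z : R[i]) : normc z = Num.sqrt (complex.Re z ^+ 2 + complex.Im z ^+ 2).
Proof. by case: z. Qed.

Lemma normc_ge0 (z : R[i]) : 0 <= normc z.
Proof. by rewrite normc_sqrtE sqrtr_ge0. Qed.

Lemma measurable_normc f : cmeasurable f -> measurable_fun setT (fun x => normc (f x)).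
Proof.
move=> [mre mim].
rewrite (_ : (fun x => _) = (fun x => Num.sqrt (complex.Re (f x) ^+ 2 + complex.Im (f x) ^+ 2))).
  apply: measurableT_comp => //; first by apply: continuous_measurable_fun; exact: sqrt_continuous.
  by apply: measurable_funD; exact: measurable_funX.
by apply/funext => x; rewrite normc_sqrtE.
Qed.

Lemma Re_le_normc (z : R[i]) : `|complex.Re z| <= normc z.
Proof. by rewrite normc_sqrtE -sqrtr_sqr ler_wsqrtr// lerDl sqr_ge0. Qed.

Lemma Im_le_normc (z : R[i]) : `|complex.Im z| <= normc z.
Proof. by rewrite normc_sqrtE -sqrtr_sqr ler_wsqrtr// lerDr sqr_ge0. Qed.

Definition powered p f x : R := normc (f x) `^ p.

Lemma Lp_integrable p f : 0 < p -> Lp p f -> mu.-integrable setT (EFin \o powered p f).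
Proof.
move=> p0 [mf lf]; have mn := measurable_normc mf.
apply/integrableP; split.
  by apply/measurable_EFinP; exact: (measurableT_comp (measurable_powR _) mn).
have := poweR_Lnorm mu (EFin \o (fun x => normc (f x))) (lt0r_neq0 p0).
rewrite (eq_integral (fun x => `|(EFin \o powered p f) x|)%E); last first.
  move=> x _ /=; by rewrite !ger0_norm ?powR_ge0 ?normc_ge0.
move=> <-; apply: poweR_lty; exact: lf.
Qed.

Lemma dominating_powered p f : 0 < p -> Lp p f -> dominating (powered p f).
Proof.
move=> p0 lf; split; last exact: Lp_integrable.
  by apply: (measurableT_comp (measurable_powR _)); apply: measurable_normc; case: lf.
by move=> y; exact: powR_ge0.
Qed.

(** Puts L_p functions into the class [dominated]. *)
Lemma le_1Dpow (p a : R) : 1 <= p -> 0 <= a -> a <= 1 + a `^ p.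
Proof.
move=> p1 a0; case: (leP a 1) => a1; first by apply: le_trans a1 _; rewrite lerDl powR_ge0.
apply: (@le_trans _ _ (a `^ p)); last by rewrite lerDr.
by rewrite -{1}[a]powRr1//; apply: ler_powR => //; exact: ltW.
Qed.

Lemma dominatingD (h k : Rn -> R) : dominating h -> dominating k -> dominating (fun y => h y + k y).
Proof.
move=> [mh h0 ih] [mk k0 ik]; split; first exact: measurable_funD.
  by move=> y; rewrite addr_ge0.
exact: (integrableD measurableT ih ik).
Qed.

Lemma dominating_sum (I : finType) (h : I -> Rn -> R) :
  (forall i, dominating (h i)) -> dominating (fun y => \sum_i h i y).
Proof.
move=> dh; rewrite (_ : (fun y => _) = \sum_i h i); last by apply/funext => y; rewrite fct_sumE.
apply: big_ind => [|f g df dg|i _]; last exact: dh.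
  split => //; first exact: measurable_cst.
  exact: integrable0.
exact: dominatingD.
Qed.

Lemma heat_linear (h f g k : Rn -> R) (a b c t : R) x : dominating h ->
  dominated h f -> dominated h g -> dominated h k -> 0 < t ->
  heat (fun y => a * f y + b * g y + c * k y) t x = a * heat f t x + b * heat g t x + c * heat k t x.
Proof.
move=> dh df dg dk t0.
have i1 := integrable_dominated_heat x dh df t0.
have i2 := integrable_dominated_heat x dh dg t0.
have i3 := integrable_dominated_heat x dh dk t0.
have j1 := integrableZl measurableT a i1.
have j2 := integrableZl measurableT b i2.
have j3 := integrableZl measurableT c i3.
rewrite /heat -(RintegralZl _ measurableT i1) -(RintegralZl _ measurableT i2) -(RintegralZl _ measurableT i3).
rewrite -(RintegralD measurableT j1 j2) -(RintegralD measurableT (integrableD measurableT j1 j2) j3).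
by apply: eq_Rintegral => y _; ring.
Qed.

Lemma Re_sum (I : finType) (z : I -> R[i]) : complex.Re (\sum_i z i) = \sum_i complex.Re (z i).
Proof. by elim/big_rec2: _ => // i x y _ <-; case: (z i) => ? ?; case: y. Qed.

Lemma Im_sum (I : finType) (z : I -> R[i]) : complex.Im (\sum_i z i) = \sum_i complex.Im (z i).
Proof. by elim/big_rec2: _ => // i x y _ <-; case: (z i) => ? ?; case: y. Qed.

Lemma weak_deriv2_Re i v w (phi : Rn -> R) : weak_deriv [:: i; i] v w -> test_function phi ->
  \int[mu]_y (complex.Re (v y) * pderiv [:: i; i] phi y) = \int[mu]_y (complex.Re (w y) * phi y).
Proof.
move=> vw tphi; have := vw _ tphi; rewrite expr2 mulrNN !mul1r => -[+ _].
have ReE (z : R[i]) (r : R) : complex.Re (z * r%:C%C) = complex.Re z * r.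
  by case: z => a b /=; rewrite mulr0 subr0.
move=> e; transitivity (\int[mu]_y complex.Re (v y * (pderiv [:: i; i] phi y)%:C%C)).
  by apply: eq_Rintegral => y _; rewrite ReE.
by rewrite [LHS]e; apply: eq_Rintegral => y _; rewrite ReE.
Qed.

Lemma weak_deriv2_Im i v w (phi : Rn -> R) : weak_deriv [:: i; i] v w -> test_function phi ->
  \int[mu]_y (complex.Im (v y) * pderiv [:: i; i] phi y) = \int[mu]_y (complex.Im (w y) * phi y).
Proof.
move=> vw tphi; have := vw _ tphi; rewrite expr2 mulrNN !mul1r => -[_].
have ImE (z : R[i]) (r : R) : complex.Im (z * r%:C%C) = complex.Im z * r.
  by case: z => a b /=; rewrite mulr0 add0r.
move=> e; transitivity (\int[mu]_y complex.Im (v y * (pderiv [:: i; i] phi y)%:C%C)).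
  by apply: eq_Rintegral => y _; rewrite ImE.
by rewrite [LHS]e; apply: eq_Rintegral => y _; rewrite ImE.
Qed.

Lemma heat_equation (h v : Rn -> R) (w : 'I_n -> Rn -> R) (F : Rn -> R) t x :
  dominating h -> dominated h v -> (forall i, dominated h (w i)) ->
  (forall i phi, test_function phi ->
    \int[mu]_y (v y * pderiv [:: i; i] phi y) = \int[mu]_y (w i y * phi y)) ->
  measurable_fun setT F -> (fun y => \sum_i w i y) = F %[ae mu] -> 0 < t ->
  heat_dt v t x = heat F t x.
Proof.
move=> dh dv dw weak mF wF t0.
have mw : measurable_fun setT (fun y => \sum_i w i y).
  by apply: measurable_sum => i; case: (dw i).
have := weak_heat_sum dh dv dw weak x t0; rewrite -(EFin_heat_dt x dh dv t0) => e.
rewrite /heat /Rintegral.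
have -> : (\int[mu]_y (F y * heat_kernel t x y)%:E)%E = (heat_dt v t x)%:E; last by [].
rewrite e; apply: ae_eq_integral => //.
- by apply/measurable_EFinP; apply: measurable_funM => //; exact: measurable_heat_kernel_y.
- by apply/measurable_EFinP; apply: measurable_funM => //; exact: measurable_heat_kernel_y.
- by apply: filterS wF => y /(_ Logic.I) -> .
Qed.

(** The sum [h] of the p-th powers of |v|, |f| and all |w i| dominates every function involved.
    Pairing with the heat kernel turns the real and imaginary parts of the weak equation into the
    coupled equations in t that [modulus_le_resolvent] assumes. *)
Lemma weak_solution_le p (la : R[i]) v (w : 'I_n -> Rn -> R[i]) f :
  1 <= p -> complex.Re la < 0 -> Lp p v -> (forall i, Lp p (w i)) -> Lp p f ->
  (forall i, weak_deriv [:: i; i] v (w i)) ->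
  f = (fun x => - \sum_i w i x - la * v x) %[ae mu] ->
  {ae mu, forall x, ((normc (v x))%:E <= heat_resolvent (- complex.Re la) (fun y => normc (f y)) x)%E}.
Proof.
move=> p1 la0 lv lw lf vw fE.
have p0 : 0 < p by exact: lt_le_trans p1.
pose h y := powered p v y + powered p f y + \sum_i powered p (w i) y.
have dh : dominating h.
  apply: dominatingD; last by apply: dominating_sum => i; exact: dominating_powered.
  by apply: dominatingD; exact: dominating_powered.
have pw u y : 0 <= powered p u y by exact: powR_ge0.
have vh y : powered p v y <= h y by rewrite /h -addrA lerDl addr_ge0// sumr_ge0.
have fh y : powered p f y <= h y.
  by rewrite /h [powered p v y + _]addrC -addrA lerDl addr_ge0// sumr_ge0.
have wh i y : powered p (w i) y <= h y.
  rewrite /h (bigD1 i)//= [leRHS]addrC -addrA lerDl addr_ge0//; last by rewrite addr_ge0.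
  by rewrite sumr_ge0.
have dRe u : cmeasurable u -> (forall y, powered p u y <= h y) -> dominated h (fun y => complex.Re (u y)).
  move=> [mu1 _] uh; split=> // y; apply: le_trans (Re_le_normc _) _.
  by apply: le_trans (le_1Dpow p1 (normc_ge0 _)) _; rewrite lerD2l; exact: uh.
have dIm u : cmeasurable u -> (forall y, powered p u y <= h y) -> dominated h (fun y => complex.Im (u y)).
  move=> [_ mu1] uh; split=> // y; apply: le_trans (Im_le_normc _) _.
  by apply: le_trans (le_1Dpow p1 (normc_ge0 _)) _; rewrite lerD2l; exact: uh.
pose c := - complex.Re la; pose be := complex.Im la.
have dv1 := dRe v lv.1 vh; have dv2 := dIm v lv.1 vh.
have df1 := dRe f lf.1 fh; have df2 := dIm f lf.1 fh.
have dw1 i := dRe (w i) (lw i).1 (wh i); have dw2 i := dIm (w i) (lw i).1 (wh i).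
have c0 : 0 < c by rewrite oppr_gt0.
have sumE : {ae mu, forall y, \sum_i w i y = - f y - la * v y}.
  by apply: filterS fE => y /(_ Logic.I) ->; rewrite opprD !opprK addrK.
have ReE (a b : R[i]) : complex.Re (- a - la * b) = -1 * complex.Re a + c * complex.Re b + be * complex.Im b.
  by rewrite /c /be; case: (la) a b => [? ?] [? ?] [? ?] /=; ring.
have ImE (a b : R[i]) : complex.Im (- a - la * b) = -1 * complex.Im a + c * complex.Im b + (- be) * complex.Re b.
  by rewrite /c /be; case: (la) a b => [? ?] [? ?] [? ?] /=; ring.
have sum1 : (fun y => \sum_i complex.Re (w i y)) =
    (fun y => -1 * complex.Re (f y) + c * complex.Re (v y) + be * complex.Im (v y)) %[ae mu].
  apply: filterS sumE => y + _; rewrite -Re_sum => ->.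
  by rewrite ReE.
have sum2 : (fun y => \sum_i complex.Im (w i y)) =
    (fun y => -1 * complex.Im (f y) + c * complex.Im (v y) + (- be) * complex.Re (v y)) %[ae mu].
  apply: filterS sumE => y + _; rewrite -Im_sum => ->.
  by rewrite ImE.
have mlin (a b d : R) (u1 u2 u3 : Rn -> R) : dominated h u1 -> dominated h u2 -> dominated h u3 ->
    measurable_fun setT (fun y => a * u1 y + b * u2 y + d * u3 y).
  move=> [m1 _] [m2 _] [m3 _].
  by apply: measurable_funD; [apply: measurable_funD|]; exact: measurable_funM.
have heq1 t x : 0 < t -> heat_dt (fun y => complex.Re (v y)) t x =
    - heat (fun y => complex.Re (f y)) t x + c * heat (fun y => complex.Re (v y)) t x +
      be * heat (fun y => complex.Im (v y)) t x.
  move=> t0; rewrite (heat_equation x dh dv1 dw1 _ (mlin _ _ _ _ _ _ df1 dv1 dv2) sum1 t0).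
    by rewrite (heat_linear _ _ _ x dh df1 dv1 dv2 t0) mulN1r.
  by move=> i phi tphi; exact: weak_deriv2_Re (vw i) tphi.
have heq2 t x : 0 < t -> heat_dt (fun y => complex.Im (v y)) t x =
    - heat (fun y => complex.Im (f y)) t x + c * heat (fun y => complex.Im (v y)) t x -
      be * heat (fun y => complex.Re (v y)) t x.
  move=> t0; rewrite (heat_equation x dh dv2 dw2 _ (mlin _ _ _ _ _ _ df2 dv2 dv1) sum2 t0).
    by rewrite (heat_linear _ _ _ x dh df2 dv2 dv1 t0) mulN1r (mulNr be).
  by move=> i phi tphi; exact: weak_deriv2_Im (vw i) tphi.
have := modulus_le_resolvent c0 dh dv1 dv2 df1 df2 heq1 heq2.
apply: filterS => x; rewrite normc_sqrtE => /le_trans; apply.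
rewrite (_ : (fun y => normc (f y)) = (fun y => Num.sqrt (complex.Re (f y) ^+ 2 + complex.Im (f y) ^+ 2)))//.
by apply/funext => y; rewrite normc_sqrtE.
Qed.

End weak_resolvent.

(** * Hoelder's inequality *)

Section amgm.
Context {R : realType}.
Implicit Types (a x : R).

Lemma powR_le_exp a x : 0 <= a -> 0 <= x -> x `^ a <= expR (a * (x - 1)).
Proof.
move=> a0 x0; rewrite mulrC expRM; apply: ge0_ler_powR; rewrite ?nnegrE ?expR_ge0//.
by rewrite -[leLHS](subrK 1) addrC; exact: expR_ge1Dx.
Qed.

Lemma powR_scale s a x : 0 < s -> 0 <= x -> x `^ a = s `^ a * (x / s) `^ a.
Proof.
move=> s0 x0; have s0' := ltW s0.
by rewrite -powRM ?divr_ge0// mulrC divfK// lt0r_neq0.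
Qed.

(* After dividing by the right-hand side, multiply the bounds x^a <= exp (a (x - 1)). *)
Lemma amgm4 a0 a1 a2 a3 x0 x1 x2 x3 : 0 <= a0 -> 0 <= a1 -> 0 <= a2 -> 0 <= a3 ->
  a0 + a1 + a2 + a3 = 1 -> 0 <= x0 -> 0 <= x1 -> 0 <= x2 -> 0 <= x3 ->
  x0 `^ a0 * x1 `^ a1 * x2 `^ a2 * x3 `^ a3 <= a0 * x0 + a1 * x1 + a2 * x2 + a3 * x3.
Proof.
move=> a0_ a1_ a2_ a3_ a01 x0_ x1_ x2_ x3_.
set s := leRHS; have s0 : 0 <= s by rewrite !addr_ge0// mulr_ge0.
(* If the right-hand side vanishes, some exponent is nonzero and the corresponding x is 0, so the
   product vanishes as well. *)
have [sz|sz] := eqVneq s 0.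
  have zero a x : a * x = 0 -> a != 0 -> x `^ a = 0.
    by move=> /eqP; rewrite mulf_eq0 => /orP[/eqP->|/eqP-> a_]; rewrite ?eqxx ?powR0.
  have [m0 [m1 [m2 m3]]] : a0 * x0 = 0 /\ a1 * x1 = 0 /\ a2 * x2 = 0 /\ a3 * x3 = 0.
    have := mulr_ge0 a0_ x0_; have := mulr_ge0 a1_ x1_.
    have := mulr_ge0 a2_ x2_; have := mulr_ge0 a3_ x3_.
    by move: sz; rewrite /s => sz *; repeat split; lra.
  rewrite sz; have [e0|e0] := eqVneq a0 0; last by rewrite (zero _ _ m0 e0) !mul0r.
  have [e1|e1] := eqVneq a1 0; last by rewrite (zero _ _ m1 e1) mulr0 !mul0r.
  have [e2|e2] := eqVneq a2 0; last by rewrite (zero _ _ m2 e2) mulr0 !mul0r.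
  rewrite (zero _ _ m3) ?mulr0//; move: a01; rewrite e0 e1 e2 !add0r => ->.
  exact: oner_neq0.
have sp : 0 < s by rewrite lt_neqAle eq_sym sz.
rewrite (powR_scale a0 sp x0_) (powR_scale a1 sp x1_) (powR_scale a2 sp x2_) (powR_scale a3 sp x3_).
have sE : s = s `^ a0 * s `^ a1 * s `^ a2 * s `^ a3.
  by rewrite -!powRD ?sz ?implybT// a01 powRr1.
rewrite [leRHS]sE.
set y0 := (x0 / s) `^ a0; set y1 := (x1 / s) `^ a1; set y2 := (x2 / s) `^ a2; set y3 := (x3 / s) `^ a3.
have -> : s `^ a0 * y0 * (s `^ a1 * y1) * (s `^ a2 * y2) * (s `^ a3 * y3) =
  (s `^ a0 * s `^ a1 * s `^ a2 * s `^ a3) * (y0 * y1 * y2 * y3) by ring.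
rewrite -[leRHS]mulr1 -sE ler_wpM2l//.
have d x : 0 <= x -> 0 <= x / s by move=> ?; rewrite divr_ge0.
have -> : 1 = expR (a0 * (x0 / s - 1)) * expR (a1 * (x1 / s - 1)) * expR (a2 * (x2 / s - 1)) *
    expR (a3 * (x3 / s - 1)).
  rewrite -!expRD -[LHS]expR0; congr expR.
  have -> : a0 * (x0 / s - 1) + a1 * (x1 / s - 1) + a2 * (x2 / s - 1) + a3 * (x3 / s - 1) =
    (a0 * x0 + a1 * x1 + a2 * x2 + a3 * x3) / s - (a0 + a1 + a2 + a3) by ring.
  by rewrite -/s divff// a01 subrr.
by rewrite !ler_pM ?mulr_ge0 ?powR_ge0 ?powR_le_exp ?d.
Qed.

(** Integrated with scales [y0], ..., [y3] bounding the integrals of the four functions, the last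
    factor is at most a0 + a1 + a2 + a3 = 1: this is Hoelder's inequality. *)
Lemma amgm4_weighted a0 a1 a2 a3 x0 x1 x2 x3 y0 y1 y2 y3 :
  0 <= a0 -> 0 <= a1 -> 0 <= a2 -> 0 <= a3 -> a0 + a1 + a2 + a3 = 1 ->
  0 <= x0 -> 0 <= x1 -> 0 <= x2 -> 0 <= x3 -> 0 < y0 -> 0 < y1 -> 0 < y2 -> 0 < y3 ->
  x0 `^ a0 * x1 `^ a1 * x2 `^ a2 * x3 `^ a3 <=
  y0 `^ a0 * y1 `^ a1 * y2 `^ a2 * y3 `^ a3 *
  (a0 / y0 * x0 + a1 / y1 * x1 + a2 / y2 * x2 + a3 / y3 * x3).
Proof.
move=> a0_ a1_ a2_ a3_ a01 x0_ x1_ x2_ x3_ y0_ y1_ y2_ y3_.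
rewrite (powR_scale a0 y0_ x0_) (powR_scale a1 y1_ x1_) (powR_scale a2 y2_ x2_) (powR_scale a3 y3_ x3_).
set z0 := (x0 / y0) `^ a0; set z1 := (x1 / y1) `^ a1; set z2 := (x2 / y2) `^ a2; set z3 := (x3 / y3) `^ a3.
have -> : y0 `^ a0 * z0 * (y1 `^ a1 * z1) * (y2 `^ a2 * z2) * (y3 `^ a3 * z3) =
  (y0 `^ a0 * y1 `^ a1 * y2 `^ a2 * y3 `^ a3) * (z0 * z1 * z2 * z3) by ring.
rewrite ler_wpM2l ?mulr_ge0 ?powR_ge0//.
have -> : a0 / y0 * x0 + a1 / y1 * x1 + a2 / y2 * x2 + a3 / y3 * x3 =
  a0 * (x0 / y0) + a1 * (x1 / y1) + a2 * (x2 / y2) + a3 * (x3 / y3) by ring.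
by apply: amgm4 => //; rewrite divr_ge0// ltW.
Qed.

(** Distributes the powers over four integrable factors: [om] enters all of them with total exponent
    1, the kernel the first two, [h] the second and fourth with p (a1 + a3) = 1, and [a] the third
    with th a2 = 1. *)
Lemma holder_split (a0 a1 a2 a3 th p om ka a h : R) :
  0 <= a0 -> 0 <= a1 -> 0 <= a2 -> 0 <= a3 -> a0 + a1 + a2 + a3 = 1 -> a0 + a1 != 0 ->
  th * a2 = 1 -> p * (a1 + a3) = 1 -> 0 <= om -> 0 <= ka -> 0 <= a -> 0 <= h ->
  om * ka `^ (a0 + a1) * a * h =
  (om * ka) `^ a0 * (om * ka * h `^ p) `^ a1 * (om * a `^ th) `^ a2 * (om * h `^ p) `^ a3.
Proof.
move=> a0_ a1_ a2_ a3_ a01 s0 tha pa om0 ka0 a_0 h0.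
rewrite !powRM ?mulr_ge0 ?powR_ge0// -!powRrM tha (powRr1 a_0).
have hE : h = h `^ (p * a1) * h `^ (p * a3).
  by rewrite -powRD -?mulrDr pa ?oner_eq0// powRr1.
have omE : om = om `^ a0 * om `^ a1 * om `^ a2 * om `^ a3.
  have [->|om_] := eqVneq om 0; last by rewrite -!powRD ?om_ ?implybT// a01 powRr1.
  have [e0|e0] := eqVneq a0 0; last by rewrite (powR0 e0) !mul0r.
  have [e1|e1] := eqVneq a1 0; last by rewrite (powR0 e1) mulr0 !mul0r.
  by move: s0; rewrite e0 e1 addr0 eqxx.
have kaE : ka `^ (a0 + a1) = ka `^ a0 * ka `^ a1 by rewrite powRD// (negbTE s0).
by rewrite {1}omE kaE {1}hE; ring.
Qed.

End amgm.

(** * Iterated integrals over time and space *)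

Section iterated_integral.
Context {dT dX : measure_display} {T : measurableType dT} {X : measurableType dX} {R : realType}.
Variables (m : {sigma_finite_measure set T -> \bar R}) (mu : {sigma_finite_measure set X -> \bar R}).
Implicit Types F G : T * X -> R.

Definition iterated F : \bar R := (\int[m]_t \int[mu]_y (F (t, y))%:E)%E.

Let mslice F t : measurable_fun setT F -> measurable_fun setT (fun y => (F (t, y))%:E).
Proof.
move=> mF; apply/measurable_EFinP.
exact: (measurableT_comp mF (measurable_fun_pair (measurable_cst t) (@measurable_id _ X setT))).
Qed.

Let mint F : measurable_fun setT F -> measurable_fun setT (fun t => \int[mu]_y (F (t, y))%:E)%E.
Proof.
move=> mF; have mE : measurable_fun setT (EFin \o F) by exact/measurable_EFinP.
exact: (measurable_fubini mu mE).
Qed.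

Lemma iterated_ge0 F : (forall z, 0 <= F z) -> (0 <= iterated F)%E.
Proof. by move=> F0; apply: integral_ge0 => t _; apply: integral_ge0 => y _; rewrite lee_fin. Qed.

Lemma le_iterated F G : measurable_fun setT F -> measurable_fun setT G ->
  (forall z, 0 <= F z) -> (forall z, F z <= G z) -> (iterated F <= iterated G)%E.
Proof.
move=> mF mG F0 FG; have G0 z : 0 <= G z := le_trans (F0 z) (FG z).
apply: ge0_le_integral => //.
- by move=> t _; apply: integral_ge0 => y _; rewrite lee_fin.
- exact: mint.
- exact: mint.
move=> t _; apply: ge0_le_integral => //.
- by move=> y _; rewrite lee_fin.
- exact: mslice.
- exact: mslice.
- by move=> y _; rewrite lee_fin.
Qed.

Lemma iteratedD F G : measurable_fun setT F -> measurable_fun setT G ->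
  (forall z, 0 <= F z) -> (forall z, 0 <= G z) ->
  iterated (fun z => F z + G z) = (iterated F + iterated G)%E.
Proof.
move=> mF mG F0 G0; rewrite /iterated -ge0_integralD//; first last.
- exact: mint.
- by move=> t _; apply: integral_ge0 => y _; rewrite lee_fin.
- exact: mint.
- by move=> t _; apply: integral_ge0 => y _; rewrite lee_fin.
apply: eq_integral => t _; rewrite -ge0_integralD//.
- by move=> y _; rewrite lee_fin.
- exact: mslice.
- by move=> y _; rewrite lee_fin.
- exact: mslice.
Qed.

Lemma iteratedZ k F : measurable_fun setT F -> (forall z, 0 <= F z) -> 0 <= k ->
  iterated (fun z => k * F z) = (k%:E * iterated F)%E.
Proof.
move=> mF F0 k0; rewrite /iterated -ge0_integralZl_EFin//; first last.
- exact: mint.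
- by move=> t _; apply: integral_ge0 => y _; rewrite lee_fin.
apply: eq_integral => t _; rewrite -ge0_integralZl_EFin//.
- by move=> y _; rewrite lee_fin.
- exact: mslice.
Qed.

Lemma iterated_prod (f : T -> R) (g : X -> R) : measurable_fun setT f -> measurable_fun setT g ->
  (forall t, 0 <= f t) -> (forall y, 0 <= g y) ->
  iterated (fun z => f z.1 * g z.2) = (\int[m]_t (f t)%:E * \int[mu]_y (g y)%:E)%E.
Proof.
move=> mf mg f0 g0; have I0 : (0 <= \int[mu]_y (g y)%:E)%E.
  by apply: integral_ge0 => y _; rewrite lee_fin.
rewrite muleC -ge0_integralZl//; last 2 first.
- exact/measurable_EFinP.
- by move=> t _; rewrite lee_fin.
apply: eq_integral => t _; rewrite muleC -ge0_integralZl_EFin//.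
- by move=> y _; rewrite lee_fin.
- exact/measurable_EFinP.
Qed.

Lemma measurable_iterated (F : X -> T * X -> R) :
  measurable_fun setT (fun z : (X * T) * X => F z.1.1 (z.1.2, z.2)) ->
  measurable_fun setT (fun x => iterated (F x)).
Proof.
move=> mF; have mE : measurable_fun setT (EFin \o (fun z : (X * T) * X => F z.1.1 (z.1.2, z.2))).
  exact/measurable_EFinP.
exact: (measurable_fubini m (measurable_fubini mu mE)).
Qed.

End iterated_integral.

(** Collects the powers left by two applications of Hoelder's inequality; S occurs with total
    exponent (a0 + a1 + a2 + a3) p1 = p1. *)
Lemma schur_constE {R : realType} (S A B P a0 a1 a2 a3 be p1 : R) :
  0 < S -> 0 < A -> 0 < B -> 0 < P -> a0 + a1 + a2 + a3 = 1 ->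
  (S `^ a0 * (S * A) `^ a2 * (S * P) `^ a3) `^ p1 * B `^ (p1 * be) * (S * P) `^ (p1 * a1) =
  (S * A `^ a2 * B `^ be * P `^ (a1 + a3)) `^ p1.
Proof.
move=> S0 A0 B0 P0 a01.
have E x y : x `^ (p1 * y) = (x `^ y) `^ p1 by rewrite mulrC powRrM.
have pos x y : 0 <= x `^ y :> R by exact: powR_ge0.
rewrite (E B) (E (S * P)) (powRM _ (ltW S0) (ltW A0)) !(powRM _ (ltW S0) (ltW P0)).
have SE : S = S `^ a0 * S `^ a1 * S `^ a2 * S `^ a3.
  by rewrite -!powRD ?(lt0r_neq0 S0) ?implybT// a01 powRr1// ltW.
have PE : P `^ (a1 + a3) = P `^ a1 * P `^ a3 by rewrite powRD// (lt0r_neq0 P0) implybT.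
rewrite PE [X in _ = (X * _ * _ * _) `^ _]SE.
set s0 := S `^ a0; set s1 := S `^ a1; set s2 := S `^ a2; set s3 := S `^ a3.
have [p0 p1_ p2 p3] : [/\ 0 <= s0, 0 <= s1, 0 <= s2 & 0 <= s3] by split; exact: pos.
rewrite -(powRM p1 _ (pos B be)); last by rewrite !mulr_ge0.
rewrite -(powRM p1); [|by rewrite !mulr_ge0|by rewrite !mulr_ge0].
by congr (_ `^ _); ring.
Qed.

(** * A Schur test for kernels with weights on both sides *)

Section schur.
Context {dT dX : measure_display} {T : measurableType dT} {X : measurableType dX} {R : realType}.
Variables (m : {sigma_finite_measure set T -> \bar R}) (mu : {sigma_finite_measure set X -> \bar R}).
Variables (om : T -> R) (ka : X -> T * X -> R) (eta : X -> R) (S : R).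
Hypotheses (mom : measurable_fun setT om) (om0 : forall t, 0 <= om t).
Hypotheses (S0 : 0 < S) (int_om : (\int[m]_t (om t)%:E = S%:E)%E).
Hypotheses (mka : measurable_fun setT (fun z : (X * T) * X => ka z.1.1 (z.1.2, z.2))).
Hypotheses (ka0 : forall x z, 0 <= ka x z).
Hypothesis int_kar : forall t x, (\int[mu]_y (om t * ka x (t, y))%:E = (om t)%:E)%E.
Hypothesis int_kal : forall t y, (\int[mu]_x (om t * ka x (t, y))%:E = (om t)%:E)%E.
Hypotheses (meta : measurable_fun setT eta) (eta0 : forall x, 0 < eta x).
Hypothesis int_eta : (\int[mu]_x (eta x)%:E = 1)%E.
Variables (a0 a1 a2 a3 th p r p1 be : R).
Hypotheses (a0_ge0 : 0 <= a0) (a1_ge0 : 0 <= a1) (a2_ge0 : 0 <= a2) (a3_ge0 : 0 <= a3).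
Hypotheses (sum_a : a0 + a1 + a2 + a3 = 1) (a01_neq0 : a0 + a1 != 0).
Hypotheses (th_a2 : th * a2 = 1) (p_a13 : p * (a1 + a3) = 1).
Hypotheses (p1_ge0 : 0 < p1) (be_ge0 : 0 <= be) (r_be : r * be = 1) (p1_a1 : p1 * (a1 + be) = 1).
Variables (h a b : X -> R) (A B P : R).
Hypotheses (mh : measurable_fun setT h) (ma : measurable_fun setT a) (mb : measurable_fun setT b).
Hypotheses (h0 : forall x, 0 <= h x) (a_0 : forall x, 0 <= a x) (b0 : forall x, 0 <= b x).
Hypotheses (A0 : 0 < A) (B0 : 0 < B).
Hypotheses (int_a : (\int[mu]_x (a x `^ th)%:E <= A%:E)%E).
Hypotheses (int_b : (\int[mu]_x (b x `^ r)%:E <= B%:E)%E).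
Hypotheses (int_h : (\int[mu]_x (h x `^ p)%:E < P%:E)%E).

Let mslice x : measurable_fun setT (ka x).
Proof.
pose g (z : T * X) := ((x, z.1), z.2).
have mg : measurable_fun setT g.
  apply: measurable_fun_pair => //; apply: measurable_fun_pair => //.
rewrite (_ : ka x = (fun z => ka z.1.1 (z.1.2, z.2)) \o g); first exact: (measurableT_comp mka mg).
by apply/funext => -[].
Qed.

Let mpow (f : X -> R) e : measurable_fun setT f -> measurable_fun setT (fun x => f x `^ e).
Proof. by move=> mf; exact: (measurableT_comp (measurable_powR _) mf). Qed.

(** In the application [ka] is a heat kernel and its power, times [om], is the kernel of the
    resolvent. The mass conditions on [ka] carry the factor [om t] because a heat kernel has mass
    one only for t > 0, outside of which [om] is 0. *)
Definition schur_op x : \bar R :=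
  iterated m mu (fun z => om z.1 * ka x z `^ (a0 + a1) * a z.2 * h z.2).

Let J1 x : \bar R := iterated m mu (fun z => om z.1 * ka x z * h z.2 `^ p).

Let J1_ge0 x : (0 <= J1 x)%E.
Proof. by apply: iterated_ge0 => z; rewrite !mulr_ge0// powR_ge0. Qed.

Let mF : measurable_fun setT (fun z : (X * T) * X => om z.1.2 * ka z.1.1 (z.1.2, z.2) * h z.2 `^ p).
Proof.
apply: measurable_funM; last exact: (measurableT_comp (mpow p mh) measurable_snd).
apply: measurable_funM => //.
exact: (measurableT_comp mom (measurableT_comp measurable_snd measurable_fst)).
Qed.

Let mJ1 : measurable_fun setT J1.
Proof. exact: (measurable_iterated m mu (F := fun x z => om z.1 * ka x z * h z.2 `^ p) mF). Qed.

(** [J1] is the only Hoelder factor whose integral over (t, y) varies with x; its integral in x is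
    computed by Tonelli from the mass of the kernel in its first variable. *)
Lemma integral_J1 : (\int[mu]_x J1 x = S%:E * \int[mu]_x (h x `^ p)%:E)%E.
Proof.
have mE : measurable_fun setT (EFin \o (fun z : (X * T) * X => om z.1.2 * ka z.1.1 (z.1.2, z.2) * h z.2 `^ p)).
  exact/measurable_EFinP.
have F0 z : 0 <= om z.1.2 * ka z.1.1 (z.1.2, z.2) * h z.2 `^ p by rewrite !mulr_ge0// powR_ge0.
rewrite -int_om -(iterated_prod m mu mom (mpow p mh) om0 (fun y => powR_ge0 _ _)).
rewrite /J1 /iterated.
rewrite (@fubini_tonelli _ _ _ _ _ mu m (fun xt => \int[mu]_y (om xt.2 * ka xt.1 (xt.2, y) * h y `^ p)%:E)%E); first last.
- by move=> z; apply: integral_ge0 => y _; rewrite lee_fin (F0 (z, y)).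
- exact: (measurable_fubini mu mE).
apply: eq_integral => t _ /=.
rewrite (@fubini_tonelli _ _ _ _ _ mu mu (fun xy => (om t * ka xy.1 (t, xy.2) * h xy.2 `^ p)%:E)%E); first last.
- by move=> z; rewrite lee_fin (F0 ((z.1, t), z.2)).
- pose g (z : X * X) := ((z.1, t), z.2).
  have mg : measurable_fun setT g.
    by apply: measurable_fun_pair => //; exact: measurable_fun_pair.
  exact: (measurableT_comp mE mg).
apply: eq_integral => y _ /=.
transitivity (\int[mu]_x ((h y `^ p)%:E * (om t * ka x (t, y))%:E))%E.
  by apply: eq_integral => x _; rewrite -EFinM mulrC.
rewrite ge0_integralZl_EFin ?powR_ge0//.
- by rewrite int_kal -EFinM mulrC.
- by move=> x _; rewrite lee_fin mulr_ge0.
- apply/measurable_EFinP; apply: measurable_funM => //.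
  pose g (x : X) := ((x, t), y).
  have mg : measurable_fun setT g.
    by apply: measurable_fun_pair => //; exact: measurable_fun_pair.
  exact: (measurableT_comp mka mg).
Qed.

Let int_h_fin : (\int[mu]_x (h x `^ p)%:E)%E \is a fin_num.
Proof.
rewrite ge0_fin_numE; first exact: lt_trans int_h (ltry _).
by apply: integral_ge0 => x _; rewrite lee_fin powR_ge0.
Qed.

Let Hp := fine (\int[mu]_x (h x `^ p)%:E)%E.

Let HpE : (\int[mu]_x (h x `^ p)%:E)%E = Hp%:E.
Proof. by rewrite /Hp fineK. Qed.

Let Hp_lt : Hp < P.
Proof. by rewrite -lte_fin -HpE. Qed.

Let Hp_ge0 : 0 <= Hp.
Proof. by apply: fine_ge0; apply: integral_ge0 => x _; rewrite lee_fin powR_ge0. Qed.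

Let P0 : 0 < P. Proof. exact: le_lt_trans Hp_lt. Qed.

(** The scale for [J1 x] must be positive, but [J1 x] may be 0. The slack in the strict bound of the
    integral of h^p by [P] is spread along the positive density [eta], so that J1 + [fill] is
    positive everywhere and has integral exactly S P. *)
Let fill x := S * (P - Hp) * eta x.

Let fill_gt0 x : 0 < fill x.
Proof. by rewrite !mulr_gt0// subr_gt0. Qed.

Let C := S `^ a0 * (S * A) `^ a2 * (S * P) `^ a3.

Let ratio_le (e y : R) (J : \bar R) : 0 <= e -> 0 < y -> (0 <= J)%E -> (J <= y%:E)%E ->
  ((e / y)%:E * J <= e%:E)%E.
Proof.
move=> e0 y0 J0 Jy; apply: le_trans (lee_wpmul2l _ Jy) _.
  by rewrite lee_fin divr_ge0// ltW.
by rewrite -EFinM lee_fin divfK// lt0r_neq0.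
Qed.

(** Hoelder in (t, y) for fixed x, with scales S, J1 x + fill x, S A and S P: each of the four
    integrated terms is at most its exponent. *)
Lemma schur_op_le x : (J1 x < +oo)%E -> (schur_op x <= (C * (fine (J1 x) + fill x) `^ a1)%:E)%E.
Proof.
move=> Jx; set y1 := fine _ + _.
have y1_gt0 : 0 < y1 by rewrite ltr_wpDl// fine_ge0.
have SA : 0 < S * A by rewrite mulr_gt0.
have SP : 0 < S * P by rewrite mulr_gt0.
have f1 : measurable_fun setT (fun z : T * X => om z.1) by exact: (measurableT_comp mom measurable_fst).
have f2 : measurable_fun setT (fun z : T * X => h z.2) by exact: (measurableT_comp mh measurable_snd).
have f3 : measurable_fun setT (fun z : T * X => a z.2) by exact: (measurableT_comp ma measurable_snd).
pose phi0 (z : T * X) := om z.1 * ka x z.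
pose phi1 (z : T * X) := om z.1 * ka x z * h z.2 `^ p.
pose phi2 (z : T * X) := om z.1 * a z.2 `^ th.
pose phi3 (z : T * X) := om z.1 * h z.2 `^ p.
have m0 : measurable_fun setT phi0 by exact: measurable_funM.
have m1 : measurable_fun setT phi1.
  by apply: measurable_funM => //; exact: (measurableT_comp (mpow p mh) measurable_snd).
have m2 : measurable_fun setT phi2.
  by apply: measurable_funM => //; exact: (measurableT_comp (mpow th ma) measurable_snd).
have m3 : measurable_fun setT phi3.
  by apply: measurable_funM => //; exact: (measurableT_comp (mpow p mh) measurable_snd).
have p0_ z : 0 <= phi0 z by rewrite mulr_ge0.
have p1_ z : 0 <= phi1 z by rewrite !mulr_ge0 ?powR_ge0.
have p2_ z : 0 <= phi2 z by rewrite mulr_ge0 ?powR_ge0.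
have p3_ z : 0 <= phi3 z by rewrite mulr_ge0 ?powR_ge0.
pose D := S `^ a0 * y1 `^ a1 * (S * A) `^ a2 * (S * P) `^ a3.
have D0 : 0 <= D by rewrite !mulr_ge0 ?powR_ge0.
have e0 : 0 <= a0 / S by rewrite divr_ge0// ltW.
have e1 : 0 <= a1 / y1 by rewrite divr_ge0// ltW.
have e2 : 0 <= a2 / (S * A) by rewrite divr_ge0// ltW.
have e3 : 0 <= a3 / (S * P) by rewrite divr_ge0// ltW.
have -> : C * y1 `^ a1 = D by rewrite /C /D; ring.
pose c0 z := a0 / S * phi0 z; pose c1 z := a1 / y1 * phi1 z.
pose c2 z := a2 / (S * A) * phi2 z; pose c3 z := a3 / (S * P) * phi3 z.
have mc0 : measurable_fun setT c0 by exact: measurable_funM.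
have mc1 : measurable_fun setT c1 by exact: measurable_funM.
have mc2 : measurable_fun setT c2 by exact: measurable_funM.
have mc3 : measurable_fun setT c3 by exact: measurable_funM.
have c0_ z : 0 <= c0 z by rewrite mulr_ge0.
have c1_ z : 0 <= c1 z by rewrite mulr_ge0.
have c2_ z : 0 <= c2 z by rewrite mulr_ge0.
have c3_ z : 0 <= c3 z by rewrite mulr_ge0.
have mc01 : measurable_fun setT (fun z => c0 z + c1 z) by exact: measurable_funD.
have mc012 : measurable_fun setT (fun z => c0 z + c1 z + c2 z) by exact: measurable_funD.
have mc : measurable_fun setT (fun z => c0 z + c1 z + c2 z + c3 z) by exact: measurable_funD.
have c01_ z : 0 <= c0 z + c1 z by rewrite addr_ge0.
have c012_ z : 0 <= c0 z + c1 z + c2 z by rewrite addr_ge0.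
have c_ z : 0 <= c0 z + c1 z + c2 z + c3 z by rewrite addr_ge0.
apply: (@le_trans _ _ (iterated m mu (fun z => D * (c0 z + c1 z + c2 z + c3 z)))).
  apply: le_iterated.
  - apply: measurable_funM => //; apply: measurable_funM => //; apply: measurable_funM => //.
    exact: (measurableT_comp (measurable_powR _) (mslice x)).
  - exact: measurable_funM.
  - by move=> z; rewrite !mulr_ge0 ?powR_ge0.
  - move=> z; rewrite (holder_split a0_ge0 a1_ge0 a2_ge0 a3_ge0 sum_a a01_neq0 th_a2 p_a13)//.
    exact: (amgm4_weighted a0_ge0 a1_ge0 a2_ge0 a3_ge0 sum_a (p0_ z) (p1_ z) (p2_ z) (p3_ z)).
rewrite iteratedZ// iteratedD// iteratedD// iteratedD// !iteratedZ//.
rewrite -[leRHS]mule1; apply: lee_wpmul2l; first by rewrite lee_fin.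
rewrite -sum_a !EFinD; apply: leeD; first apply: leeD; first apply: leeD.
- apply: ratio_le => //; first exact: iterated_ge0.
  rewrite /iterated (eq_integral (fun t => (om t)%:E)) ?int_om// => t _.
  exact: int_kar.
- apply: ratio_le => //; first exact: iterated_ge0.
  rewrite -[leLHS]fineK; first by rewrite lee_fin /y1 lerDl ltW.
  by rewrite ge0_fin_numE//; exact: J1_ge0.
- apply: ratio_le => //; first exact: iterated_ge0.
  rewrite /phi2 (iterated_prod m mu mom (mpow th ma) om0 (fun y => powR_ge0 _ _)) int_om EFinM.
  by rewrite lee_wpmul2l// lee_fin ltW.
- apply: ratio_le => //; first exact: iterated_ge0.
  rewrite /phi3 (iterated_prod m mu mom (mpow p mh) om0 (fun y => powR_ge0 _ _)) int_om EFinM.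
  by rewrite lee_wpmul2l ?lee_fin ?ltW.
Qed.

Lemma measurable_schur_op : measurable_fun setT schur_op.
Proof.
apply: (measurable_iterated m mu (F := fun x z => om z.1 * ka x z `^ (a0 + a1) * a z.2 * h z.2)).
apply: measurable_funM; last exact: (measurableT_comp mh measurable_snd).
apply: measurable_funM; last exact: (measurableT_comp ma measurable_snd).
apply: measurable_funM; last exact: (measurableT_comp (measurable_powR _) mka).
exact: (measurableT_comp mom (measurableT_comp measurable_snd measurable_fst)).
Qed.

Let schur_ge0 x : (0 <= schur_op x)%E.
Proof. by apply: iterated_ge0 => z; rewrite !mulr_ge0 ?powR_ge0. Qed.

(** A second Hoelder step, in x: the p1-th power is bounded by powers of b^r and of J1 + [fill] with
    exponents p1 be and p1 a1, which sum to 1, and both integrals are under control. *)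
Lemma schur_bound :
  (\int[mu]_x (((b x)%:E * schur_op x) `^ p1) <=
   ((S * A `^ a2 * B `^ be * P `^ (a1 + a3)) `^ p1)%:E)%E.
Proof.
have SP : 0 < S * P by rewrite mulr_gt0.
have p10 := ltW p1_ge0.
pose K := C `^ p1 * B `^ (p1 * be) * (S * P) `^ (p1 * a1).
pose Z x := (J1 x + (fill x)%:E)%E.
have mfill : measurable_fun setT fill by exact: measurable_funM.
have mZ : measurable_fun setT Z by apply: emeasurable_funD => //; exact/measurable_EFinP.
have Z0 x : (0 <= Z x)%E by rewrite adde_ge0// lee_fin ltW.
have e0 : 0 <= p1 * be / B by rewrite divr_ge0 ?mulr_ge0// ltW.
have e1 : 0 <= p1 * a1 / (S * P) by rewrite divr_ge0 ?mulr_ge0// ltW.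
have K0 : 0 <= K by rewrite !mulr_ge0 ?powR_ge0.
have mbr : measurable_fun setT (fun x => (b x `^ r)%:E) by apply/measurable_EFinP; exact: mpow.
pose W x := (K%:E * ((p1 * be / B)%:E * (b x `^ r)%:E + (p1 * a1 / (S * P))%:E * Z x))%E.
have W00 x : (0 <= (p1 * be / B)%:E * (b x `^ r)%:E)%E by rewrite mule_ge0 ?lee_fin ?powR_ge0.
have W01 x : (0 <= (p1 * a1 / (S * P))%:E * Z x)%E by rewrite mule_ge0 ?lee_fin.
have mW0 : measurable_fun setT (fun x => (p1 * be / B)%:E * (b x `^ r)%:E)%E.
  exact: emeasurable_funM.
have mW1 : measurable_fun setT (fun x => (p1 * a1 / (S * P))%:E * Z x)%E.
  exact: emeasurable_funM.
have mW01 := emeasurable_funD mW0 mW1.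
have intJ : (\int[mu]_x J1 x = (S * Hp)%:E)%E by rewrite integral_J1 HpE.
have J1_ae : {ae mu, forall x, (J1 x < +oo)%E}.
  have iJ : mu.-integrable setT J1.
    apply/integrableP; split=> //.
    by rewrite (eq_integral J1) ?intJ ?ltry// => x _; rewrite gee0_abs.
  have := integrable_ae measurableT iJ; apply: filterS => x /(_ Logic.I).
  by rewrite ge0_fin_numE.
apply: (@le_trans _ _ (\int[mu]_x W x)%E).
  apply: ae_ge0_le_integral => //.
  - by move=> x _; exact: poweR_ge0.
  - apply: (measurableT_comp (measurable_poweR _)); apply: emeasurable_funM; last exact: measurable_schur_op.
    exact/measurable_EFinP.
  - by move=> x _; rewrite mule_ge0 ?lee_fin// adde_ge0.
  - exact: emeasurable_funM.
  - apply: filterS J1_ae => x Jx _.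
    set y1 := fine (J1 x) + fill x.
    have y1_gt0 : 0 < y1 by rewrite ltr_wpDl// fine_ge0.
    have ZE : Z x = y1%:E by rewrite /Z -[J1 x]fineK// ge0_fin_numE.
    apply: (@le_trans _ _ ((b x * (C * y1 `^ a1)) `^ p1)%:E).
      rewrite -poweR_EFin; apply: gt0_ler_poweR => //.
      - by rewrite in_itv/= leey mule_ge0 ?lee_fin.
      - by rewrite in_itv/= leey lee_fin !mulr_ge0 ?powR_ge0.
      - by rewrite EFinM lee_wpmul2l ?lee_fin// schur_op_le.
    have -> : W x = (K * (p1 * be / B * b x `^ r + p1 * a1 / (S * P) * y1))%:E by rewrite /W ZE.
    rewrite lee_fin.
    have C0 : 0 <= C by rewrite !mulr_ge0 ?powR_ge0.
    have -> : (b x * (C * y1 `^ a1)) `^ p1 = b x `^ p1 * (C `^ p1 * y1 `^ (p1 * a1)).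
      have yC : 0 <= y1 `^ a1 by exact: powR_ge0.
      by rewrite (powRM _ (b0 x) (mulr_ge0 C0 yC)) (powRM _ C0 yC) -powRrM [a1 * p1]mulrC.
    have bE : b x `^ p1 = (b x `^ r) `^ (p1 * be) by rewrite -powRrM mulrCA r_be mulr1.
    have sumE : p1 * be + p1 * a1 + 0 + 0 = 1 by rewrite !addr0 -mulrDr [be + a1]addrC.
    (* The two-factor case, padded with two trivial factors of exponent 0. *)
    have := amgm4_weighted (mulr_ge0 p10 be_ge0) (mulr_ge0 p10 a1_ge0) (lexx 0) (lexx 0) sumE
      (powR_ge0 (b x) r) (ltW y1_gt0) (@ler01 R) (@ler01 R) B0 SP (@ltr01 R) (@ltr01 R).
    rewrite !powRr0 !mulr1 !mul0r !addr0 -bE => /(ler_wpM2l (powR_ge0 C p1)).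
    rewrite /K; set q := (_ + _); move=> H.
    by rewrite mulrCA -!mulrA; move: H; rewrite -!mulrA.
have KE : K = (S * A `^ a2 * B `^ be * P `^ (a1 + a3)) `^ p1 by exact: schur_constE.
rewrite -KE -[leRHS]mule1 ge0_integralZl_EFin//; last by move=> x _; rewrite adde_ge0.
apply: lee_wpmul2l; first by rewrite lee_fin.
rewrite ge0_integralD// ge0_integralZl_EFin//; last by move=> x _; rewrite lee_fin powR_ge0.
rewrite ge0_integralZl_EFin//.
have -> : 1%E = ((p1 * be)%:E + (p1 * a1)%:E)%E :> \bar R by rewrite -EFinD -mulrDr [be + a1]addrC p1_a1.
apply: leeD; apply: ratio_le => //; rewrite ?mulr_ge0//.
- by apply: integral_ge0 => x _; rewrite lee_fin powR_ge0.
- by apply: integral_ge0.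
- rewrite ge0_integralD//; last 2 first.
  + by move=> x _; rewrite lee_fin ltW.
  + exact/measurable_EFinP.
  rewrite intJ.
  have -> : (\int[mu]_x (fill x)%:E = (S * (P - Hp))%:E)%E.
    transitivity (\int[mu]_x ((S * (P - Hp))%:E * (eta x)%:E))%E; first by [].
    rewrite ge0_integralZl_EFin ?int_eta ?mule1//.
    - by move=> x _; rewrite lee_fin ltW.
    - exact/measurable_EFinP.
    - by rewrite mulr_ge0 ?subr_ge0 ?ltW.
  by rewrite -EFinD lee_fin -mulrDr addrC subrK.
Qed.

End schur.

(** * The Gamma function *)

Section gamma.
Context {R : realType}.
Local Notation leb := (@lebesgue_measure R).
Local Notation mR := (measurableTypeR R).
Implicit Types (c d s t : R) (f : R -> R).

(** Compact intervals inside ]0, +oo[, on which the integrands are continuous, allow the fundamental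
    theorem and substitutions. The scale [d] matches the intervals before and after t -> c t. *)
Lemma exhaust_cvg f d : 0 < d -> measurable_fun setT (f : mR -> R) -> (forall t, 0 <= f t) ->
  (\int[leb]_(t in `[(d / k.+1%:R)%R, (d * k.+1%:R)%R]) (f t)%:E)%E @[k --> \oo] -->
  (\int[leb]_(t in `]0%R, +oo[) (f t)%:E)%E.
Proof.
move=> d0 mf f0.
have -> : (`]0, +oo[%classic : set R) = \bigcup_k `[d / k.+1%:R, d * k.+1%:R]%classic.
  apply/seteqP; split => t /=; rewrite in_itv/= ?andbT.
    move=> t0; pose N := Num.bound (t / d + d / t).
    have tN : t / d + d / t < N%:R.
      by apply: archi_boundP; rewrite addr_ge0// divr_ge0// ltW.
    have tN1 : t / d + d / t < N.+1%:R by apply: lt_le_trans tN _; rewrite ler_nat.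
    have p1 : 0 < t / d by rewrite divr_gt0.
    have p2 : 0 < d / t by rewrite divr_gt0.
    exists N => //=; rewrite in_itv/= ler_pdivrMr// -ler_pdivrMl// mulrC.
    apply/andP; split; first by rewrite mulrC; lra.
    by rewrite -ler_pdivrMl// mulrC; lra.
  by move=> [k _] /=; rewrite in_itv/= => /andP[+ _]; apply: lt_le_trans; rewrite divr_gt0.
apply: ge0_nondecreasing_set_cvg_integral.
- apply/nondecreasing_seqP => k; apply/subsetPset => t /=; rewrite !in_itv/= => /andP[t1 t2].
  apply/andP; split.
    by apply: le_trans t1; rewrite ler_pM2l// lef_pV2 ?posrE// ler_nat.
  by apply: le_trans t2 _; rewrite ler_pM2l// ler_nat.
- by move=> k; exact: measurable_itv.
- by move=> k; apply/measurable_EFinP; exact: measurable_funTS.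
- by move=> k t _; rewrite lee_fin.
Qed.

Lemma measurable_gamma_integrand s c : measurable_fun setT (fun t : mR => t `^ (s - 1) * expR (- (c * t))).
Proof.
apply: measurable_funM; first exact: measurable_powR.
by apply: measurableT_comp => //; apply: measurableT_comp => //; exact: measurable_funM.
Qed.

Lemma gamma_integrand_ge0 s c t : 0 <= t `^ (s - 1) * expR (- (c * t)).
Proof. by rewrite mulr_ge0 ?powR_ge0 ?expR_ge0. Qed.

Lemma continuous_powR_gt0 s t : 0 < t -> {for t, continuous (fun t : R => t `^ s)}.
Proof.
move=> t0; apply: (@differentiable_continuous _ R^o R^o).
by apply/derivable1_diffP; apply: derivable_powR; rewrite in_itv/= andbT.
Qed.

Lemma gamma_integrand_continuous s c t : 0 < t ->
  {for t, continuous (fun t : R => t `^ (s - 1) * expR (- (c * t)))}.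
Proof.
move=> t0; apply: cvgM; first exact: continuous_powR_gt0.
apply: (@continuous_comp _ _ _ (fun t : R => - (c * t)) expR); last exact: continuous_expR.
by apply: cvgN; apply: cvgM; [exact: cvg_cst|exact: cvg_id].
Qed.

(** The bound x^s <= exp(s (x - 1)) at x = t / (2 s). *)
Lemma powR_le_exp_half s t : 0 < s -> 0 <= t -> t `^ s <= (2 * s) `^ s * expR (t / 2).
Proof.
move=> s0 t0; have s2 : 0 < 2 * s by rewrite mulr_gt0.
rewrite (powR_scale s s2 t0) ler_wpM2l ?powR_ge0//.
apply: le_trans (powR_le_exp (ltW s0) _) _; first by rewrite divr_ge0// ltW.
rewrite ler_expR mulrBr mulr1.
have -> : s * (t / (2 * s)) = t / 2 by field; exact: lt0r_neq0.
by rewrite lerBlDr lerDl ltW.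
Qed.

(* On [0, +oo[ the integrand is at most a multiple of the derivative of -1 / (1 + t^s). *)
Lemma gamma_integral_lty s : 0 < s ->
  (\int[leb]_(t in `]0%R, +oo[) (t `^ (s - 1) * expR (- (1 * t)))%:E < +oo)%E.
Proof.
(* Squaring 1 + t^s <= (1 + (2 s)^s) e^(t/2) gives this constant; the 1/s cancels the factor s in
   the derivative [f]. *)
move=> s0; pose K := (1 + (2 * s) `^ s) ^+ 2 / s.
pose F t := - (1 + t `^ s)^-1.
pose f t := s * t `^ (s - 1) / (1 + t `^ s) ^+ 2.
have K0 : 0 <= K by rewrite divr_ge0 ?sqr_ge0// ltW.
have den t : 0 < 1 + t `^ s by rewrite ltr_wpDr ?powR_ge0.
have dF t : 0 < t -> is_derive t 1 F (f t).
  move=> t0; have dp := is_derive1_powR s t0.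
  have d1 : is_derive t 1 (fun u : R => 1 + u `^ s) (s * t `^ (s - 1)).
    by apply: is_derive_eq (is_deriveD (is_derive_cst (1 : R) t 1) dp) _; rewrite add0r.
  have d2 := is_deriveN (@is_deriveV R (fun u : R => 1 + u `^ s) t _ 1 (lt0r_neq0 (den t)) d1).
  have e2 : - (- (1 + t `^ s) ^- 2 *: (s * t `^ (s - 1))) = f t.
    by rewrite /f scaleNr opprK; exact: mulrC.
  by move: d2; rewrite e2.
have F1 t : `|F t| <= 1.
  by rewrite normrN normfV ger0_norm ?(ltW (den t))// invf_le1// lerDl powR_ge0.
have F0 t : F t <= 0 by rewrite oppr_le0 invr_ge0 ltW.
have cF t : 0 < t -> {for t, continuous F}.
  move=> t0; apply: (@differentiable_continuous _ R^o R^o); apply/derivable1_diffP.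
  by have [] := dF t t0.
have cf t : 0 < t -> {for t, continuous f}.
  move=> t0; apply: cvgM.
    by apply: cvgM; [exact: cvg_cst|exact: continuous_powR_gt0].
  apply: cvgV; first by rewrite expf_neq0// lt0r_neq0.
  have c1 : (1 + u `^ s) @[u --> t] --> 1 + t `^ s.
    by apply: cvgD; [exact: cvg_cst|exact: continuous_powR_gt0].
  exact: (cvgM c1 c1).
have f0 t : 0 <= f t by rewrite divr_ge0 ?sqr_ge0// mulr_ge0 ?powR_ge0// ltW.
have mf : measurable_fun setT (f : mR -> R).
  have mp e : measurable_fun setT (fun t : mR => t `^ e) by exact: measurable_powR.
  apply: measurable_funM; first exact: measurable_funM.
  apply: (measurableT_comp (@measurable_inv R)); apply: measurable_funX; exact: measurable_funD.
have int1 k : (\int[leb]_(t in `[(1 / k.+1%:R)%R, (1 * k.+1%:R)%R]) (f t)%:E <= 1)%E.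
  have a0 : 0 < 1 / k.+1%:R :> R by rewrite divr_gt0.
  have [->|k0] := eqVneq k 0%N.
    by rewrite mulr1 divr1 set_itv1 integral_set1.
  have ab : 1 / k.+1%:R < 1 * k.+1%:R :> R.
    rewrite !mul1r; apply: (@lt_trans _ _ 1); last by rewrite ltr1n ltnS lt0n.
    by rewrite invf_lt1// ltr1n ltnS lt0n.
  rewrite (@continuous_FTC2 R f F)//.
  - rewrite -EFinB lee_fin; have := F0 (1 * k.+1%:R); have := F1 (1 / k.+1%:R).
    by rewrite ler_norml => /andP[]; lra.
  - apply: continuous_in_subspaceT => t; rewrite inE/= in_itv/= => /andP[at_ _].
    by apply: cf; exact: lt_le_trans at_.
  - split.
    + move=> t; rewrite in_itv/= => /andP[at_ _].
      by have [] := dF t (lt_trans a0 at_).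
    + by apply: cvg_at_right_filter; exact: cF.
    + by apply: cvg_at_left_filter; apply: cF; exact: lt_trans ab.
  - move=> t; rewrite in_itv/= => /andP[at_ _].
    by rewrite derive1E; have [_ ->] := dF t (lt_trans a0 at_).
have If : (\int[leb]_(t in `]0%R, +oo[) (f t)%:E <= 1)%E.
  have := exhaust_cvg ltr01 mf f0; move/cvg_lim => <-//.
  by apply: lime_le; [by apply/cvg_ex; eexists; exact: exhaust_cvg|exact: nearW].
apply: (@le_lt_trans _ _ (K%:E * \int[leb]_(t in `]0%R, +oo[) (f t)%:E)%E); last first.
  apply: (@le_lt_trans _ _ (K%:E * 1)%E); last by rewrite mule1 ltry.
  by rewrite lee_wpmul2l ?lee_fin.
rewrite -ge0_integralZl_EFin//; last 2 first.
- by move=> t _; rewrite lee_fin.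
- by apply/measurable_EFinP; exact: measurable_funTS.
apply: ge0_le_integral => //.
- by move=> t _; rewrite lee_fin gamma_integrand_ge0.
- by apply/measurable_EFinP; apply: measurable_funTS; exact: measurable_gamma_integrand.
- by apply/measurable_EFinP; apply: measurable_funTS; exact: measurable_funM.
move=> t /=; rewrite in_itv/= andbT => t0.
rewrite lee_fin mul1r /K /f.
set u := t `^ (s - 1); set w := 1 + (2 * s) `^ s; set z := 1 + t `^ s.
have u0 : 0 <= u by exact: powR_ge0.
have zw : z <= w * expR (t / 2).
  rewrite /w mulrDl mul1r lerD//; first by rewrite -expR0 ler_expR divr_ge0// ltW.
  by apply: powR_le_exp_half => //; exact: ltW.
have w0 : 0 < w by rewrite ltr_wpDr ?powR_ge0.
have -> : w ^+ 2 / s * (s * u / z ^+ 2) = u * (w / z) ^+ 2.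
  by field; rewrite (lt0r_neq0 s0) (lt0r_neq0 (den t)).
rewrite ler_wpM2l//.
have -> : expR (- t) = expR (- (t / 2)) ^+ 2 by rewrite -expRM_natl; congr expR; field.
rewrite ler_pXn2r ?nnegrE ?expR_ge0 ?divr_ge0 ?(ltW w0) ?(ltW (den t))//.
by rewrite ler_pdivlMr ?den// expRN mulrC ler_pdivrMr ?expR_gt0.
Qed.

(** The substitution t -> c t is made on compact intervals and passed to the limit on both sides. *)
Lemma gamma_scaled_EFin s c : 0 < c ->
  (\int[leb]_(t in `]0%R, +oo[) (t `^ (s - 1) * expR (- (c * t)))%:E =
   (c `^ (- s))%:E * \int[leb]_(t in `]0%R, +oo[) (t `^ (s - 1) * expR (- (1 * t)))%:E)%E.
Proof.
move=> c0; have c00 := lt0r_neq0 c0.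
pose G t := t `^ (s - 1) * expR (- (1 * t)).
pose Gc t := t `^ (s - 1) * expR (- (c * t)).
have mG : measurable_fun setT (G : mR -> R) by exact: measurable_gamma_integrand.
have mGc : measurable_fun setT (Gc : mR -> R) by exact: measurable_gamma_integrand.
have G0 t : 0 <= G t by exact: gamma_integrand_ge0.
have Gc0 t : 0 <= Gc t by exact: gamma_integrand_ge0.
have l1 := exhaust_cvg c0 mG G0.
have l2 := exhaust_cvg ltr01 mGc Gc0.
have cs : c `^ s != 0 by rewrite lt0r_neq0// powR_gt0.
suff key k : (\int[leb]_(t in `[(c / k.+1%:R)%R, (c * k.+1%:R)%R]) (G t)%:E =
    (c `^ s)%:E * \int[leb]_(t in `[(1 / k.+1%:R)%R, (1 * k.+1%:R)%R]) (Gc t)%:E)%E.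
  have l3 : ((c `^ s)%:E * \int[leb]_(t in `[(1 / k.+1%:R)%R, (1 * k.+1%:R)%R]) (Gc t)%:E)%E @[k --> \oo] -->
      ((c `^ s)%:E * \int[leb]_(t in `]0%R, +oo[) (Gc t)%:E)%E.
    by apply: cvgeZl => //; exact: l2.
  rewrite (_ : (fun k => _) = (fun k => (c `^ s)%:E * \int[leb]_(t in `[(1 / k.+1%:R)%R, (1 * k.+1%:R)%R]) (Gc t)%:E)%E) in l1; last first.
    by apply/funext => k; exact: key.
  have e : (\int[leb]_(t in `]0%R, +oo[) (G t)%:E = (c `^ s)%:E * \int[leb]_(t in `]0%R, +oo[) (Gc t)%:E)%E.
    exact: (cvg_unique _ l1 l3).
  by rewrite -/(G _) e muleA -EFinM powRN mulVf// mul1e.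
have dF : derive1 (fun t : R => c * t) = cst c.
  apply/funext => t; rewrite derive1E.
  have d1 := is_deriveM (is_derive_cst c t (1 : R)) (is_derive_id t (1 : R)).
  by rewrite (@derive_val _ _ _ _ _ _ _ d1) scaler0 addr0 /= /GRing.scale/= mulr1.
have ab : 1 / k.+1%:R <= 1 * k.+1%:R :> R.
  rewrite !mul1r; apply: (@le_trans _ _ 1); last by rewrite ler1n.
  by rewrite invf_le1// ler1n.
have a0 : 0 < 1 / k.+1%:R :> R by rewrite divr_gt0.
have E1 : c / k.+1%:R = c * (1 / k.+1%:R) by rewrite div1r.
have E2 : c * k.+1%:R = c * (1 * k.+1%:R) by rewrite mul1r.
rewrite E1 E2 (integration_by_substitution_increasing (F := fun t => c * t) (G := G) ab).
- rewrite -ge0_integralZl_EFin ?powR_ge0//; last 2 first.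
  + by move=> t _; rewrite lee_fin.
  + by apply/measurable_EFinP; exact: measurable_funTS.
  apply: eq_integral => t; rewrite inE/= in_itv/= => /andP[at_ _].
  have t0 : 0 < t by exact: lt_le_trans at_.
  rewrite dF; transitivity ((G (c * t) * c)%:E); first by [].
  rewrite -EFinM; congr (_%:E); rewrite /G /Gc mul1r powRM ?(ltW c0) ?(ltW t0)//.
  have -> : c `^ s = c `^ (s - 1) * c by rewrite -[X in _ * X]powRr1 ?(ltW c0)// -powRD ?c00 ?implybT// subrK.
  by ring.
- by move=> x y _ _; rewrite ltr_pM2l.
- by rewrite dF => t _; exact: cvg_cst.
- by rewrite dF; apply: is_cvg_cst.
- by rewrite dF; apply: is_cvg_cst.
- have cc : continuous (fun t : R => c * t) by move=> t; apply: cvgM; [exact: cvg_cst|exact: cvg_id].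
  split.
  + by move=> t _; apply: derivableM => //; exact: derivable_id.
  + by apply: cvg_at_right_filter; exact: cc.
  + by apply: cvg_at_left_filter; exact: cc.
- apply: continuous_in_subspaceT => t; rewrite inE/= in_itv/= => /andP[at_ _].
  by apply: gamma_integrand_continuous; apply: lt_le_trans at_; rewrite mulr_gt0.
Qed.

Lemma Gamma_EFin s : 0 < s ->
  (\int[leb]_(t in `]0%R, +oo[) (t `^ (s - 1) * expR (- (1 * t)))%:E = (Gamma s)%:E)%E.
Proof.
move=> s0; rewrite /Gamma /Rintegral fineK.
  by apply: eq_integral => t _; rewrite mul1r.
rewrite ge0_fin_numE; last by apply: integral_ge0 => t _; rewrite lee_fin -[t in expR (- t)]mul1r gamma_integrand_ge0.
apply: le_lt_trans (gamma_integral_lty s0); rewrite le_eqVlt; apply/orP; left; apply/eqP.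
by apply: eq_integral => t _; rewrite mul1r.
Qed.

Lemma gamma_scaled s c : 0 < s -> 0 < c ->
  (\int[leb]_(t in `]0%R, +oo[) (t `^ (s - 1) * expR (- (c * t)))%:E = (c `^ (- s) * Gamma s)%:E)%E.
Proof. by move=> s0 c0; rewrite gamma_scaled_EFin// Gamma_EFin. Qed.

Lemma Gamma_gt0 s : 0 < s -> 0 < Gamma s.
Proof.
move=> s0; rewrite lt_neqAle; apply/andP; split; last first.
  by apply: Rintegral_ge0 => t _; rewrite -[t in expR (- t)]mul1r gamma_integrand_ge0.
apply/negP => /eqP G0; have := Gamma_EFin s0; rewrite -G0; apply/eqP; rewrite gt_eqF//.
have mI : measurable (`[1, 2]%classic : set mR) by exact: measurable_itv.
(* On [1, 2] one has t^(s-1) >= 1/t >= 1/2 and e^(-t) >= e^(-2). *)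
apply: (@lt_le_trans _ _ (\int[leb]_(t in `[1%R, 2%R]) (expR (- 2) / 2)%:E)%E).
  have l12 : leb (`[1, 2]%classic : set mR) = 1%E.
    by rewrite /= lebesgue_measure_itv/= lte_fin ltr1n/= -EFinD; congr (_%:E); lra.
  by rewrite integral_cst// [X in (_ * X)%E]l12 mule1 lte_fin divr_gt0 ?expR_gt0.
apply: (@le_trans _ _ (\int[leb]_(t in `[1%R, 2%R]) (t `^ (s - 1) * expR (- (1 * t)))%:E)%E).
  apply: ge0_le_integral => //.
  - by apply/measurable_EFinP; apply: measurable_funTS; exact: measurable_gamma_integrand.
  move=> t /=; rewrite in_itv/= => /andP[t1 t2]; have t0 : 0 < t by exact: lt_le_trans t1.
  rewrite lee_fin mul1r mulrC ler_pM ?expR_ge0 ?invr_ge0 ?ler_expR ?lerN2//.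
  have -> : t `^ (s - 1) = t `^ s * t^-1.
    by rewrite powRD ?(lt0r_neq0 t0) ?implybT// powR_inv1// ltW.
  rewrite -[leLHS]mul1r ler_pM ?invr_ge0//; last by rewrite lef_pV2 ?posrE.
  have -> : 1 = 1 `^ s :> R by rewrite powR1.
  by apply: ge0_ler_powR; rewrite ?nnegrE// ltW.
apply: ge0_subset_integral => //.
- by apply/measurable_EFinP; apply: measurable_funTS; exact: measurable_gamma_integrand.
- by move=> t _; rewrite lee_fin gamma_integrand_ge0.
- by move=> t /=; rewrite !in_itv/= andbT => /andP[t1 _]; exact: lt_le_trans t1.
Qed.

(** Gamma(s) (1 + |x|^2)^(-s) is the integral of t^(s-1) e^(-(1 + |x|^2) t) over t > 0. Integrating
    in x first yields the Gaussian factor (pi/t)^(n/2), which lowers the exponent to s - n/2. This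
    is the source of the Gamma quotient in [C1_const]. *)
Lemma integral_bracket (n : nat) s : n%:R / 2 < s ->
  (\int[@lebesgue_rV R n]_x ((1 + sqnorm x) `^ (- s))%:E =
   (pi `^ (n%:R / 2) * (Gamma (s - n%:R / 2) / Gamma s))%:E)%E.
Proof.
move=> ns; set mu := @lebesgue_rV R n.
have n0 : 0 <= n%:R / 2 :> R by rewrite divr_ge0.
have s0 : 0 < s by exact: le_lt_trans ns.
have Gs0 := Gamma_gt0 s0.
have b0 (x : 'rV[R]_n) : 0 < 1 + sqnorm x by rewrite ltr_wpDr ?sqnorm_ge0.
have mI : measurable (`]0, +oo[%classic : set mR) by exact: measurable_itv.
have msq : measurable_fun setT (@sqnorm R n) by exact: measurable_sqnorm.
have mb : measurable_fun setT (fun x : 'rV[R]_n => (1 + sqnorm x) `^ (- s)).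
  apply: (measurableT_comp (measurable_powR _) (g := fun x : 'rV[R]_n => 1 + sqnorm x)).
  exact: measurable_funD.
suff key : ((Gamma s)%:E * \int[mu]_x ((1 + sqnorm x) `^ (- s))%:E =
    (pi `^ (n%:R / 2) * Gamma (s - n%:R / 2))%:E)%E.
  have -> : (pi `^ (n%:R / 2) * (Gamma (s - n%:R / 2) / Gamma s))%:E =
    (((Gamma s)^-1)%:E * (pi `^ (n%:R / 2) * Gamma (s - n%:R / 2))%:E)%E :> \bar R.
    by rewrite -EFinM; congr (_%:E); rewrite mulrA mulrC.
  by rewrite -key muleA -EFinM mulVf ?mul1e// lt0r_neq0.
pose D t : R := \1_(`]0, +oo[%classic : set R) t.
have mD : measurable_fun setT (D : mR -> R) by exact: measurable_indic.
have D0 t : 0 <= D t by rewrite /D indicE ler0n.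
have indE (f : R -> R) : (\int[leb]_(t in `]0%R, +oo[) (f t)%:E = \int[leb]_t (D t * f t)%:E)%E.
  rewrite integral_mkcond; apply: eq_integral => t _; rewrite patchE /D indicE.
  by case: ifP => _; rewrite ?mul1r ?mul0r.
pose f (x : 'rV[R]_n) (t : R) := D t * (t `^ (s - 1) * expR (- ((1 + sqnorm x) * t))).
transitivity (\int[mu]_x \int[leb]_t (f x t)%:E)%E.
  rewrite -ge0_integralZl_EFin ?(ltW Gs0)//; last 2 first.
  - by move=> x _; rewrite lee_fin powR_ge0.
  - exact/measurable_EFinP.
  apply: eq_integral => x _.
  rewrite -(indE (fun t => t `^ (s - 1) * expR (- ((1 + sqnorm x) * t)))).
  by rewrite gamma_scaled// mulrC.
have mf : measurable_fun setT (fun z : 'rV[R]_n * mR => (f z.1 z.2)%:E).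
  apply/measurable_EFinP; apply: measurable_funM; first exact: (measurableT_comp mD measurable_snd).
  apply: measurable_funM; first exact: (measurableT_comp (measurable_powR _) measurable_snd).
  apply: measurableT_comp => //; apply: measurableT_comp => //; apply: measurable_funM => //.
  by apply: measurable_funD => //; exact: (measurableT_comp msq measurable_fst).
rewrite (@fubini_tonelli _ _ _ _ _ mu leb (fun z => (f z.1 z.2)%:E) mf); last first.
  by move=> z; rewrite lee_fin mulr_ge0// gamma_integrand_ge0.
have s1 : 0 < s - n%:R / 2 by rewrite subr_gt0.
transitivity (\int[leb]_t ((pi `^ (n%:R / 2))%:E *
    (D t * (t `^ (s - n%:R / 2 - 1) * expR (- (1 * t))))%:E))%E; last first.
  rewrite ge0_integralZl_EFin ?powR_ge0//.
  - by rewrite -(indE (fun t => t `^ (s - n%:R / 2 - 1) * expR (- (1 * t)))) Gamma_EFin.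
  - by move=> t _; rewrite lee_fin mulr_ge0// gamma_integrand_ge0.
  - apply/measurable_EFinP; apply: measurable_funM => //; exact: measurable_gamma_integrand.
apply: eq_integral => t _ /=; rewrite /f.
case: (boolP (t \in (`]0, +oo[%classic : set R))) => [|tD]; last first.
  have -> : D t = 0 by rewrite /D indicE (negbTE tD).
  rewrite mul0r mule0; apply: integral0_eq => x _; by rewrite mul0r.
rewrite inE/= in_itv/= andbT => t0; have p0 := pi_gt0 R.
have -> : D t = 1 by rewrite /D indicE mem_set//= in_itv/= t0.
transitivity (\int[mu]_x ((t `^ (s - 1) * expR (- t))%:E * (expR (- (t * sqnorm (x - 0))))%:E))%E.
  apply: eq_integral => x _; rewrite -EFinM mul1r subr0; congr (_%:E).
  by rewrite -mulrA -expRD; congr (_ * expR _); ring.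
rewrite ge0_integralZl_EFin ?mulr_ge0 ?powR_ge0 ?expR_ge0//; last first.
  apply/measurable_EFinP; apply: measurableT_comp => //; apply: measurableT_comp => //.
  by apply: measurable_funM => //; under eq_fun do rewrite subr0.
rewrite integral_gauss_sym// -!EFinM; congr (_%:E).
have -> : Num.sqrt (pi / t) ^+ n = pi `^ (n%:R / 2) * t `^ (- (n%:R / 2)).
  rewrite -powR12_sqrt ?divr_ge0 ?(ltW p0) ?(ltW t0)// -powR_mulrn ?powR_ge0// -powRrM.
  rewrite [2^-1 * _]mulrC powRM ?invr_ge0 ?(ltW p0) ?(ltW t0)//; congr (_ * _).
  by rewrite -[t^-1]powR_inv1 ?(ltW t0)// -powRrM mulN1r.
have -> : t `^ (s - n%:R / 2 - 1) = t `^ (s - 1) * t `^ (- (n%:R / 2)).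
  by rewrite -powRD ?(lt0r_neq0 t0) ?implybT//; congr (_ `^ _); ring.
by rewrite !mul1r; ring.
Qed.

End gamma.

(** * Resolvent bounds *)

Section resolvent_bound.
Context {R : realType} {n : nat}.
Local Notation mu := (@lebesgue_rV R n).
Local Notation leb := (@lebesgue_measure R).
Local Notation mR := (measurableTypeR R).
Implicit Types (x y : 'rV[R]_n) (t : R).

(* The L^1(0, oo) norm of t |-> e^(-c t) ||k_t||_(1 / (1 - 2 / r)), k the heat kernel. *)
Definition resolvent_const (c r : R) : R :=
  (4 * pi) `^ (- (n%:R / r)) * (1 - 2 / r) `^ (n%:R / 2 * (1 - 2 / r)) *
  (c `^ (- (1 - n%:R / r)) * Gamma (1 - n%:R / r)).

Variables (c r : R).
Hypotheses (c0 : 0 < c) (r2 : 2 < r) (nr : n%:R < r).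

Let r0 : 0 < r. Proof. exact: lt_trans r2. Qed.
Let s := 1 - 2 / r.
Let s0 : 0 < s. Proof. by rewrite subr_gt0 ltr_pdivrMr ?mul1r. Qed.
Let g0 : 0 < 1 - n%:R / r. Proof. by rewrite subr_gt0 ltr_pdivrMr ?mul1r. Qed.
Let N := (4 * pi) `^ (- (n%:R / r)) * s `^ (n%:R / 2 * s).
Let D t : R := \1_(`]0, +oo[%classic : set R) t.
Let om t := D t * (N * (t `^ ((1 - n%:R / r) - 1) * expR (- (c * t)))).
Let ka x (z : mR * 'rV[R]_n) := heat_kernel (s * z.1) x z.2.

Let N0 : 0 <= N. Proof. by rewrite mulr_ge0 ?powR_ge0. Qed.

Let D0 t : 0 <= D t. Proof. by rewrite /D indicE ler0n. Qed.

Let om0 t : 0 <= om t.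
Proof. by rewrite !mulr_ge0 ?powR_ge0 ?expR_ge0. Qed.

Let mD : measurable_fun setT (D : mR -> R).
Proof. by apply: measurable_indic; exact: measurable_itv. Qed.

Let mom : measurable_fun setT (om : mR -> R).
Proof. by apply: measurable_funM => //; apply: measurable_funM => //; exact: measurable_gamma_integrand. Qed.

Let int_om : (\int[leb]_t (om t)%:E = (resolvent_const c r)%:E)%E.
Proof.
transitivity (\int[leb]_(t in `]0%R, +oo[) (N%:E * (t `^ ((1 - n%:R / r) - 1) * expR (- (c * t)))%:E))%E.
  rewrite [RHS]integral_mkcond; apply: eq_integral => t _; rewrite patchE /om /D indicE.
  by case: ifP => _; rewrite ?mul1r ?mul0r.
rewrite ge0_integralZl_EFin ?mulr_ge0 ?powR_ge0//.
- by rewrite gamma_scaled.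
- by move=> t _; rewrite lee_fin gamma_integrand_ge0.
- by apply/measurable_EFinP; apply: measurable_funTS; exact: measurable_gamma_integrand.
Qed.

Let mka : measurable_fun setT (fun z : ('rV[R]_n * mR) * 'rV[R]_n => ka z.1.1 (z.1.2, z.2)).
Proof.
pose G (z : ('rV[R]_n * mR) * 'rV[R]_n) := ((s * z.1.2 : mR, z.1.1), z.2).
have mG : measurable_fun setT G.
  apply: measurable_fun_pair => //=; apply: measurable_fun_pair => /=.
    by apply: measurable_funM => //; exact: (measurableT_comp measurable_snd measurable_fst).
  exact: (measurableT_comp measurable_fst measurable_fst).
exact: (measurableT_comp (@measurable_heat_kernel R n) mG).
Qed.

Let om_case t : om t = 0 \/ 0 < t.
Proof.
rewrite /om /D indicE; case: (boolP (t \in _)) => [|_]; last by left; rewrite mul0r.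
by rewrite inE/= in_itv/= andbT; right.
Qed.

Let int_kar t x : (\int[mu]_y (om t * ka x (t, y))%:E = (om t)%:E)%E.
Proof.
case: (om_case t) => [->|t0]; first by apply: integral0_eq => y _; rewrite mul0r.
transitivity (\int[mu]_y ((om t)%:E * (heat_kernel (s * t) x y)%:E))%E; first by [].
rewrite ge0_integralZl_EFin ?om0//.
- by rewrite integral_heat_kernel ?mule1// mulr_gt0.
- by move=> y _; rewrite lee_fin heat_kernel_ge0.
- by apply/measurable_EFinP; exact: measurable_heat_kernel_y.
Qed.

Let int_kal t y : (\int[mu]_x (om t * ka x (t, y))%:E = (om t)%:E)%E.
Proof.
rewrite -[RHS](int_kar t y); apply: eq_integral => x _.
by rewrite /ka heat_kernel_sym.
Qed.

(** The s-th power of the Gaussian at time s t has the exponent of the Gaussian at time t, and the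
    two peaks differ by N t^(-n/r). Thus [ka] has mass one and [om] carries e^(-c t) times the norm
    of k_t with exponent 1/s. *)
Let kernel_factor t x y : 0 < t ->
  expR (- (c * t)) * heat_kernel t x y = om t * ka x (t, y) `^ s.
Proof.
move=> t0; have st0 : 0 < s * t by rewrite mulr_gt0.
have p0 : 0 < 4 * pi :> R by rewrite mulr_gt0// pi_gt0.
rewrite /om /D indicE mem_set/= ?in_itv/= ?t0// mul1r /ka /= !heat_kernelE// /heat_peak /heat_weight.
rewrite [(_ * expR _) `^ s]powRM ?powR_ge0 ?expR_ge0// -expRM.
have -> : - ((4 * (s * t))^-1 * sqnorm (x - y)) * s = - ((4 * t)^-1 * sqnorm (x - y)).
  by field; rewrite (lt0r_neq0 t0) (lt0r_neq0 s0).
have -> : 4 * pi * (s * t) = s * (4 * pi * t) by ring.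
have q0 : 0 < 4 * pi * t by rewrite mulr_gt0.
rewrite (powRM _ (ltW s0) (ltW q0)) [X in _ = _ * (X * _)](powRM s (powR_ge0 _ _) (powR_ge0 _ _)) -!powRrM /N.
have e1 : s `^ (n%:R / 2 * s) * s `^ (- (n%:R / 2) * s) = 1.
  by rewrite -powRD ?(lt0r_neq0 s0) ?implybT// mulNr subrr powRr0.
have e2 : (4 * pi) `^ (- (n%:R / r)) * t `^ (1 - n%:R / r - 1) * (4 * pi * t) `^ (- (n%:R / 2) * s) =
    (4 * pi * t) `^ (- (n%:R / 2)).
  have -> : 1 - n%:R / r - 1 = - (n%:R / r) by ring.
  rewrite -powRM ?(ltW p0) ?(ltW t0)// -powRD ?(lt0r_neq0 q0) ?implybT//.
  by congr (_ `^ _); rewrite /s; field; exact: lt0r_neq0.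
rewrite -e2; set w := s `^ (n%:R / 2 * s) in e1 *; set w' := s `^ (- (n%:R / 2) * s) in e1 *.
transitivity ((w * w') * ((4 * pi) `^ (- (n%:R / r)) * t `^ (1 - n%:R / r - 1) *
   (4 * pi * t) `^ (- (n%:R / 2) * s)) * expR (- (c * t)) * expR (- ((4 * t)^-1 * sqnorm (x - y)))).
  by rewrite e1; ring.
by ring.
Qed.

(** The exponents solve a linear system: a0 + a1 = s for the kernel, th a2 = 1 for [a], p (a1 + a3)
    = 1 for [h], total 1. The three inequalities assumed on the exponents say that a0, a1 and a3 are
    nonnegative, and the formula for 1/p1 says 1/p1 = a1 + 1/r. *)
Lemma heat_resolvent_bound (p p1 th : R) (h a b : 'rV[R]_n -> R) (A B P : R) :
  0 < p -> 0 < p1 -> 0 < th -> p1^-1 = p^-1 - r^-1 + th^-1 ->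
  p^-1 + th^-1 <= 1 -> 2 / r <= p^-1 + th^-1 -> th^-1 <= 2 / r ->
  measurable_fun setT h -> measurable_fun setT a -> measurable_fun setT b ->
  (forall x, 0 <= h x) -> (forall x, 0 <= a x) -> (forall x, 0 <= b x) -> 0 < A -> 0 < B ->
  (\int[mu]_x (a x `^ th)%:E <= A%:E)%E ->
  (\int[mu]_x (b x `^ r)%:E <= B%:E)%E ->
  (\int[mu]_x (h x `^ p)%:E < P%:E)%E ->
  (\int[mu]_x (((b x)%:E * heat_resolvent c (fun y => (a y * h y)%R) x) `^ p1) <=
   ((resolvent_const c r * A `^ th^-1 * B `^ r^-1 * P `^ p^-1) `^ p1)%:E)%E.
Proof.
move=> p0 p10 th0 p1E a0_ge0 a1_ge0 a3_ge0 mh ma mb h0 a_0 b0 A0 B0 IA IB IP.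
pose a0 := 1 - p^-1 - th^-1; pose a1 := p^-1 - 2 / r + th^-1.
pose a2 := th^-1; pose a3 := 2 / r - th^-1.
have S0 : 0 < resolvent_const c r.
  by rewrite !mulr_gt0 ?powR_gt0 ?Gamma_gt0// mulr_gt0 ?pi_gt0.
have a01 : a0 + a1 = s by rewrite /a0 /a1 /s; ring.
have H0 : 0 <= a0 by rewrite /a0; lra.
have H1 : 0 <= a1 by rewrite /a1; lra.
have H2 : 0 <= a2 by rewrite invr_ge0 ltW.
have H3 : 0 <= a3 by rewrite /a3; lra.
have H4 : a0 + a1 + a2 + a3 = 1 by rewrite /a0 /a1 /a2 /a3; ring.
have H5 : a0 + a1 != 0 by rewrite a01 lt0r_neq0.
have H6 : th * a2 = 1 by rewrite mulfV// lt0r_neq0.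
have a13 : a1 + a3 = p^-1 by rewrite /a1 /a3; ring.
have H7 : p * (a1 + a3) = 1 by rewrite a13 mulfV// lt0r_neq0.
have H8 : 0 <= r^-1 by rewrite invr_ge0 ltW.
have H9 : r * r^-1 = 1 by rewrite mulfV// lt0r_neq0.
have H10 : p1 * (a1 + r^-1) = 1.
  rewrite (_ : a1 + r^-1 = p1^-1) ?mulfV ?lt0r_neq0//.
  by rewrite p1E /a1; ring.
(* Any positive probability density would do for [eta]; the heat kernel at time 1 is at hand. *)
have eta0 x : 0 < heat_kernel 1 0 x :> R.
  by rewrite heat_kernelE// mulr_gt0 ?heat_peak_gt0// expR_gt0.
have := @schur_bound _ _ _ _ R leb mu om ka (heat_kernel 1 0) (resolvent_const c r)
  mom om0 S0 int_om mka (fun x z => heat_kernel_ge0 _ _ _) int_kar int_kal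
  (measurable_heat_kernel_y _ _) eta0 (integral_heat_kernel _ ltr01)
  a0 a1 a2 a3 th p r p1 r^-1 H0 H1 H2 H3 H4 H5 H6 H7 p10 H8 H9 H10 h a b A B P
  mh ma mb h0 a_0 b0 A0 B0 IA IB IP.
rewrite a13; apply: le_trans; rewrite le_eqVlt; apply/orP; left; apply/eqP.
apply: eq_integral => x _.
suff -> : heat_resolvent c (fun y => a y * h y) x = schur_op leb mu om ka a0 a1 h a x by [].
rewrite /heat_resolvent /schur_op /iterated integral_mkcond; apply: eq_integral => t _.
rewrite patchE; case: ifPn => [|tD].
  rewrite inE/= in_itv/= andbT => t0; apply: eq_integral => y _.
  by rewrite kernel_factor// a01 -!mulrA.
apply/esym; apply: integral0_eq => y _ /=.
by rewrite /om /D indicE (negbTE tD) !mul0r.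
Qed.

End resolvent_bound.

(** * Positivity, additivity and monotonicity of the resolvent *)

Section heat_resolvent_theory.
Context {R : realType} {n : nat}.
Local Notation mu := (@lebesgue_rV R n).
Local Notation leb := (@lebesgue_measure R).
Local Notation mR := (measurableTypeR R).
Implicit Types (c : R) (x y : 'rV[R]_n) (g : 'rV[R]_n -> R).

Let F c g x (z : mR * 'rV[R]_n) := expR (- (c * z.1)) * heat_kernel z.1 x z.2 * g z.2.

Lemma heat_resolventE c g x : heat_resolvent c g x = iterated leb mu (F c g x).
Proof.
rewrite /heat_resolvent /iterated integral_mkcond; apply: eq_integral => t _.
rewrite patchE; case: ifPn => // tD; apply/esym; apply: integral0_eq => y _.
rewrite /F /heat_kernel ifF ?mulr0 ?mul0r//; apply: negbTE.
by apply: contra tD => t0; rewrite inE/= in_itv/= t0.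
Qed.

Let mF c g : measurable_fun setT g ->
  measurable_fun setT (fun z : ('rV[R]_n * mR) * 'rV[R]_n => F c g z.1.1 (z.1.2, z.2)).
Proof.
move=> mg; apply: measurable_funM; last exact: (measurableT_comp mg measurable_snd).
apply: measurable_funM.
  apply: measurableT_comp => //; apply: measurableT_comp => //; apply: measurable_funM => //.
  exact: (measurableT_comp measurable_snd measurable_fst).
pose G (z : ('rV[R]_n * mR) * 'rV[R]_n) := ((z.1.2 : mR, z.1.1), z.2).
have mG : measurable_fun setT G.
  apply: measurable_fun_pair => //=; apply: measurable_fun_pair => /=.
    exact: (measurableT_comp measurable_snd measurable_fst).
  exact: (measurableT_comp measurable_fst measurable_fst).
exact: (measurableT_comp (@measurable_heat_kernel R n) mG).
Qed.

Let mFx c g x : measurable_fun setT g -> measurable_fun setT (F c g x).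
Proof.
move=> mg; pose G (z : mR * 'rV[R]_n) := ((x, z.1), z.2).
have mG : measurable_fun setT G.
  by apply: measurable_fun_pair => //; apply: measurable_fun_pair.
rewrite (_ : F c g x = (fun z => F c g z.1.1 (z.1.2, z.2)) \o G); last by apply/funext => -[].
exact: (measurableT_comp (mF c mg) mG).
Qed.

Let F0 c g x z : (forall y, 0 <= g y) -> 0 <= F c g x z.
Proof. by move=> g0; rewrite !mulr_ge0 ?expR_ge0 ?heat_kernel_ge0. Qed.

Lemma heat_resolvent_ge0 c g x : (forall y, 0 <= g y) -> (0 <= heat_resolvent c g x)%E.
Proof. by move=> g0; rewrite heat_resolventE; apply: iterated_ge0 => z; exact: F0. Qed.

Lemma measurable_heat_resolvent c g : measurable_fun setT g -> measurable_fun setT (heat_resolvent c g).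
Proof.
move=> mg; rewrite (_ : heat_resolvent c g = (fun x => iterated leb mu (F c g x))).
  exact: (measurable_iterated leb mu (mF c mg)).
by apply/funext => x; rewrite heat_resolventE.
Qed.

Lemma heat_resolventD c (f g : 'rV[R]_n -> R) x : measurable_fun setT f -> measurable_fun setT g ->
  (forall y, 0 <= f y) -> (forall y, 0 <= g y) ->
  heat_resolvent c (fun y => f y + g y) x = (heat_resolvent c f x + heat_resolvent c g x)%E.
Proof.
move=> mf mg f0 g0; rewrite !heat_resolventE -iteratedD; [|exact: mFx|exact: mFx|by move=> z; exact: F0|by move=> z; exact: F0].
by congr (iterated _ _ _); apply/funext => z; rewrite /F mulrDr.
Qed.

Lemma le_heat_resolvent c (f g : 'rV[R]_n -> R) x : measurable_fun setT f -> measurable_fun setT g ->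
  (forall y, 0 <= f y) -> (forall y, f y <= g y) -> (heat_resolvent c f x <= heat_resolvent c g x)%E.
Proof.
move=> mf mg f0 fg; rewrite !heat_resolventE; apply: le_iterated; [exact: mFx|exact: mFx|by move=> z; exact: F0|].
by move=> z; rewrite /F ler_wpM2l// mulr_ge0 ?expR_ge0 ?heat_kernel_ge0.
Qed.

Lemma heat_resolvent_ae_eq c (f g : 'rV[R]_n -> R) x : measurable_fun setT f -> measurable_fun setT g ->
  {ae mu, forall y, f y = g y} -> heat_resolvent c f x = heat_resolvent c g x.
Proof.
move=> mf mg fg; rewrite !heat_resolventE; apply: eq_integral => t _.
have sl h : measurable_fun setT h -> measurable_fun setT (fun y => (F c h x (t, y))%:E).
  move=> mh; apply/measurable_EFinP.
  exact: (measurableT_comp (mFx c x mh) (measurable_fun_pair (@measurable_cst _ _ _ _ setT (t : mR)) (@measurable_id _ _ setT))).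
apply: ae_eq_integral => //; try exact: sl.
by apply: filterS fg => y e _; rewrite /F e.
Qed.

End heat_resolvent_theory.

(* Chebyshev: the measure of [F + 2 de < w] is at most (s / de)^p + (S / de)^p1 integrated. *)
Lemma ae_le_approx d (T : measurableType d) (R : realType) (mu : {sigma_finite_measure set T -> \bar R})
    (F : T -> \bar R) (w : T -> R) (p p1 : R) : 0 < p -> 0 < p1 ->
  measurable_fun setT F -> measurable_fun setT w -> (forall x, 0 <= F x)%E ->
  (forall e : R, 0 < e -> exists (s : T -> R) (S : T -> \bar R),
    [/\ measurable_fun setT s /\ measurable_fun setT S,
        (forall x, 0 <= s x) /\ (forall x, 0 <= S x)%E,
        {ae mu, forall x, ((w x)%:E <= (s x)%:E + S x + F x)%E},
        (\int[mu]_x (s x `^ p)%:E <= e%:E)%E & (\int[mu]_x (S x `^ p1) <= e%:E)%E]) ->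
  {ae mu, forall x, ((w x)%:E <= F x)%E}.
Proof.
move=> p0 p10 mF mw F0 approx.
pose E (j : nat) := [set x | (F x + (2 * j.+1%:R^-1)%:E < (w x)%:E)%E].
have mE j : measurable (E j).
  have mFj : measurable_fun setT (fun x => F x + (2 * j.+1%:R^-1)%:E)%E.
    by apply: emeasurable_funD => //; exact: measurable_cst.
  have mwE : measurable_fun setT (fun x => (w x)%:E) by apply/measurable_EFinP.
  by rewrite -[E j]setTI; exact: measurable_lte.
have nE j : mu (E j) = 0%E.
  pose de : R := j.+1%:R^-1.
  have de0 : 0 < de by rewrite invr_gt0.
  have bound (e : R) : 0 < e -> (mu (E j) <= ((de `^ (- p) + de `^ (- p1)) * e)%:E)%E.
    move=> e0; have [s [S [[ms mS] [s0 S0] wsS Is IS]]] := approx e e0.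
    have i1 : (mu (E j) = \int[mu]_x (\1_(E j) x)%:E)%E by rewrite integral_indic ?setIT.
    have m1 : measurable_fun setT (fun x => (s x `^ p)%:E).
      by apply/measurable_EFinP; exact: (measurableT_comp (measurable_powR _) ms).
    have m2 : measurable_fun setT (fun x => S x `^ p1)%E by exact: (measurableT_comp (measurable_poweR _) mS).
    have dp : 0 <= de `^ (- p) by exact: powR_ge0.
    have dp1 : 0 <= de `^ (- p1) by exact: powR_ge0.
    have q1 x : (0 <= (de `^ (- p))%:E * (s x `^ p)%:E)%E by rewrite mule_ge0 ?lee_fin ?powR_ge0.
    have q2 x : (0 <= (de `^ (- p1))%:E * S x `^ p1)%E by rewrite mule_ge0 ?lee_fin ?poweR_ge0.
    have n1 : measurable_fun setT (fun x => (de `^ (- p))%:E * (s x `^ p)%:E)%E by exact: emeasurable_funM.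
    have n2 : measurable_fun setT (fun x => (de `^ (- p1))%:E * S x `^ p1)%E by exact: emeasurable_funM.
    apply: (@le_trans _ _ (\int[mu]_x ((de `^ (- p))%:E * (s x `^ p)%:E + (de `^ (- p1))%:E * S x `^ p1))%E); last first.
      rewrite ge0_integralD// ge0_integralZl_EFin//; last by move=> x _; rewrite lee_fin powR_ge0.
      rewrite ge0_integralZl_EFin//; last by move=> x _; exact: poweR_ge0.
      by rewrite mulrDl EFinD; apply: leeD; rewrite EFinM lee_wpmul2l ?lee_fin.
    rewrite i1; apply: ae_ge0_le_integral => //.
    - by apply/measurable_EFinP; exact: measurable_indic.
    - by move=> x _; rewrite adde_ge0.
    - exact: emeasurable_funD.
    apply: filterS wsS => x wx _; rewrite indicE.
    case: (boolP (x \in E j)) => [|_]; last by rewrite adde_ge0.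
    rewrite inE /E/= -/de => Fw.
    (* On E j the errors add up to more than 2 de, so one of [s x] and [S x] is at least [de]; [F x]
       is finite there and can be cancelled. *)
    have sS : ((2 * de)%:E < (s x)%:E + S x)%E.
      have Ff : F x \is a fin_num.
        rewrite ge0_fin_numE//; apply: le_lt_trans (lt_trans Fw (ltry _)).
        by rewrite leeDl// lee_fin mulr_ge0// ltW.
      by rewrite -(lteD2rE _ _ Ff) addeC; exact: lt_le_trans Fw wx.
    case: (leP de (s x)) => sd.
      apply: (@le_trans _ _ ((de `^ (- p))%:E * (s x `^ p)%:E)%E); last by rewrite leeDl.
      rewrite -EFinM lee_fin powRN mulrC ler_pdivlMr ?powR_gt0// mul1r.
      by apply: ge0_ler_powR; rewrite ?nnegrE// ltW.
    have Sd : (de%:E <= S x)%E.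
      rewrite leNgt; apply/negP => Sd; move: sS; apply/negP; rewrite -leNgt.
      rewrite (_ : 2 * de = de + de); last by ring.
      by rewrite EFinD; apply: leeD; rewrite ?lee_fin; exact: ltW.
    apply: (@le_trans _ _ ((de `^ (- p1))%:E * S x `^ p1)%E); last by rewrite leeDr.
    apply: (@le_trans _ _ ((de `^ (- p1))%:E * (de%:E `^ p1))%E).
      by rewrite poweR_EFin -EFinM powRN mulVf// lt0r_neq0// powR_gt0.
    apply: lee_wpmul2l; first by rewrite lee_fin.
    apply: gt0_ler_poweR => //; first exact: ltW.
    - by rewrite in_itv/= leey lee_fin ltW.
    - by rewrite in_itv/= leey S0.
  apply/eqP; rewrite eq_le measure_ge0 andbT.
  pose C := de `^ (- p) + de `^ (- p1).
  have C0 : 0 < C by rewrite addr_gt0 ?powR_gt0.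
  apply/lee_addgt0Pr => e e0; rewrite add0e.
  apply: le_trans (bound (e / C) _) _; first by rewrite divr_gt0.
  by rewrite lee_fin -/C mulrC divfK// lt0r_neq0.
have nU : mu.-negligible (\bigcup_j E j).
  by apply: negligible_bigcup => j; exists (E j); split; [exact: mE|exact: nE|by []].
apply: negligibleS nU => x /=; move/negP; rewrite -ltNge => Fw.
have Ff : F x \is a fin_num by rewrite ge0_fin_numE//; exact: lt_trans Fw (ltry _).
  move: Fw; rewrite -(fineK Ff) lte_fin => Fw.
  pose a := w x - fine (F x); have a0 : 0 < a by rewrite subr_gt0.
  pose j := Num.bound (2 / a); exists j => //=; rewrite /E/= -(fineK Ff) -EFinD lte_fin.
  have : 2 / a < j.+1%:R.
    by apply: lt_le_trans (archi_boundP _) _; [rewrite divr_ge0// ltW|rewrite ler_nat].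
  rewrite ltr_pdivrMr// => H.
  suff : 2 * j.+1%:R^-1 < a by rewrite /a ltrBrDl.
  by rewrite ltr_pdivrMr// mulrC.
Qed.

(** * The Birman-Schwinger operator *)

Section birman_schwinger_kernel.
Context {R : realType} {n : nat}.
Local Notation Rn := 'rV[R]_n.
Local Notation mu := (@lebesgue_rV R n).
Local Notation normc := Normc.normc.
Implicit Types (u f g : Rn -> R[i]) (p tau : R) (q : Rn -> R[i]) (x y : Rn).

Lemma integral_powered p f : 0 < p -> (\int[mu]_x (powered p f x)%:E = cLnorm p f `^ p)%E.
Proof.
move=> p0; rewrite /cLnorm (poweR_Lnorm mu (EFin \o (fun x => normc (f x))) (lt0r_neq0 p0)).
by apply: eq_integral => x _ /=; rewrite ger0_norm ?normc_ge0.
Qed.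

Lemma integral_powered_le p f (e : R) : 0 < p -> 0 <= e -> (cLnorm p f <= e%:E)%E ->
  (\int[mu]_x (powered p f x)%:E <= (e `^ p)%:E)%E.
Proof.
move=> p0 e0 fe; rewrite integral_powered// -poweR_EFin.
apply: gt0_ler_poweR => //; first exact: ltW.
- by rewrite in_itv/= leey Lnorm_ge0.
- by rewrite in_itv/= lee_fin e0 leey.
Qed.

Definition bracket tau y : R := (1 + sqnorm y) `^ (- (tau / 2)).

Lemma measurable_bracket tau : measurable_fun setT (bracket tau : Rn -> R).
Proof.
apply: (measurableT_comp (measurable_powR _) (g := fun x : Rn => 1 + sqnorm x)).
by apply: measurable_funD => //; exact: measurable_sqnorm.
Qed.

Lemma enorm_sqr (x : Rn) : enorm x ^+ 2 = sqnorm x.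
Proof. by rewrite /enorm sqr_sqrtr// sumr_ge0// => i _; exact: sqr_ge0. Qed.

Lemma normc_real (a : R) : 0 <= a -> normc (a%:C%C) = a.
Proof. by move=> a0; rewrite /= expr0n addr0 sqrtr_sqr ger0_norm. Qed.

Lemma normc_factor_a tau y : normc (factor_a tau y) = bracket tau y.
Proof. by rewrite /factor_a normc_real ?powR_ge0// enorm_sqr. Qed.

(** Unfolding the graph gives f = a u, a solution v of (-Delta - la) v = f, and g = b v, so that
    [weak_solution_le] bounds |v| by the resolvent of |a u|. *)
Lemma birman_schwinger_le p tau q la u g : 1 <= p -> complex.Re la < 0 ->
  birman_schwinger p tau q la u g ->
  {ae mu, forall x, ((normc (g x))%:E <= (normc (factor_b tau q x))%:E *
    heat_resolvent (- complex.Re la) (fun y => (bracket tau y * normc (u y))%R) x)%E}.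
Proof.
move=> p1 la0 [v [[f [[Lu Lf fE] [_ [l [[[Lv _] _ [w [wP lE]]] fE']]]]] [_ _ gE]]].
have fw : f = (fun x => - \sum_(i < n) w i x - la * v x) %[ae mu].
  move: fE' lE; apply: filterS2 => x /(_ Logic.I) -> /(_ Logic.I) lE _.
  by rewrite lE.
have vle := weak_solution_le p1 la0 Lv (fun i => (wP i).1) Lf (fun i => (wP i).2) fw.
have fle x : heat_resolvent (- complex.Re la) (fun y => normc (f y)) x =
    heat_resolvent (- complex.Re la) (fun y => bracket tau y * normc (u y)) x.
  apply: heat_resolvent_ae_eq.
  - by apply: measurable_normc; case: Lf.
  - by apply: measurable_funM; [exact: measurable_bracket|apply: measurable_normc; case: Lu].
  by apply: filterS fE => y /(_ Logic.I) ->; rewrite Normc.normcM normc_factor_a.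
move: vle gE; apply: filterS2 => x; rewrite fle => vx /(_ Logic.I) ->.
by rewrite Normc.normcM EFinM lee_wpmul2l// lee_fin normc_ge0.
Qed.

(** The kernel bound holds only on the domain of [birman_schwinger], where [u] need not lie. For v
    in this domain close to u, with image g, the errors are d = v - u and h = Q d = g + u, because Q
    u = -u; hence |u| <= |h| + |g|, and the boundedness of [Q] makes h small. *)
Lemma approx_eigenfunction p tau q la Q u : 1 <= p -> complex.Re la < 0 ->
  bounded_extension p (birman_schwinger p tau q la) Q -> Q u (fun x => -1 * u x) ->
  exists2 M : R, 0 < M & forall e : R, 0 < e -> exists (v d h : Rn -> R[i]),
    [/\ Lp p v, Lp p d, Lp p h, forall x, v x = u x + d x &
    [/\ (\int[mu]_x (powered p d x)%:E <= (e `^ p)%:E)%E,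
        (\int[mu]_x (powered p h x)%:E <= ((M * e) `^ p)%:E)%E
      & {ae mu, forall x, ((normc (u x))%:E <= (normc (h x))%:E + (normc (factor_b tau q x))%:E *
          heat_resolvent (- complex.Re la) (fun y => (bracket tau y * normc (v y))%R) x)%E}]].
Proof.
move=> p1 la0 [dense opQ _ [M0 QM] QT] Qu.
have p0 : 0 < p by exact: lt_le_trans p1.
(* The operator bound [M0] comes without a sign; the later estimates divide by a positive one. *)
pose M := `|M0| + 1; have M_gt0 : 0 < M by rewrite ltr_wpDl.
exists M => // e e0; have [Lu _] := operator_Lp opQ Qu.
have [v [g [Tvg ve]]] := dense u Lu e e0.
have Qvg := QT _ _ Tvg; have [Lv Lg] := operator_Lp opQ Qvg.
have Qd := operator_linear opQ (-1) Qu Qvg.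
have [Ld Lh] := operator_Lp opQ Qd.
exists v, (fun x => -1 * u x + v x), (fun x => -1 * (-1 * u x) + g x); split=> //.
  by move=> x; rewrite mulN1r addrA subrr add0r.
have de : (cLnorm p (fun x => -1 * u x + v x)%R <= e%:E)%E.
  apply: le_trans (ltW ve); rewrite le_eqVlt; apply/orP; left; apply/eqP.
  rewrite /cLnorm; congr Lnorm.body; apply/funext => x /=; congr (_%:E).
  by rewrite mulN1r -[in LHS](normcN (- u x + v x)) opprD opprK.
split.
- by apply: integral_powered_le => //; exact: ltW.
- apply: integral_powered_le => //; first by rewrite mulr_ge0// ltW.
  apply: le_trans (QM _ _ Qd) _; rewrite EFinM.
  apply: (@le_trans _ _ (M%:E * cLnorm p (fun x => -1 * u x + v x)%R)%E).
    apply: lee_wpmul2r; first exact: Lnorm_ge0.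
    by rewrite lee_fin /M; apply: le_trans (ler_norm _) _; rewrite lerDl.
  by apply: lee_wpmul2l => //; rewrite lee_fin ltW.
have := birman_schwinger_le p1 la0 Tvg; apply: filterS => x gx.
apply: le_trans (leeD2l _ gx); rewrite -EFinD lee_fin.
have -> : normc (u x) = normc ((-1 * (-1 * u x) + g x) + (- g x)).
  by rewrite addrK !mulN1r opprK.
by apply: le_trans (le_normcD _ _) _; rewrite normcN.
Qed.

End birman_schwinger_kernel.

(** * Fixed points of the weighted resolvent *)

Lemma powR_small {R : realType} (k a e : R) : 0 < k -> 0 < a -> 0 < e ->
  exists2 d : R, 0 < d & forall x, 0 <= x -> x <= d -> (k * x) `^ a <= e.
Proof.
move=> k0 a0 e0; exists (e `^ a^-1 / k); first by rewrite divr_gt0// powR_gt0.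
move=> x x0 xd; have -> : e = (e `^ a^-1) `^ a.
  by rewrite -powRrM mulVf ?lt0r_neq0// powRr1// ltW.
apply: ge0_ler_powR; rewrite ?nnegrE ?powR_ge0 ?mulr_ge0 ?(ltW k0) ?(ltW a0)//.
by move: xd; rewrite ler_pdivlMr// mulrC.
Qed.

Section fixed_point.
Context {R : realType} {n : nat}.
Local Notation Rn := 'rV[R]_n.
Local Notation mu := (@lebesgue_rV R n).
Implicit Types (x y : Rn) (h : Rn -> R) (p : R).
Variables (c r A : R) (al be : Rn -> R).
Hypotheses (c0 : 0 < c) (r2 : 2 < r) (nr : n%:R < r).
Hypotheses (mal : measurable_fun setT al) (al0 : forall x, 0 < al x) (al1 : forall x, al x <= 1).
Hypotheses (mbe : measurable_fun setT be) (be0 : forall x, 0 <= be x).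
Hypotheses (A0 : 0 < A) (int_al : (\int[mu]_x (al x `^ r)%:E <= A%:E)%E).

Let r0 : 0 < r. Proof. exact: lt_trans r2. Qed.

Definition weighted_resolvent h x : \bar R :=
  ((be x)%:E * heat_resolvent c (fun y => (al y * h y)%R) x)%E.

Let K := weighted_resolvent.

Let alh_ge0 h y : (forall y, 0 <= h y) -> 0 <= al y * h y.
Proof. by move=> h0; rewrite mulr_ge0// ltW. Qed.

Lemma weighted_resolvent_ge0 h x : (forall y, 0 <= h y) -> (0 <= K h x)%E.
Proof.
move=> h0; rewrite mule_ge0 ?lee_fin//; apply: heat_resolvent_ge0 => y; exact: alh_ge0.
Qed.

Lemma measurable_weighted_resolvent h : measurable_fun setT h -> measurable_fun setT (K h).
Proof.
move=> mh; apply: emeasurable_funM; first exact/measurable_EFinP.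
by apply: measurable_heat_resolvent; exact: measurable_funM.
Qed.

Lemma weighted_resolvent_le h h1 h2 x : measurable_fun setT h -> measurable_fun setT h1 ->
  measurable_fun setT h2 -> (forall y, 0 <= h y) -> (forall y, 0 <= h1 y) -> (forall y, 0 <= h2 y) ->
  (forall y, h y <= h1 y + h2 y) -> (K h x <= K h1 x + K h2 x)%E.
Proof.
move=> mh mh1 mh2 h0 h10 h20 hh; rewrite /K /weighted_resolvent -ge0_muleDr; first last.
- by apply: heat_resolvent_ge0 => y; exact: alh_ge0.
- by apply: heat_resolvent_ge0 => y; exact: alh_ge0.
apply: lee_wpmul2l; first by rewrite lee_fin.
rewrite -heat_resolventD; [|exact: measurable_funM|exact: measurable_funM
  |by move=> y; exact: alh_ge0|by move=> y; exact: alh_ge0].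
apply: le_heat_resolvent.
- exact: measurable_funM.
- by apply: measurable_funD; exact: measurable_funM.
- by move=> y; exact: alh_ge0.
- by move=> y; rewrite -mulrDr ler_wpM2l// ltW.
Qed.

(* K maps L_p to L_p1 under these conditions on the exponents. *)
Record admissible p p1 th : Prop := Admissible {
  admissible_p1 : 0 < p1 ;
  admissible_eq : p1^-1 = p^-1 - r^-1 + th^-1 ;
  admissible_le1 : p^-1 + th^-1 <= 1 ;
  admissible_ge : 2 / r <= p^-1 + th^-1 ;
  admissible_le2 : r <= th }.

Lemma admissible_r p : 1 < p -> p <= r -> r^-1 <= 1 - p^-1 -> admissible p p r.
Proof.
move=> p1 pr rp; have p0 : 0 < p by exact: lt_trans p1.
have ip : r^-1 <= p^-1 by rewrite lef_pV2 ?posrE.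
by split=> //; [rewrite subrK|lra|lra].
Qed.

(** The choice th = p' puts the largest exponent on the bounded weight and leads from L_p to L_r'.
    It applies when p < r', that is, p' > r, and then al^th <= al^r because al <= 1. *)
Lemma admissible_conj p : 1 < p -> 1 - p^-1 < r^-1 ->
  admissible p (1 - r^-1)^-1 (1 - p^-1)^-1.
Proof.
move=> p1 rp; have p0 : 0 < p by exact: lt_trans p1.
have ip : p^-1 < 1 by rewrite invf_lt1.
have ir : 2 / r < 1 by rewrite ltr_pdivrMr// mul1r.
have ir0 : 0 < r^-1 by rewrite invr_gt0.
split; rewrite ?invrK; try lra.
  by rewrite invr_gt0; lra.
by rewrite -[leLHS]invrK lef_pV2 ?posrE; lra.
Qed.

Let S := @resolvent_const R n c r.

Let S0 : 0 < S.
Proof.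
have g0 : 0 < 1 - n%:R / r by rewrite subr_gt0 ltr_pdivrMr ?mul1r.
have s0 : 0 < 1 - 2 / r by rewrite subr_gt0 ltr_pdivrMr ?mul1r.
by rewrite /S !mulr_gt0 ?powR_gt0 ?Gamma_gt0// mulr_gt0 ?pi_gt0.
Qed.

Variable B : R.
Hypotheses (B0 : 0 < B) (int_be : (\int[mu]_x (be x `^ r)%:E <= B%:E)%E).

Let const_gt0 th : 0 < S * A `^ th^-1 * B `^ r^-1.
Proof.
have a1 : 0 < A `^ th^-1 by exact: powR_gt0.
have b1 : 0 < B `^ r^-1 by exact: powR_gt0.
exact: mulr_gt0 (mulr_gt0 S0 a1) b1.
Qed.

Lemma weighted_resolvent_bound p p1 th h (P : R) : 0 < p -> admissible p p1 th ->
  measurable_fun setT h -> (forall y, 0 <= h y) -> (\int[mu]_x (h x `^ p)%:E < P%:E)%E ->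
  (\int[mu]_x (K h x `^ p1) <= ((S * A `^ th^-1 * B `^ r^-1 * P `^ p^-1) `^ p1)%:E)%E.
Proof.
move=> p0 [p10 e1 e2 e3 e4] mh h0 IP.
have th0 : 0 < th by exact: lt_le_trans e4.
have irt : th^-1 <= r^-1 by rewrite lef_pV2 ?posrE.
have ir0 : 0 < r^-1 by rewrite invr_gt0.
apply: heat_resolvent_bound => //; first by lra.
- by move=> x; exact: ltW.
(* Since 0 < al <= 1 and th >= r, the integral of al^th is at most that of al^r. *)
- apply: le_trans int_al; apply: ge0_le_integral => //.
  + by move=> x _; rewrite lee_fin powR_ge0.
  + by apply/measurable_EFinP; exact: (measurableT_comp (measurable_powR _) mal).
  + by apply/measurable_EFinP; exact: (measurableT_comp (measurable_powR _) mal).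
  + by move=> x _; rewrite lee_fin; apply: ger_powR => //; rewrite al0 al1.
Qed.

(** From v <= phi + d follows phi <= h + K d + K phi. The error h is small in L_p, and K d is small
    in L_p1 by the boundedness of K, so [ae_le_approx] removes both. *)
Lemma le_weighted_resolvent_approx p (phi : Rn -> R) (M : R) : 1 < p -> p <= r -> 0 < M ->
  measurable_fun setT phi -> (forall x, 0 <= phi x) ->
  (forall e : R, 0 < e -> exists v d h : Rn -> R,
    [/\ [/\ measurable_fun setT v, measurable_fun setT d & measurable_fun setT h],
        [/\ forall x, 0 <= v x, forall x, 0 <= d x & forall x, 0 <= h x],
        forall x, v x <= phi x + d x &
    [/\ (\int[mu]_x (d x `^ p)%:E <= (e `^ p)%:E)%E,
        (\int[mu]_x (h x `^ p)%:E <= ((M * e) `^ p)%:E)%E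
      & {ae mu, forall x, ((phi x)%:E <= (h x)%:E + K v x)%E}]]) ->
  {ae mu, forall x, ((phi x)%:E <= K phi x)%E}.
Proof.
move=> p1 pr M0 mphi phi0 approx; have p0 : 0 < p by exact: lt_trans p1.
(* For p >= r' the operator acts within L_p; for p < r' its values are taken in L_r'. *)
have [q [th adm]] : exists q th, admissible p q th.
  case: (leP r^-1 (1 - p^-1)) => rp; first by exists p, r; exact: admissible_r.
  by exists (1 - r^-1)^-1, (1 - p^-1)^-1; exact: admissible_conj.
have q0 := admissible_p1 adm.
apply: (ae_le_approx p0 q0) => //.
- exact: measurable_weighted_resolvent.
- by move=> x; exact: weighted_resolvent_ge0.
move=> e e0; pose C := S * A `^ th^-1 * B `^ r^-1.
have C0 : 0 < C by exact: const_gt0.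
have [d1 d10 H1] := powR_small M0 p0 e0.
have [d2 d20 H2] := powR_small (mulr_gt0 C0 (ltr0n R 2)) q0 e0.
pose ep := Num.min d1 d2.
have ep0 : 0 < ep by rewrite lt_min d10 d20.
have [v [d [h [[mv md mh] [v0 d0 h0] vd [Id Ih Kv]]]]] := approx ep ep0.
exists h, (K d); split.
- by split => //; exact: measurable_weighted_resolvent.
- by split => // x; exact: weighted_resolvent_ge0.
- apply: filterS Kv => x /le_trans; apply; rewrite -addeA leeD2l// addeC.
  exact: weighted_resolvent_le.
- by apply: le_trans Ih _; rewrite lee_fin H1 ?(ltW ep0)// ge_min lexx.
(* The factor 2 provides the strict inequality that [weighted_resolvent_bound] asks for. *)
have Id2 : (\int[mu]_x (d x `^ p)%:E < ((2 * ep) `^ p)%:E)%E.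
  apply: le_lt_trans Id _; rewrite lte_fin; apply: gt0_ltr_powR => //; rewrite ?nnegrE ?mulr_ge0 ?(ltW ep0)//.
  by rewrite ltr_pMl// ltr1n.
apply: le_trans (weighted_resolvent_bound p0 adm md d0 Id2) _.
rewrite lee_fin -powRrM mulfV ?lt0r_neq0// powRr1 ?mulr_ge0 ?(ltW ep0)// mulrA.
by apply: H2; rewrite ?(ltW ep0)// ge_min lexx orbT.
Qed.

Let self_bound p p1 th (phi : Rn -> R) (P : R) : 0 < p -> admissible p p1 th ->
  measurable_fun setT phi -> (forall x, 0 <= phi x) ->
  {ae mu, forall x, ((phi x)%:E <= K phi x)%E} ->
  (\int[mu]_x (phi x `^ p)%:E < P%:E)%E ->
  (\int[mu]_x (phi x `^ p1)%:E <= ((S * A `^ th^-1 * B `^ r^-1 * P `^ p^-1) `^ p1)%:E)%E.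
Proof.
move=> p0 adm mphi phi0 phiK IP; have p10 := admissible_p1 adm.
apply: le_trans (weighted_resolvent_bound p0 adm mphi phi0 IP).
apply: ae_ge0_le_integral => //.
- by move=> x _; rewrite lee_fin powR_ge0.
- by apply/measurable_EFinP; exact: (measurableT_comp (measurable_powR _) mphi).
- by move=> x _; exact: poweR_ge0.
- by apply: (measurableT_comp (measurable_poweR _)); exact: measurable_weighted_resolvent.
apply: filterS phiK => x phix _; rewrite -poweR_EFin.
apply: gt0_ler_poweR => //; first exact: ltW.
- by rewrite in_itv/= lee_fin phi0 leey.
- by rewrite in_itv/= leey weighted_resolvent_ge0.
Qed.

(** In this range K acts within L_p with norm at most S A^(1/r) B^(1/r), and the norm of [phi] is
    finite and nonzero, so it can be divided out of phi <= K phi. *)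
Let fixed_point_bound_r p (phi : Rn -> R) : 1 < p -> p <= r -> r^-1 <= 1 - p^-1 ->
  measurable_fun setT phi -> (forall x, 0 <= phi x) ->
  ~ {ae mu, forall x, phi x = 0} -> {ae mu, forall x, ((phi x)%:E <= K phi x)%E} ->
  (\int[mu]_x (phi x `^ p)%:E < +oo)%E -> 1 <= S * A `^ r^-1 * B `^ r^-1.
Proof.
move=> p1 pr rp mphi phi0 phiN phiK Ioo; have p0 : 0 < p by exact: lt_trans p1.
have mp : measurable_fun setT (fun x => (phi x `^ p)%:E).
  by apply/measurable_EFinP; exact: (measurableT_comp (measurable_powR _) mphi).
have I0 : (0 <= \int[mu]_x (phi x `^ p)%:E)%E by apply: integral_ge0 => x _; rewrite lee_fin powR_ge0.
have IE : (\int[mu]_x (phi x `^ p)%:E = (fine (\int[mu]_x (phi x `^ p)%:E))%:E)%E.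
  by rewrite fineK// ge0_fin_numE.
set I := fine _ in IE.
have Ipos : 0 < I.
  rewrite lt_neqAle -lee_fin -IE I0 andbT; apply/eqP => Iz; apply: phiN.
  have : ae_eq mu setT (fun x => (phi x `^ p)%:E) (cst 0%E).
    apply/(ae_eq_integral_abs mu measurableT mp).
    under eq_integral do rewrite gee0_abs ?lee_fin ?powR_ge0//.
    by rewrite IE -Iz.
  apply: filterS => x /(_ Logic.I) [/eqP]; rewrite powR_eq0 => /andP[/eqP].
  by [].
pose C := S * A `^ r^-1 * B `^ r^-1.
have C0 : 0 < C by exact: const_gt0.
have bound P : I < P -> I <= C `^ p * P.
  move=> IP; have P0 : 0 < P by exact: lt_trans IP.
  have := self_bound p0 (admissible_r p1 pr rp) mphi phi0 phiK (P := P).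
  rewrite IE lte_fin lee_fin => /(_ IP); rewrite -/C powRM ?powR_ge0 ?(ltW C0)//.
  by rewrite -powRrM mulVf ?lt0r_neq0// powRr1// ltW.
have Cp0 : 0 < C `^ p by exact: powR_gt0.
have Cp : 1 <= C `^ p.
  (* The estimate is known for P > I only; P is let tend to I. *)
  rewrite -(ler_pM2r Ipos) mul1r; apply/ler_addgt0Pr => e e0.
  have d0 : 0 < e / C `^ p by rewrite divr_gt0.
  have := bound (I + e / C `^ p); rewrite ltrDl => /(_ d0).
  by rewrite mulrDr mulrCA mulfV ?mulr1// lt0r_neq0.
rewrite leNgt; apply/negP => C1; move: Cp; apply/negP; rewrite -ltNge.
rewrite -[ltRHS](_ : 1 `^ p = 1); last by rewrite powR1.
by apply: gt0_ltr_powR; rewrite ?nnegrE// ltW.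
Qed.

(* For p < r' one application of K first improves the integrability from p to r'. *)
Lemma fixed_point_bound p (phi : Rn -> R) : 1 < p -> p <= r ->
  measurable_fun setT phi -> (forall x, 0 <= phi x) ->
  ~ {ae mu, forall x, phi x = 0} -> {ae mu, forall x, ((phi x)%:E <= K phi x)%E} ->
  (\int[mu]_x (phi x `^ p)%:E < +oo)%E -> 1 <= S * A `^ r^-1 * B `^ r^-1.
Proof.
move=> p1 pr mphi phi0 phiN phiK Ioo; have p0 : 0 < p by exact: lt_trans p1.
case: (leP r^-1 (1 - p^-1)) => rp; first exact: (fixed_point_bound_r p1 pr rp mphi).
have adm := admissible_conj p1 rp.
have ir : 2 / r < 1 by rewrite ltr_pdivrMr// mul1r.
have ir0 : 0 < r^-1 by rewrite invr_gt0.
have I0 : (0 <= \int[mu]_x (phi x `^ p)%:E)%E by apply: integral_ge0 => x _; rewrite lee_fin powR_ge0.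
have IE : (\int[mu]_x (phi x `^ p)%:E = (fine (\int[mu]_x (phi x `^ p)%:E))%:E)%E.
  by rewrite fineK// ge0_fin_numE.
have IP : (\int[mu]_x (phi x `^ p)%:E < (fine (\int[mu]_x (phi x `^ p)%:E) + 1)%:E)%E.
  by rewrite {1}IE lte_fin ltrDl.
apply: (fixed_point_bound_r (p := (1 - r^-1)^-1) _ _ _ mphi) => //.
- by rewrite -[ltLHS]invr1 ltf_pV2 ?posrE; lra.
- by rewrite -[leRHS]invrK lef_pV2 ?posrE ?invr_gt0; lra.
- by rewrite invrK; lra.
- exact: le_lt_trans (self_bound p0 adm mphi phi0 phiK IP) (ltry _).
Qed.

End fixed_point.

(** * The eigenvalue bound *)

Lemma bracket_integral {R : realType} (n : nat) (r tau : R) : n%:R < tau * r ->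
  (\int[@lebesgue_rV R n]_x (bracket tau x `^ r)%:E =
   (pi `^ (n%:R / 2) * (Gamma ((tau * r - n%:R) / 2) / Gamma (tau * r / 2)))%:E)%E.
Proof.
move=> taur; rewrite (_ : (tau * r - n%:R) / 2 = tau * r / 2 - n%:R / 2); last by ring.
rewrite -integral_bracket; last by lra.
by apply: eq_integral => x _; rewrite /bracket -powRrM; congr ((_ `^ _)%:E); ring.
Qed.

(** The r-th power of c^(-(1 - n/r)) is c^(-(r - n)): this is how |Re lambda|^(r - n) arises in the
    final bound, with -Re lambda for c. *)
Lemma resolvent_constE {R : realType} (n : nat) (c r : R) : 0 < c -> 2 < r -> n%:R < r ->
  c `^ (r - n%:R) * @resolvent_const R n c r `^ r = C_const n r.
Proof.
move=> c0 r2 nr; have r0 : 0 < r by exact: lt_trans r2.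
have g0 : 0 < 1 - n%:R / r by rewrite subr_gt0 ltr_pdivrMr ?mul1r.
have p0 : 0 < 4 * pi :> R by rewrite mulr_gt0 ?pi_gt0.
rewrite /resolvent_const /C_const.
set G := Gamma _; have G0 : 0 < G by exact: Gamma_gt0.
rewrite (powRM r (mulr_ge0 (powR_ge0 _ _) (powR_ge0 _ _)) (mulr_ge0 (powR_ge0 _ _) (ltW G0))).
rewrite (powRM r (powR_ge0 _ _) (powR_ge0 _ _)) (powRM r (powR_ge0 _ _) (ltW G0)) -!powRrM.
have -> : - (n%:R / r) * r = - n%:R by field; exact: lt0r_neq0.
have -> : n%:R / 2 * (1 - 2 / r) * r = n%:R * (r - 2) / 2 by field; exact: lt0r_neq0.
have -> : - (1 - n%:R / r) * r = - (r - n%:R) by field; exact: lt0r_neq0.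
rewrite (powRN c) powRN powR_mulrn ?(ltW p0)//.
have cr : c `^ (r - n%:R) != 0 by rewrite lt0r_neq0// powR_gt0.
set x := c `^ (r - n%:R) in cr *; set z := _ `^ (n%:R * (r - 2) / 2).
have -> : x * ((4 * pi) ^- n * z * (x^-1 * G `^ r)) = (x * x^-1) * ((4 * pi) ^- n * z * G `^ r) by ring.
by rewrite mulfV// mul1r.
Qed.

Theorem corollary4p4 (R : realType) (n : nat) (p r tau : R)
    (q : 'rV[R]_n -> R[i])
    (H : ('rV[R]_n -> R[i]) -> ('rV[R]_n -> R[i]) -> Prop)
    (n_ge3 : (3 <= n)%N) (p_gt1 : 1 < p)
    (q_meas : cmeasurable q)
    (q_Lr : Lp r (factor_b tau q))
    (taur_gt : n%:R < tau * r)
    (r_small_p : p <= n%:R -> n%:R < r)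
    (r_large_p : n%:R < p -> p <= r)
    (standing : standing_assumptions p tau q)
    (H_schrodinger : schrodinger_operator p tau q H)
    (lambda : R[i]) (lambda_eig : op_eigenvalue H lambda)
    (lambda_neg : complex.Re lambda < 0) :
  ((`|complex.Re lambda| `^ (r - n%:R))%:E <=
   (C1_const n r tau)%:E *
   \int[lebesgue_rV n]_x (Normc.normc (factor_b tau q x) `^ r)%:E)%E.
Proof.
have n3 : 3 <= n%:R :> R by rewrite (ler_nat _ 3).
(* Both ranges of [p] reduce to the same two inequalities, the only ones used from here on. *)
have [pr nr] : p <= r /\ n%:R < r.
  case: (leP p n%:R) => pn; last by have pr := r_large_p pn; split=> //; exact: lt_le_trans pr.
  by have nr := r_small_p pn; split=> //; exact: le_trans pn (ltW nr).
have r2 : 2 < r by lra.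
have r0 : 0 < r by lra.
have p0 : 0 < p by lra.
(* Needed for the weight to be at most 1. *)
have tau0 : 0 < tau by rewrite -(pmulr_lgt0 _ r0); lra.
have nlambda : ~ 0 <= lambda by rewrite lecE => /andP[_]; rewrite leNgt lambda_neg.
have [Q [extQ [u [u0 Qu]]]] := (schrodinger_eigenvalue H_schrodinger nlambda).1 lambda_eig.
have [_ opQ _ _ _] := extQ; have [Lu _] := operator_Lp opQ Qu.
have [M M0 approx] := approx_eigenfunction (ltW p_gt1) lambda_neg extQ Qu.
pose c := - complex.Re lambda.
have c0 : 0 < c by rewrite oppr_gt0.
set mu := lebesgue_rV n.
pose be (x : 'rV[R]_n) := Normc.normc (factor_b tau q x).
pose phi (x : 'rV[R]_n) := Normc.normc (u x).
have mbe : measurable_fun setT be by apply: measurable_normc; case: q_Lr.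
have mphi : measurable_fun setT phi by apply: measurable_normc; case: Lu.
have be0 x : 0 <= be x by exact: normc_ge0.
have phi0 x : 0 <= phi x by exact: normc_ge0.
pose A := pi `^ (n%:R / 2) * (Gamma ((tau * r - n%:R) / 2) / Gamma (tau * r / 2)).
have A0 : 0 < A.
  rewrite mulr_gt0 ?powR_gt0 ?pi_gt0// divr_gt0 ?Gamma_gt0//; rewrite divr_gt0//; lra.
have int_al : (\int[mu]_x (bracket tau x `^ r)%:E <= A%:E)%E by rewrite bracket_integral.
have al0 (x : 'rV[R]_n) : 0 < bracket tau x by rewrite powR_gt0// ltr_wpDr ?sqnorm_ge0.
have al1 (x : 'rV[R]_n) : bracket tau x <= 1.
  rewrite /bracket powRN invf_le1 ?powR_gt0//; last by rewrite ltr_wpDr ?sqnorm_ge0.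
  rewrite [leLHS](_ : 1 = 1 `^ (tau / 2)); last by rewrite powR1.
  apply: ge0_ler_powR; rewrite ?nnegrE ?addr_ge0 ?sqnorm_ge0//; first by rewrite divr_ge0// ltW.
  by rewrite lerDl sqnorm_ge0.
have mal : measurable_fun setT (bracket tau : 'rV[R]_n -> R) by exact: measurable_bracket.
have Ib0 : (0 <= \int[mu]_x (be x `^ r)%:E)%E by apply: integral_ge0 => x _; rewrite lee_fin powR_ge0.
have IbE : (\int[mu]_x (be x `^ r)%:E = (fine (\int[mu]_x (be x `^ r)%:E))%:E)%E.
  have := integrable_fin_num measurableT (Lp_integrable r0 q_Lr).
  by move=> If; rewrite fineK.
set Ib := fine _ in IbE.
have Ib_ge0 : 0 <= Ib by rewrite -lee_fin -IbE.
have Iphi : (\int[mu]_x (phi x `^ p)%:E < +oo)%E.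
  have := integral_powered u p0 => ->; apply: poweR_lty; exact: Lu.2.
have phiN : ~ {ae mu, forall x, phi x = 0}.
  by move=> phiz; apply: u0; apply: filterS phiz => x /Normc.eq0_normc.
(* [Ib] might be 0, whereas the resolvent bounds take a positive [B]; the estimate is proved for all
   B > Ib and B is sent to Ib afterwards. *)
have int_be B : Ib < B -> (\int[mu]_x (be x `^ r)%:E <= B%:E)%E.
  by move=> /ltW IB; rewrite IbE lee_fin.
have phiK : {ae mu, forall x, ((phi x)%:E <= weighted_resolvent c (bracket tau) be phi x)%E}.
  have B0 : 0 < Ib + 1 by rewrite ltr_wpDl.
  have IB : Ib < Ib + 1 by rewrite ltrDl.
  apply: (le_weighted_resolvent_approx c0 r2 nr mal al0 al1 mbe be0 A0 int_al B0 (int_be _ IB) p_gt1 pr M0 mphi phi0).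
  move=> e e0; have [v [d [h [Lv Ld Lh vE [Id Ih vK]]]]] := approx e e0.
  exists (fun x => Normc.normc (v x)), (fun x => Normc.normc (d x)), (fun x => Normc.normc (h x)).
  split => //.
  - by split; apply: measurable_normc; [case: Lv|case: Ld|case: Lh].
  - by split => x; exact: normc_ge0.
  - by move=> x; rewrite vE; exact: le_normcD.
pose S := @resolvent_const R n c r.
have S0 : 0 <= S.
  have g0 : 0 < 1 - n%:R / r by rewrite subr_gt0 ltr_pdivrMr ?mul1r.
  by rewrite /S !mulr_ge0 ?powR_ge0// ltW// Gamma_gt0.
have bound B : Ib < B -> 1 <= S `^ r * A * B.
  move=> IB; have B0 : 0 < B by exact: le_lt_trans IB.
  have := fixed_point_bound c0 r2 nr mal al0 al1 mbe be0 A0 int_al B0 (int_be _ IB) p_gt1 pr mphi phi0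
    phiN phiK Iphi.
  move=> H1; have := ge0_ler_powR (ltW r0) _ _ H1; rewrite !nnegrE powR1.
  have a0 : 0 <= A `^ r^-1 by exact: powR_ge0.
  have b0 : 0 <= B `^ r^-1 by exact: powR_ge0.
  move=> /(_ ler01 (mulr_ge0 (mulr_ge0 S0 a0) b0)).
  rewrite (powRM r (mulr_ge0 S0 a0) b0) (powRM r S0 a0) -!powRrM mulVf ?lt0r_neq0//.
  by rewrite !powRr1// ltW.
have D0 : 0 <= S `^ r * A by rewrite mulr_ge0 ?powR_ge0// ltW.
(* The increment is divided by S^r A + 1, positive even if S^r A were 0, so that it contributes at
   most [e]. *)
have main : 1 <= S `^ r * A * Ib.
  apply/ler_addgt0Pr => e e0.
  have d0 : 0 < e / (S `^ r * A + 1) by rewrite divr_gt0// ltr_wpDl.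
  have := bound (Ib + e / (S `^ r * A + 1)); rewrite ltrDl => /(_ d0) /le_trans; apply.
  rewrite mulrDr lerD2l mulrCA ler_piMr ?(ltW e0)// ler_pdivrMr ?mul1r ?lerDl//.
  by rewrite ltr_wpDl.
rewrite IbE -EFinM lee_fin ltr0_norm// -/c.
have -> : C1_const n r tau = C_const n r * A by rewrite /C1_const /A; ring.
rewrite -(resolvent_constE c0 r2 nr) -/S -[leLHS]mulr1.
have -> : c `^ (r - n%:R) * S `^ r * A * Ib = c `^ (r - n%:R) * (S `^ r * A * Ib) by ring.
by rewrite ler_wpM2l ?powR_ge0.
Qed.
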